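(* Let $\lambda,\mu>0$, let $f\in L^2(Q)$, and let $u\in V^{\Delta_x}_{0,\underline{0}}$ be the solution of $\partial_t u-\Delta_x u=f$ in $Q$, $u=0$ on $\Sigma$, $u=0$ on $\Sigma_0$. For any $v\in V^{\Delta_x}_{0,\underline{0}}$ and any $\boldsymbol{y}\in H^{\mathrm{div}_x,0}(Q)$, with $e:=u-v$, the following estimate holds for all $\gamma\in[\tfrac12,+\infty)$ and all $\alpha_1,\alpha_2>0$: $$(2-\tfrac1\gamma)\big(\lambda\|\nabla_x e\|_Q^2+\mu\|\partial_t e\|_Q^2\big)+\mu\|\nabla_x e\|_{\Sigma_T}^2+\lambda\|e\|_{\Sigma_T}^2\le \overline{\mathrm M}^{\mathrm I}(v,\boldsymbol y;\gamma,\alpha_i),$$ where $$\overline{\mathrm M}^{\mathrm I}(v,\boldsymbol y;\gamma,\alpha_i):=\gamma\Big\{\lambda\Big((1+\alpha_1)\|\mathbf r_{\rm d}\|_Q^2+(1+\tfrac1{\alpha_1})C_{\rm F}^2\|\mathbf r_{\rm eq}\|_Q^2\Big)+\mu\Big((1+\alpha_2)\|\mathrm{div}_x\mathbf r_{\rm d}\|_Q^2+(1+\tfrac1{\alpha_2})\|\mathbf r_{\rm eq}\|_Q^2\Big)\Big\},$$ with $\mathbf r_{\rm eq}=\mathbf r_{\rm eq}(v,\boldsymbol y):=f-\partial_t v+\mathrm{div}_x\boldsymbol y$ and $\mathbf r_{\rm d}=\mathbf r_{\rm d}(v,\boldsymbol y):=\boldsymbol y-\nabla_x v$.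
   Context: $\Omega\subset\mathbb R^d$, $d\in\{1,2,3\}$, is a bounded Lipschitz domain, $0<T<+\infty$, $Q:=\Omega\times(0,T)$, $\Sigma:=\partial\Omega\times(0,T)$, $\Sigma_0:=\Omega\times\{0\}$, $\Sigma_T:=\Omega\times\{T\}$. $\nabla_x$, $\mathrm{div}_x$, $\Delta_x$ are the gradient, divergence and Laplacian in the spatial variables, and $\partial_t$ is the time derivative. $\|\cdot\|_Q$ and $\|\cdot\|_{\Sigma_T}$ are the $L^2(Q)$ and $L^2(\Sigma_T)$ norms (also for vector-valued functions). $H^1_0(Q):=\{u\in H^1(Q): u=0\text{ on }\Sigma\}$ and $V^{\Delta_x}_{0,\underline 0}:=\{u\in H^1_0(Q): \Delta_x u\in L^2(Q),\ u=0\text{ on }\Sigma_0\}$. $H^{\mathrm{div}_x,0}(Q):=\{\boldsymbol y\in[L^2(Q)]^d:\mathrm{div}_x\boldsymbol y\in L^2(Q)\}$. $C_{\rm F}>0$ is the constant in the Friedrichs inequality $\|w\|_Q\le C_{\rm F}\|\nabla_x w\|_Q$ for all $w\in L^2(Q)$ with $\nabla_x w\in[L^2(Q)]^d$ and $w=0$ on $\Sigma$. For $w\in V^{\Delta_x}_{0,\underline 0}$ the map $t\mapsto w(\cdot,t)$ is continuous with values in $H^1_0(\Omega)$, so $\|\nabla_x w\|_{\Sigma_T}$ is meaningful. For $f\in L^2(Q)$ and zero initial data the problem is uniquely solvable in $V^{\Delta_x}_{0,\underline 0}$. *)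

(* Defs.v *)
From HB Require Import structures.
From mathcomp Require Import all_boot all_order all_algebra.
From mathcomp Require Import all_classical all_reals all_analysis.
Set Implicit Arguments. Unset Strict Implicit. Unset Printing Implicit Defensive.
Import Order.TTheory GRing.Theory Num.Theory.
Import numFieldNormedType.Exports.

Local Open Scope classical_set_scope.
Local Open Scope ring_scope.

Definition rV_display : measure_display -> measure_display.
Proof. exact. Qed.

Section measurable_rV.
Context {d} {T : sigmaRingType d}.
Variable n : nat.

Let coord : 'I_n -> 'rV[T]_n -> T := fun i v => v ord0 i.

Let rV_set0 : g_sigma_preimage coord set0.
Proof. exact: sigma_algebra0. Qed.

Let rV_setC A : g_sigma_preimage coord A -> g_sigma_preimage coord (~` A).
Proof. exact: sigma_algebraC. Qed.

Let rV_bigcup (F : _^nat) : (forall i, g_sigma_preimage coord (F i)) ->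
  g_sigma_preimage coord (\bigcup_i (F i)).
Proof. exact: sigma_algebra_bigcup. Qed.

(* The product sigma-algebra; for T = R it is the Borel sigma-algebra of R^n. *)
HB.instance Definition _ := @isMeasurable.Build (rV_display d)
  'rV[T]_n (g_sigma_preimage coord) rV_set0 rV_setC rV_bigcup.

End measurable_rV.

Lemma measurable_coord d (T : sigmaRingType d) n (i : 'I_n) :
  measurable_fun [set: 'rV[T]_n] (fun v : 'rV[T]_n => v ord0 i).
Proof.
move=> _ A mA; rewrite setTI; apply: sub_sigma_algebra.
case: n i => [[] []//|n i]; rewrite -bigcup_mkord_ord.
exists i; first exact: ltn_ord.
by exists A => //; rewrite inord_val setTI.
Qed.

Lemma measurable_fun_rVP d d' (aT : measurableType d) (T : measurableType d') n
    (f : aT -> 'rV[T]_n) :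
  (forall i, measurable_fun setT (fun x => f x ord0 i)) -> measurable_fun setT f.
Proof.
move=> mf.
apply: (@measurability _ _ _ _ _ f
  (\big[setU/set0]_(i < n) preimage_set_system setT
     (fun v : 'rV[T]_n => v ord0 i) measurable)) => //.
move=> _ [A + <-]; case: n => [|n] in f mf A *; first by rewrite big_ord0.
rewrite -bigcup_mkord_ord => -[i Ii [B mB <-]].
by rewrite setTI; apply: mf.
Qed.

(* The point (x, t) of R^n * R, seen in R^(n+1): the last coordinate is t. *)
Definition rcons_rV (T : Type) n (p : 'rV[T]_n * T) : 'rV[T]_n.+1 :=
  \row_i oapp (p.1 ord0) p.2 (unlift ord_max i).

Section lebesgue_rV.
Context {R : realType}.

Lemma measurable_rcons_rV n :
  measurable_fun [set: 'rV[measurableTypeR R]_n * measurableTypeR R] (@rcons_rV (measurableTypeR R) n).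
Proof.
apply: measurable_fun_rVP => i; rewrite /rcons_rV.
case: (unliftP ord_max i) => [j ->|->].
  apply: (eq_measurable_fun (fun p : 'rV[R]_n * R => p.1 ord0 j)).
    by move=> p _; rewrite mxE liftK.
  exact: measurableT_comp (measurable_coord j) measurable_fst.
apply: (eq_measurable_fun (snd : 'rV[R]_n * R -> R)).
  by move=> p _; rewrite mxE unlift_none.
exact: measurable_snd.
Qed.


Lemma rcons_rV_bij n : bijective (@rcons_rV R n).
Proof.
exists (fun v : 'rV[R]_n.+1 => (\row_j v ord0 (lift ord_max j), v ord0 ord_max)).
  move=> [x t]; congr pair; last by rewrite /= mxE unlift_none.
  by apply/rowP => j; rewrite !mxE liftK.
move=> v; apply/rowP => i; rewrite !mxE.
by case: unliftP => [j ->|->] //=; rewrite mxE.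
Qed.

Section succ.
Variables (n : nat) (m : {sigma_finite_measure set 'rV[R]_n -> \bar R}).
Local Open Scope ereal_scope.

Definition lebesgue_rV_succ : set 'rV[R]_n.+1 -> \bar R :=
  pushforward (m \x @lebesgue_measure R) (@rcons_rV R n).

Let pf := measure_function_pushforward__canonical__measure_function_Measure
  (m \x @lebesgue_measure R) (@measurable_rcons_rV n).

Let succ0 : lebesgue_rV_succ set0 = 0.
Proof. exact: (measure0 pf). Qed.

Let succ_ge0 A : 0 <= lebesgue_rV_succ A.
Proof. exact: (measure_ge0 pf). Qed.

Let succ_sigma_additive : semi_sigma_additive lebesgue_rV_succ.
Proof. exact: (@measure_semi_sigma_additive _ _ _ pf). Qed.

HB.instance Definition _ := isMeasure.Build _ _ _ lebesgue_rV_succ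
  succ0 succ_ge0 succ_sigma_additive.

Let succ_sigma_finite : sigma_finite setT lebesgue_rV_succ.
Proof.
have [g fg gf] := rcons_rV_bij n.
have /sigma_finiteP[F [TF ndF Foo]] := sigma_finiteT m.
have /sigma_finiteP[G [TG ndG Goo]] := sigma_finiteT (@lebesgue_measure R).
exists (fun k => g @^-1` (F k `*` G k)).
  rewrite predeqE => v; split => // _; rewrite /preimage /=.
  have [k _ Fk] : (\bigcup_k F k) (g v).1 by rewrite -TF.
  have [l _ Gl] : (\bigcup_k G k) (g v).2 by rewrite -TG.
  exists (maxn k l) => //; split.
    by move: Fk; exact/subsetPset/ndF/leq_maxl.
  by move: Gl; exact/subsetPset/ndG/leq_maxr.
move=> k; have [mFk Fk] := Foo k; have [mGk Gk] := Goo k; split; last first.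
  rewrite /lebesgue_rV_succ /pushforward.
  have -> : @rcons_rV R n @^-1` (g @^-1` (F k `*` G k)) = F k `*` G k.
    by rewrite predeqE => z; rewrite /preimage /= fg.
  rewrite [ltLHS]product_measure1E//.
  by rewrite lte_mul_pinfty// ge0_fin_numE.
have {mFk mGk}mFG := measurableX mFk mGk.
have gE : g = (fun v : 'rV[R]_n.+1 => (\row_j v ord0 (lift ord_max j), v ord0 ord_max)).
  apply/funext => v; apply: (can_inj fg); rewrite gf.
  apply/rowP => i; rewrite !mxE.
  by case: unliftP => [j ->|->] //=; rewrite mxE.
rewrite -[X in measurable X]setTI gE; move: mFG.
suff : measurable_fun setT (fun v : 'rV[R]_n.+1 =>
    ((\row_j v ord0 (lift ord_max j) : 'rV[R]_n), v ord0 ord_max)) by move=> + mFG; apply.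
apply/measurable_fun_pairP; split; last exact: measurable_coord.
apply: measurable_fun_rVP => i.
apply: (eq_measurable_fun (fun v : 'rV[R]_n.+1 => v ord0 (lift ord_max i))).
  by move=> v _; rewrite /= mxE.
exact: measurable_coord.
Qed.

HB.instance Definition _ := @Measure_isSigmaFinite.Build _ _ _ lebesgue_rV_succ
  succ_sigma_finite.

End succ.

(* Lebesgue measure on R^n, obtained by iterated products. *)
Fixpoint lebesgue_rV n : {sigma_finite_measure set 'rV[R]_n -> \bar R} :=
  match n return {sigma_finite_measure set 'rV[R]_n -> \bar R} with
  | 0 => dirac (0 : 'rV[R]_0)
  | n'.+1 => lebesgue_rV_succ (lebesgue_rV n')
  end.

Lemma lebesgue_rVS n :
  lebesgue_rV n.+1 = lebesgue_rV_succ (lebesgue_rV n) :> (set _ -> \bar R).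
Proof. by []. Qed.
End lebesgue_rV.

Section smooth_functions.
Context {R : realType} {n : nat}.
Implicit Types (D : set 'rV[R]_n) (phi : 'rV[R]_n -> R).

Definition partial (i : 'I_n) phi : 'rV[R]_n -> R :=
  fun x => 'D_(delta_mx 0 i) phi x.

(* C^infty on the whole of R^n: every iterated partial derivative exists and is
   continuous. *)
Definition smooth phi := forall s : seq 'I_n,
  let phi_s := foldr partial phi s in
  continuous phi_s /\ forall i x, derivable phi_s x (delta_mx 0 i).

Definition test_function D phi :=
  smooth phi /\ exists2 K, compact K & K `<=` D /\ forall x, ~ K x -> phi x = 0.

End smooth_functions.

Section sobolev.
Context {R : realType} {n : nat}.
Local Notation mu := (lebesgue_rV n).
Implicit Types (D : set 'rV[R]_n) (w g phi : 'rV[R]_n -> R).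

(* Elements of function spaces are represented by functions defined on all of
   R^n; their values outside D are irrelevant. *)
Definition L2 D w := w \_ D \in Lfun mu 2%:E.

Definition normL2 D w : R := fine 'N[mu]_2%:E[EFin \o (w \_ D)].

Definition L2v D m (y : 'rV[R]_n -> 'rV[R]_m) :=
  forall j, L2 D (fun z => y z 0 j).

Definition normL2v D m (y : 'rV[R]_n -> 'rV[R]_m) : R :=
  Num.sqrt (\sum_j normL2 D (fun z => y z 0 j) ^+ 2).

Definition is_weak_partial D (i : 'I_n) w g := L2 D g /\
  forall phi, test_function D phi ->
    \int[mu]_(z in D) (w z * partial i phi z) =
    - \int[mu]_(z in D) (g z * phi z).

Definition has_weak_partial D i w := exists g, is_weak_partial D i w g.

(* The weak derivative, unique up to a null subset of D; it is the zero function
   when there is no weak derivative in L^2(D). *)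
Definition weak_partial D i w : 'rV[R]_n -> R :=
  xget (fun=> 0) [set g | is_weak_partial D i w g].

Definition weak_grad D w : 'rV[R]_n -> 'rV[R]_n :=
  fun z => \row_i weak_partial D i w z.

Definition H1 D w := L2 D w /\ forall i, has_weak_partial D i w.

Definition normH1 D w : R :=
  Num.sqrt (normL2 D w ^+ 2 + normL2v D (weak_grad D w) ^+ 2).

(* The closure of the test functions in H^1(D). *)
Definition H10 D w := H1 D w /\ exists phi_ : nat -> 'rV[R]_n -> R,
  (forall k, test_function D (phi_ k)) /\
  normH1 D (phi_ k \- w) @[k --> \oo] --> (0 : R).

End sobolev.

Section domain.
Context {R : realType} {d : nat}.
Implicit Types Omega : set 'rV[R]_d.

Definition dot (x y : 'rV[R]_d) : R := \sum_i x 0 i * y 0 i.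

(* Near each boundary point and for some unit vector nu, Omega is the strict
   subgraph in direction nu of a Lipschitz function on the hyperplane
   orthogonal to nu. *)
Definition lipschitz_boundary Omega :=
  forall x0, (closure Omega `\` Omega) x0 ->
  exists (nu : 'rV[R]_d) (psi : 'rV[R]_d -> R),
    [/\ dot nu nu = 1, lipschitz psi &
        \forall x \near x0, Omega x <-> dot x nu < psi (x - dot x nu *: nu)].

Definition bounded_lipschitz_domain Omega :=
  [/\ Omega !=set0, open Omega, connected Omega, bounded_set Omega &
      lipschitz_boundary Omega].

End domain.

Section space_time.
Context {R : realType} {d : nat}.
Implicit Types (Omega : set 'rV[R]_d) (T : R) (w : 'rV[R]_d.+1 -> R)
  (y : 'rV[R]_d.+1 -> 'rV[R]_d).

Definition space (z : 'rV[R]_d.+1) : 'rV[R]_d := \row_j z 0 (lift ord_max j).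
Definition time (z : 'rV[R]_d.+1) : R := z 0 ord_max.

Definition cylinder Omega T : set 'rV[R]_d.+1 :=
  [set z | Omega (space z) /\ 0 < time z < T].

Definition dt Omega T w := weak_partial (cylinder Omega T) ord_max w.

Definition gradx Omega T w : 'rV[R]_d.+1 -> 'rV[R]_d :=
  fun z => \row_j weak_partial (cylinder Omega T) (lift ord_max j) w z.

Definition is_divx Omega T y g := L2 (cylinder Omega T) g /\
  forall phi, test_function (cylinder Omega T) phi ->
    \int[lebesgue_rV d.+1]_(z in cylinder Omega T)
      (\sum_j y z 0 j * partial (lift ord_max j) phi z) =
    - \int[lebesgue_rV d.+1]_(z in cylinder Omega T) (g z * phi z).

Definition has_divx Omega T y := exists g, is_divx Omega T y g.

Definition divx Omega T y : 'rV[R]_d.+1 -> R :=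
  xget (fun=> 0) [set g | is_divx Omega T y g].

Definition lapx Omega T w := divx Omega T (gradx Omega T w).

(* w in L^2(Q) with spatial gradient in L^2(Q)^d. *)
Definition L2H1 Omega T w := L2 (cylinder Omega T) w /\
  forall j, has_weak_partial (cylinder Omega T) (lift ord_max j) w.

(* w = 0 on the lateral boundary Sigma, for w in L2H1: w is a limit, in the norm
   of L2H1, of smooth functions that vanish near Sigma. *)
Definition zero_on_Sigma Omega T w :=
  exists phi_ : nat -> 'rV[R]_d.+1 -> R,
  [/\ forall k, smooth (phi_ k) /\ exists2 K, compact K &
        K `<=` Omega /\ forall z, ~ K (space z) -> phi_ k z = 0,
      normL2 (cylinder Omega T) (phi_ k \- w) @[k --> \oo] --> (0 : R) &
      normL2v (cylinder Omega T) (gradx Omega T (phi_ k \- w))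
        @[k --> \oo] --> (0 : R)].

(* w = 0 on Sigma_0, for w in H^1(Q): the trace on Sigma_0 is the continuous
   extension of the restriction of smooth functions. *)
Definition zero_on_Sigma0 Omega T w :=
  exists phi_ : nat -> 'rV[R]_d.+1 -> R,
  [/\ forall k, smooth (phi_ k),
      normH1 (cylinder Omega T) (phi_ k \- w) @[k --> \oo] --> (0 : R) &
      normL2 Omega (fun x => phi_ k (rcons_rV (x, 0)))
        @[k --> \oo] --> (0 : R)].

Definition H10Q Omega T w :=
  H1 (cylinder Omega T) w /\ zero_on_Sigma Omega T w.

Definition V00 Omega T w :=
  [/\ H10Q Omega T w, has_divx Omega T (gradx Omega T w) &
      zero_on_Sigma0 Omega T w].

Definition Hdivx0 Omega T y :=
  L2v (cylinder Omega T) y /\ has_divx Omega T y.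

Definition friedrichs Omega T (C : R) := forall w,
  L2H1 Omega T w -> zero_on_Sigma Omega T w ->
  normL2 (cylinder Omega T) w <=
    C * normL2v (cylinder Omega T) (gradx Omega T w).

Definition heat_solution Omega T f w := V00 Omega T w /\
  {ae lebesgue_rV d.+1, forall z, cylinder Omega T z ->
    dt Omega T w z - lapx Omega T w z = f z}.

(* W is the map t |-> w(., t), as a continuous map from [0, T] to H^1_0(Omega);
   it gives a meaning to the restriction of w to Omega * {T}. *)
Definition continuous_slices Omega T w (W : R -> 'rV[R]_d -> R) :=
  [/\ forall t, 0 <= t <= T -> H10 Omega (W t),
      forall s, 0 <= s <= T ->
        normH1 Omega (W t \- W s) @[t --> within `[0, T] (nbhs s)] --> (0 : R) &
      {ae @lebesgue_measure R, forall t, 0 < t < T ->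
        {ae lebesgue_rV d, forall x, Omega x ->
          W t x = w (rcons_rV (x, t))}}].

Definition majorant Omega T (C_F lambda mu : R) f v y
    (gamma alpha1 alpha2 : R) : R :=
  let Q := cylinder Omega T in
  let r_eq := fun z => f z - dt Omega T v z + divx Omega T y z in
  let r_d := fun z => y z - gradx Omega T v z in
  gamma *
  (lambda * ((1 + alpha1) * normL2v Q r_d ^+ 2 +
             (1 + alpha1^-1) * C_F ^+ 2 * normL2 Q r_eq ^+ 2) +
   mu * ((1 + alpha2) * normL2 Q (divx Omega T r_d) ^+ 2 +
         (1 + alpha2^-1) * normL2 Q r_eq ^+ 2)).

End space_time.

(* Main.v *)
From HB Require Import structures.
From mathcomp Require Import all_boot all_order all_algebra.
From mathcomp Require Import all_classical all_reals all_analysis.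
From mathcomp Require Import measurable_realfun ring lra.
Require Import Defs.
Set Implicit Arguments. Unset Strict Implicit. Unset Printing Implicit Defensive.
Import Order.TTheory GRing.Theory Num.Theory.
Import numFieldNormedType.Exports.
Local Open Scope classical_set_scope.
Local Open Scope ring_scope.

(** Write e = u - v, g for its time derivative, G for its spatial gradient, l for
    its spatial Laplacian, and (_, _) for the inner product of L^2(Q). The heat
    equation for u gives g - l = r_eq - div r_d almost everywhere. Testing this
    identity with e and with g, and using
      (e, g) >= 1/2 |e(T)|^2   and   - (l, g) >= 1/2 |grad e(T)|^2,
    together with (l, e) = - |G|^2 and (div r_d, e) = - (r_d, G), one finds
      1/2 |e(T)|^2 + |G|^2 <= (r_eq, e) + (r_d, G),
      1/2 |grad e(T)|^2 + |g|^2 <= (r_eq, g) - (div r_d, g).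
    Cauchy-Schwarz, the Friedrichs inequality and Young's inequality ([young])
    bound the right-hand sides; lambda times the first line plus mu times the
    second one is the estimate.

    The substance is in the two inequalities at the final time,
    [final_value_le] and [final_gradient_le]. A chain rule for |grad e|^2 would
    involve mixed derivatives of e in space and time, about which nothing is
    known. Instead, the time derivative is replaced by backward difference
    quotients. For w in L^2(Q) with translate w_h (z) = w (z - h e_t), the
    elementary inequality 2 w w_h <= w^2 + w_h^2 yields [energy]:
      (w, w) - (w, w_h) >= 1/2 |w|^2 on the slab T - h < t < T,
    where (w, w_h) is the integral over h < t < T. It is applied to w = e and to
    the components of G, divided by h, and h tends to 0.

    - On the left, for w = e, the quotients converge to (e, g), by
      [quotient_weak_cvg]: smooth approximations of e have difference quotients
      bounded by their time derivatives, and the slab 0 < t < h contributes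
      nothing in the limit since e vanishes at time 0. For the components of G,
      integrating by parts in space at fixed h ([divx_shift]) turns their sum
      into the opposite of a difference quotient of e tested with l, which
      converges to - (l, g).

    - On the right, w^2 >= 2 w psi - psi^2 for a test function psi of the space
      variable makes the bound linear in w. The averages of e psi over the slab
      tend to the inner product of e(T) and psi, by continuity of the slices
      ([slices_average]); for G the derivative is first moved onto psi. The
      best choice of psi, approached by test functions, gives the norm of the
      value at time T ([terminal_limit]).

    Integration by parts rests on explicit smooth cutoffs built from
    exp (- 1 / x). Weak derivatives and divergences are determined up to null
    sets by [fundamental_lemma], so the chosen representatives can be
    subtracted and compared. *)

(** * Lebesgue measure on R^n: Fubini, open sets, translations *)
Section fubini.
Context {R : realType} {n : nat}.
Local Notation mu := (@lebesgue_rV R).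
Local Notation leb := (@lebesgue_measure R).
Local Open Scope ereal_scope.

Let mr : @measurable_fun _ _ ('rV[R]_n * measurableTypeR R)%type 'rV[R]_n.+1 setT
  (@rcons_rV R n).
Proof. exact: measurable_rcons_rV. Qed.

Let mcomp d' (T' : measurableType d') (f : 'rV[R]_n.+1 -> T') :
  measurable_fun setT f -> @measurable_fun _ _
    ('rV[R]_n * measurableTypeR R)%type _ setT (f \o (@rcons_rV R n)).
Proof.
move=> mf; exact: (@measurableT_comp _ _ _ ('rV[R]_n * measurableTypeR R)%type
  'rV[R]_n.+1 _ f _ (@rcons_rV R n) mf mr).
Qed.

Lemma tonelli_rV (f : 'rV[R]_n.+1 -> \bar R) : measurable_fun setT f ->
  (forall z, 0 <= f z) ->
  \int[mu n.+1]_z f z = \int[leb]_t \int[mu n]_x f (rcons_rV (x, t)).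
Proof.
move=> mf f0.
transitivity (\int[mu n \x leb]_p (f \o (@rcons_rV R n)) p).
  rewrite -[LHS]/(\int[pushforward (mu n \x leb) (@rcons_rV R n)]_z f z).
  by rewrite ge0_integral_pushforward.
by rewrite fubini_tonelli2//; [exact: mcomp|move=> p; exact: f0].
Qed.

Lemma tonelli_rV' (f : 'rV[R]_n.+1 -> \bar R) : measurable_fun setT f ->
  (forall z, 0 <= f z) ->
  \int[mu n.+1]_z f z = \int[mu n]_x \int[leb]_t f (rcons_rV (x, t)).
Proof.
move=> mf f0.
transitivity (\int[mu n \x leb]_p (f \o (@rcons_rV R n)) p).
  rewrite -[LHS]/(\int[pushforward (mu n \x leb) (@rcons_rV R n)]_z f z).
  by rewrite ge0_integral_pushforward.
by rewrite fubini_tonelli1//; [exact: mcomp|move=> p; exact: f0].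
Qed.

Lemma measurable_tonelli_rV (f : 'rV[R]_n.+1 -> \bar R) : measurable_fun setT f ->
  (forall z, 0 <= f z) ->
  measurable_fun setT (fun t : measurableTypeR R => \int[mu n]_x f (rcons_rV (x, t))).
Proof.
move=> mf f0.
apply: (@measurable_fun_fubini_tonelli_G _ _ _ _ _ (mu n) (f \o @rcons_rV R n)).
  exact: mcomp.
by move=> p; exact: f0.
Qed.

Lemma measurable_tonelli_rV' (f : 'rV[R]_n.+1 -> \bar R) : measurable_fun setT f ->
  (forall z, 0 <= f z) ->
  measurable_fun setT (fun x : 'rV[R]_n => \int[leb]_t f (rcons_rV (x, t))).
Proof.
move=> mf f0.
apply: (@measurable_fun_fubini_tonelli_F _ _ _ _ _ leb (f \o @rcons_rV R n)).
  exact: mcomp.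
by move=> p; exact: f0.
Qed.

Lemma integrable_rcons (f : 'rV[R]_n.+1 -> \bar R) :
  (mu n.+1).-integrable setT f ->
  (mu n \x leb).-integrable setT (f \o (@rcons_rV R n)).
Proof.
move=> /integrableP[mf foo]; apply/integrableP; split.
  exact: mcomp.
rewrite (le_lt_trans _ foo)//.
rewrite -[leRHS]/(\int[pushforward (mu n \x leb) (@rcons_rV R n)]_z `|f z|).
by rewrite ge0_integral_pushforward//; exact: measurableT_comp.
Qed.

Lemma fubini_rV (f : 'rV[R]_n.+1 -> \bar R) : (mu n.+1).-integrable setT f ->
  \int[mu n.+1]_z f z = \int[leb]_t \int[mu n]_x f (rcons_rV (x, t)).
Proof.
move=> intf; have intf' := integrable_rcons intf.
transitivity (\int[mu n \x leb]_p (f \o (@rcons_rV R n)) p).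
  rewrite -[LHS]/(\int[pushforward (mu n \x leb) (@rcons_rV R n)]_z f z).
  rewrite integral_pushforward//; exact: measurable_int intf.
by rewrite -integral21_prod_meas1.
Qed.

Lemma fubini_rV' (f : 'rV[R]_n.+1 -> \bar R) : (mu n.+1).-integrable setT f ->
  \int[mu n.+1]_z f z = \int[mu n]_x \int[leb]_t f (rcons_rV (x, t)).
Proof.
move=> intf; have intf' := integrable_rcons intf.
transitivity (\int[mu n \x leb]_p (f \o (@rcons_rV R n)) p).
  rewrite -[LHS]/(\int[pushforward (mu n \x leb) (@rcons_rV R n)]_z f z).
  rewrite integral_pushforward//; exact: measurable_int intf.
by rewrite -integral12_prod_meas1.
Qed.

End fubini.

Section topology.
Context {R : realType}.

(** The balls with rational centre and radius that lie in U cover it. An index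
    that codes no such ball is sent to the ball of radius 0, which is empty. *)
Lemma open_bigcup_ball n (U : set 'rV[R]_n) : open U ->
  exists B : nat -> 'rV[R]_n * R,
    U = \bigcup_k ball (B k).1 (B k).2.
Proof.
move=> oU.
pose Q : countType := ('rV[rat]_n * rat)%type.
pose c (q : 'rV[rat]_n) : 'rV[R]_n := map_mx (fun x => ratr x) q.
pose P (q : Q) := ball (c q.1) (ratr q.2 : R) `<=` U.
pose B k : 'rV[R]_n * R := if pickle_inv k is Some q then
   if `[< P q >] then (c q.1, ratr q.2) else (0, 0) else (0, 0).
exists B; apply/seteqP; split=> [x Ux|x [k _]]; last first.
  rewrite /B; case: pickle_inv => [q|] /=.
    by case: asboolP => [/[apply]//|_ []]; rewrite ltxx.
  by case; rewrite ltxx.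
have : nbhs x U by exact: open_nbhs_nbhs.
move=> /nbhs_ballP[e /= e0 exU].
have [r /andP[r0 re]] : exists r : rat, 0 < (ratr r : R) < e / 2.
  have [|q] := @rat_in_itvoo R 0 (e / 2); first by rewrite divr_gt0.
  by rewrite in_itv/=; exists q.
have hq (i : 'I_n) : exists q : rat, `|ratr q - x 0 i| < (ratr r : R).
  have [|q] := @rat_in_itvoo R (x 0 i - ratr r) (x 0 i + ratr r).
    by rewrite ltrD2l gtrN.
  by rewrite in_itv/= => /andP[q1 q2]; exists q; rewrite ltr_distl q1 q2.
pose q : 'rV[rat]_n := \row_i xchoose (hq i).
have hqx : ball (c q) (ratr r : R) x.
  split => // i j; rewrite /ball/= !mxE; rewrite ord1.
  exact: (xchooseP (hq j)).
exists (pickle ((q, r) : Q)) => //; rewrite /B pickleK_inv.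
case: asboolP => // -[] y [_ qy]; apply: exU; split => // i j.
rewrite -[X in ball _ X](subrK (ratr r)) ; apply: (@ball_triangle _ _ (c q i j)).
  case: hqx => _ /(_ i j)/ball_sym; apply: (@le_ball _ _ (x i j)).
  by rewrite lerBrDl [leRHS]splitr; apply/ltW/ltrD.
exact: qy.
Qed.
End topology.

Section topology2.
Context {R : realType}.
Local Notation mu := (@lebesgue_rV R).
Local Notation leb := (@lebesgue_measure R).

Lemma measurable_ball_rV n (x : 'rV[R]_n) (r : R) : measurable (ball x r).
Proof.
have [r0|r0] := leP r 0.
  rewrite (_ : ball x r = set0); first exact: measurable0.
  by rewrite -subset0 => y [] /lt_geF; rewrite r0.
rewrite (_ : ball x r =
  \bigcap_(i in [set: 'I_n]) (fun v : 'rV[R]_n => v ord0 i) @^-1` ball (x ord0 i) r).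
  apply: fin_bigcap_measurable => // i _; rewrite -[X in measurable X]setTI.
  by apply: measurable_coord => //; exact: measurable_ball.
apply/seteqP; split => [y [_ xy] i _|y xy]; first exact: xy.
by split => // i j; rewrite ord1; exact: xy.
Qed.

Lemma open_measurable_rV n (U : set 'rV[R]_n) : open U -> measurable U.
Proof.
move=> /open_bigcup_ball[B ->]; apply: bigcupT_measurable => k.
exact: measurable_ball_rV.
Qed.

(** The sigma-algebra is defined by the coordinates. Its description by open
    sets provides the pi-system for the Dynkin argument of [fundamental_lemma]. *)
Lemma measurable_rV_open n : @measurable _ 'rV[R]_n = <<s @open 'rV[R]_n >>.
Proof.
apply/seteqP; split; last first.
  apply: smallest_sub; first exact: sigma_algebra_measurable.
  exact: open_measurable_rV.
apply: smallest_sub; first exact: smallest_sigma_algebra.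
case: n => [|n]; first by rewrite big_ord0.
rewrite -bigcup_mkord_ord => A [i Ii [B mB <-]].
have : measurable_fun (setT : set (g_sigma_algebraType (@open 'rV[R]_n.+1)))
    (fun v => v ord0 (inord i) : R).
  apply: (measurability _ (RGenOpens.measurableE R)) => _ [_ [a [b ->] <-]].
  apply: sub_sigma_algebra; rewrite setTI.
  apply: open_comp; last exact: interval_open.
  by move=> v _; exact: coord_continuous.
by apply.
Qed.

Lemma continuous_measurable_rV n (f : 'rV[R]_n -> R) :
  continuous f -> measurable_fun setT f.
Proof.
move=> cf; apply: (measurability _ (RGenOpens.measurableE R)).
move=> _ [_ [a [b ->] <-]]; rewrite setTI; apply: open_measurable_rV.
apply: open_comp; last exact: interval_open.
by move=> v _; exact: cf.
Qed.

Definition cube n (M : R) : set 'rV[R]_n :=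
  [set x | forall i, `|x 0 i| <= M].
Arguments cube : clear implicits.

Lemma measurable_cube n M : measurable (cube n M).
Proof.
rewrite (_ : cube n M = \bigcap_(i in [set: 'I_n])
   (fun v : 'rV[R]_n => v ord0 i) @^-1` `[-M, M]).
  apply: fin_bigcap_measurable => // i _; rewrite -[X in measurable X]setTI.
  exact: measurable_coord.
apply/seteqP; split => [y xy i _|y xy i].
  by rewrite /= in_itv/= -ler_norml; exact: xy.
by have := xy i I; rewrite /= in_itv/= -ler_norml.
Qed.

Lemma cube_finite n M : (mu n (cube n M) < +oo)%E.
Proof.
elim: n => [|n IHn]; first by rewrite /= /dirac/= indicE ltry.
rewrite -[X in (X < _)%E]/((mu n \x leb)%E (@rcons_rV R n @^-1` cube n.+1 M)).
rewrite (_ : _ @^-1` _ = cube n M `*` `[-M, M]).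
  rewrite [X in (X < _)%E]product_measure1E//; last exact: measurable_cube.
  rewrite lte_mul_pinfty// ?ge0_fin_numE//.
  by rewrite [X in (X < _)%E]lebesgue_measure_itv/=; case: ifP => // _; rewrite ltry.
apply/seteqP; split => [[x t] /= xt|[x t] [/= cx ct] i].
  split => [i|/=]; last first.
    by have := xt ord_max; rewrite mxE unlift_none in_itv/= -ler_norml.
  by have := xt (lift ord_max i); rewrite mxE liftK.
rewrite /rcons_rV mxE; case: unliftP => [j _|_] /=; first exact: cx.
by move: ct; rewrite in_itv/= -ler_norml.
Qed.

Lemma bounded_sub_cube n (D : set 'rV[R]_n) : bounded_set D ->
  exists2 M, 0 < M & D `<=` cube n M.
Proof.
move=> [M [_ HM]]; exists (`|M| + 1); first by rewrite ltr_wpDl.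
move=> x Dx i; have := HM (`|M| + 1); rewrite ltr_pwDr// ?ler_norm// => /(_ isT x Dx).
apply: le_trans; rewrite [leRHS]mx_normrE.
by rewrite (le_trans _ (le_bigmax _ _ (0, i)))//.
Qed.

Lemma bounded_finite_measure n (D : set 'rV[R]_n) : measurable D -> bounded_set D ->
  (mu n D < +oo)%E.
Proof.
move=> mD /bounded_sub_cube[M _ DM]; apply: le_lt_trans (cube_finite n M).
by apply: le_measure; rewrite ?inE//; exact: measurable_cube.
Qed.

(** The pushforward by a translation preserves the length of intervals, which
    characterises Lebesgue measure. *)
Lemma lebesgue_shift (h : R) (A : set R) : measurable A ->
  leb ((fun t => t + h) @^-1` A) = leb A.
Proof.
move=> mA; have mh : measurable_fun [set: measurableTypeR R] (fun t : measurableTypeR R => t + h : measurableTypeR R).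
  by apply: measurable_funD => //; exact: measurable_id.
pose m := measure_function_pushforward__canonical__measure_function_Measure leb mh.
apply/esym; apply: (@lebesgue_measure_unique _ m) => // _ [[a b] _ <-].
rewrite [RHS]/= /pushforward (_ : _ @^-1` _ = `]a - h, b - h]%classic).
  rewrite !lebesgue_measure_itv/= !lte_fin ltrD2r; case: ifPn => // _.
  by rewrite -!EFinB; congr (_%:E); ring.
by apply/seteqP; split => t /=; rewrite !in_itv/= ltrBlDr lerBrDr.
Qed.

Lemma integral_shift (h : R) (f : R -> \bar R) : measurable_fun setT f ->
  (forall t, (0 <= f t)%E) -> (\int[leb]_t f (t + h)%R = \int[leb]_t f t)%E.
Proof.
move=> mf f0.
have mh : measurable_fun [set: measurableTypeR R] (fun t : measurableTypeR R => t + h : measurableTypeR R).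
  by apply: measurable_funD => //; exact: measurable_id.
transitivity (\int[pushforward leb (fun t : measurableTypeR R => (t + h)%R : measurableTypeR R)]_t f t)%E.
  by rewrite ge0_integral_pushforward.
by apply: eq_measure_integral => //= A mA _; exact: lebesgue_shift.
Qed.

End topology2.
Arguments cube {R} n M.

(** * The space L^2(D) *)
Section L2_theory.
Context {R : realType} {n : nat}.
Local Notation mu := (lebesgue_rV n).
Variable D : set 'rV[R]_n.
Hypothesis mD : measurable D.
Implicit Types f g w : 'rV[R]_n -> R.

Definition ip f g : R := \int[mu]_(z in D) (f z * g z).

Lemma sqr_restrict w : (fun z => (w \_ D) z ^+ 2) = (fun z => w z ^+ 2) \_ D.
Proof.
by apply/funext => z; rewrite /patch; case: ifP => //; rewrite expr0n.
Qed.

(** Square integrability is easier to transport than finiteness of the norm: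
    the closure properties of L^2 go through this equivalence. *)
Lemma L2P w : L2 D w <->
  measurable_fun D w /\ mu.-integrable D (EFin \o (fun z => w z ^+ 2)).
Proof.
split=> [lw|[mw iw]].
  split.
    by apply/(measurable_restrictT _ mD); move: lw => /andP[]; rewrite inE.
  apply/(integrable_mkcond _ mD); rewrite restrict_EFin -sqr_restrict.
  exact: Lfun2_integrable_sqr.
apply/andP; split; first by rewrite inE; apply/(measurable_restrictT _ mD).
rewrite inE /= /finite_norm unlock; apply: poweR_lty.
move/(integrable_mkcond _ mD) : iw; rewrite restrict_EFin -sqr_restrict.
move=> /integrableP[_]; apply: le_lt_trans.
rewrite le_eqVlt; apply/orP; left; apply/eqP; apply: eq_integral => z _ /=.
by rewrite powR_mulrn// normrX.
Qed.

Lemma normL2_ge0 w : 0 <= normL2 D w.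
Proof. by apply: fine_ge0; exact: Lnorm_ge0. Qed.

Lemma normL2E w : normL2 D w ^+ 2 = ip w w.
Proof.
rewrite /ip (_ : (fun z => w z * w z) = (fun z => w z ^+ 2)); last first.
  by apply/funext => z; rewrite expr2.
rewrite Rintegral_mkcond -sqr_restrict /Rintegral /normL2.
have -> : (\int[mu]_x ((w \_ D) x ^+ 2)%:E)%E =
    ('N[mu]_2%:E[EFin \o w \_ D] `^ 2)%E.
  rewrite poweR_Lnorm//; apply: eq_integral => z _ /=.
  by rewrite powR_mulrn// -normrX ger0_norm// sqr_ge0.
have := Lnorm_ge0 mu 2%:E (EFin \o w \_ D).
move: ('N[_]_ _ [_])%E => [r| |] //= r0; first by rewrite powR_mulrn.
by rewrite expr0n/= pnatr_eq0.
Qed.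

Lemma L2_mfun w : L2 D w -> measurable_fun D w.
Proof. by move=> /L2P[]. Qed.

Lemma L2_integrableM f g : L2 D f -> L2 D g ->
  mu.-integrable D (EFin \o (fun z => f z * g z)).
Proof.
move=> lf lg; apply/(integrable_mkcond _ mD); rewrite restrict_EFin.
rewrite (_ : _ \_ D = (f \_ D) \* (g \_ D)).
  by apply/Lfun1_integrable; exact: Lfun2_mul_Lfun1.
by apply/funext => z; rewrite /patch /=; case: ifP => //; rewrite mul0r.
Qed.

Lemma L2D f g : L2 D f -> L2 D g -> L2 D (fun z => f z + g z).
Proof.
move=> /L2P[mf if2] /L2P[mg ig2]; apply/L2P.
have mfg : measurable_fun D (fun z => f z + g z) by exact: measurable_funD.
split => //; apply: (@le_integrable _ _ _ mu D mD _
    (fun z => 2%:E * (f z ^+ 2)%:E + 2%:E * (g z ^+ 2)%:E)%E).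
- by apply/measurable_EFinP; exact: measurable_funX.
- move=> z Dz; rewrite /= lee_fin !ger0_norm ?sqr_ge0//.
    by have := sqr_ge0 (f z - g z); nra.
  by rewrite addr_ge0// mulr_ge0// sqr_ge0.
- by apply: integrableD => //; exact: integrableZl.
Qed.

Lemma L2Z a f : L2 D f -> L2 D (fun z => a * f z).
Proof.
move=> /L2P[mf if2]; apply/L2P; split; first exact: measurable_funM.
under [X in EFin \o X]eq_fun do rewrite exprMn.
exact: (integrableZl mD (a ^+ 2) if2).
Qed.

Lemma L2N f : L2 D f -> L2 D (fun z => - f z).
Proof.
move=> /(L2Z (-1)); congr L2; apply/funext => z; exact: mulN1r.
Qed.

Lemma L2B f g : L2 D f -> L2 D g -> L2 D (fun z => f z - g z).
Proof. by move=> lf lg; apply: L2D => //; exact: L2N. Qed.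

Lemma L20 : L2 D (fun=> 0).
Proof.
apply/L2P; split; first exact: measurable_cst.
by under [X in EFin \o X]eq_fun do rewrite expr0n; exact: integrable0.
Qed.

Lemma L2_dominated f g : measurable_fun D f -> L2 D g ->
  (forall z, D z -> `|f z| <= `|g z|) -> L2 D f.
Proof.
move=> mf /L2P[mg ig] fg; apply/L2P; split => //.
apply: (le_integrable mD _ _ ig).
  by apply/measurable_EFinP; exact: measurable_funX.
move=> z Dz /=; rewrite lee_fin !normrX; apply: lerXn2r; rewrite ?nnegrE//.
exact: fg.
Qed.

Lemma L2_bounded f (C : R) : (mu D < +oo)%E -> measurable_fun D f ->
  (forall z, D z -> `|f z| <= C) -> L2 D f.
Proof.
move=> Doo mf fC; apply: (@L2_dominated f (fun=> C)) => //.
  apply/L2P; split; first exact: measurable_cst.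
  apply/integrableP; split; first exact/measurable_EFinP/measurable_cst.
  rewrite (_ : (fun _ => _) = cst `|C ^+ 2|%:E)//.
  by rewrite integral_cst// lte_mul_pinfty.
by move=> z Dz; rewrite (le_trans (fC _ Dz))// ler_norm.
Qed.

Lemma ipC f g : ip f g = ip g f.
Proof. by apply: eq_Rintegral => z _; exact: mulrC. Qed.

Lemma ip_eq f f' g g' : (forall z, D z -> f z = f' z) ->
  (forall z, D z -> g z = g' z) -> ip f g = ip f' g'.
Proof.
by move=> ff gg; apply: eq_Rintegral => z; rewrite inE => Dz; rewrite ff// gg.
Qed.

Lemma ae_eq_ip f f' g g' : measurable_fun D f -> measurable_fun D f' ->
  measurable_fun D g -> measurable_fun D g' ->
  ae_eq mu D f f' -> ae_eq mu D g g' -> ip f g = ip f' g'.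
Proof.
move=> mf mf' mg mg' ff gg; congr fine; apply: ae_eq_integral => //.
- by apply/measurable_EFinP; exact: measurable_funM.
- by apply/measurable_EFinP; exact: measurable_funM.
- by apply: filterS2 ff gg => z ff gg Dz; rewrite ff// gg.
Qed.

Lemma ipDl f f' g : L2 D f -> L2 D f' -> L2 D g ->
  ip (fun z => f z + f' z) g = ip f g + ip f' g.
Proof.
move=> lf lf' lg; rewrite /ip -RintegralD//; try exact: L2_integrableM.
by apply: eq_Rintegral => z _; exact: mulrDl.
Qed.

Lemma ipZl a f g : L2 D f -> L2 D g -> ip (fun z => a * f z) g = a * ip f g.
Proof.
move=> lf lg; rewrite /ip -RintegralZl//; last exact: L2_integrableM.
by apply: eq_Rintegral => z _; rewrite mulrA.
Qed.

Lemma ipNl f g : L2 D f -> L2 D g -> ip (fun z => - f z) g = - ip f g.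
Proof.
move=> lf lg; rewrite -mulN1r -ipZl//; apply: ip_eq => // z _.
by rewrite mulN1r.
Qed.

Lemma ipBl f f' g : L2 D f -> L2 D f' -> L2 D g ->
  ip (fun z => f z - f' z) g = ip f g - ip f' g.
Proof. by move=> lf lf' lg; rewrite ipDl// ?ipNl//; exact: L2N. Qed.

Lemma ipDr f f' g : L2 D f -> L2 D f' -> L2 D g ->
  ip g (fun z => f z + f' z) = ip g f + ip g f'.
Proof. by move=> *; rewrite ipC ipDl// ![ip g _]ipC. Qed.

Lemma ipBr f f' g : L2 D f -> L2 D f' -> L2 D g ->
  ip g (fun z => f z - f' z) = ip g f - ip g f'.
Proof. by move=> *; rewrite ipC ipBl// ![ip g _]ipC. Qed.

Lemma ip_ge0 w : 0 <= ip w w.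
Proof. by rewrite -normL2E sqr_ge0. Qed.

Lemma ip_CS f g : L2 D f -> L2 D g -> `|ip f g| <= normL2 D f * normL2 D g.
Proof.
move=> lf lg; have ifg := L2_integrableM lf lg.
apply: le_trans (le_normr_Rintegral mD ifg) _.
rewrite -lee_fin EFinM.
have finN w : L2 D w -> (normL2 D w)%:E = ('N[mu]_2%:E[EFin \o (w \_ D)])%E.
  move=> /andP[_]; rewrite inE /= /finite_norm => woo.
  by rewrite fineK// ge0_fin_numE// Lnorm_ge0.
rewrite !finN// fineK; last first.
  by apply: integrable_fin_num => //; exact: integrable_norm.
have := @hoelder _ _ _ mu (f \_ D) (g \_ D) 2 2.
rewrite Lnorm1 => H; apply: le_trans (H _ _ _ _ _) => //.
- rewrite integral_mkcond le_eqVlt; apply/orP; left; apply/eqP.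
  apply: eq_integral => z _; rewrite /patch /=; case: ifP => // _.
  by rewrite mul0r normr0.
- by move: lf => /andP[]; rewrite inE.
- by move: lg => /andP[]; rewrite inE.
- by rewrite [RHS]splitr !div1r.
Qed.

Lemma normL2_triangle f g : L2 D f -> L2 D g ->
  normL2 D (fun z => f z + g z) <= normL2 D f + normL2 D g.
Proof.
move=> lf lg; have lfg := L2D lf lg.
rewrite -(@ler_pXn2r _ 2)// ?nnegrE ?addr_ge0 ?normL2_ge0//.
rewrite normL2E ipDl// !ipDr// -!normL2E (ipC g f).
have := ip_CS lf lg; have := ler_norm (ip f g); nra.
Qed.

End L2_theory.

(** * Smooth functions and cutoffs *)
Section smooth_closure.
Context {R : realType} {n : nat}.
Implicit Types f g : 'rV[R]_n -> R.

Definition diff1 f := continuous f /\ forall i x, derivable f x (delta_mx 0 i).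

Lemma smooth_partial i f : smooth f -> smooth (partial i f).
Proof. by move=> sf s; have := sf (rcons s i); rewrite foldr_rcons. Qed.

Lemma smooth_diff1 f : smooth f -> diff1 f.
Proof. by move=> /(_ [::]). Qed.

Lemma smooth_continuous f : smooth f -> continuous f.
Proof. by move=> /smooth_diff1[]. Qed.

Lemma smooth_derivable f : smooth f -> forall i x, derivable f x (delta_mx 0 i).
Proof. by move=> /smooth_diff1[]. Qed.

Lemma smooth_measurable f : smooth f -> measurable_fun setT f.
Proof. by move=> /smooth_continuous; exact: continuous_measurable_rV. Qed.

(** Coinduction principle for smoothness: the class P contains all the iterated
    derivatives of its members. It applies where the derivatives of f are not
    of the same form as f but remain in an explicit class. *)
Lemma smooth_coind (P : ('rV[R]_n -> R) -> Prop) :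
  (forall f, P f -> diff1 f /\ forall i, P (partial i f)) ->
  forall f, P f -> smooth f.
Proof.
move=> HP f Pf s; elim/last_ind: s f Pf => [|s i IH] f Pf.
  by have [[]] := HP _ Pf.
by rewrite foldr_rcons; apply: IH; have [_] := HP _ Pf.
Qed.

Lemma partialD i f g : (forall x, derivable f x (delta_mx 0 i)) ->
  (forall x, derivable g x (delta_mx 0 i)) ->
  partial i (fun x => f x + g x) = fun x => partial i f x + partial i g x.
Proof. by move=> df dg; apply/funext => x; exact: deriveD. Qed.

Lemma partialM i f g : (forall x, derivable f x (delta_mx 0 i)) ->
  (forall x, derivable g x (delta_mx 0 i)) ->
  partial i (fun x => f x * g x) = fun x => f x * partial i g x + g x * partial i f x.
Proof. by move=> df dg; apply/funext => x; exact: deriveM. Qed.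

Lemma partial_cst i (a : R) : partial i (fun _ : 'rV[R]_n => a) = fun=> 0.
Proof. apply/funext => x; exact: derive_cst. Qed.

Lemma derive_line f x v : 'D_v f x = 'D_1 (fun h : R => f (h *: v + x)) 0.
Proof.
rewrite /derive; set a := fun h => _; set b := fun h => _.
suff -> : a = b by []; apply/funext => h; rewrite /a /b /=.
by rewrite addr0 scale0r add0r [_%:A]mulr1.
Qed.

Lemma derivable_exp f x v : derivable f x v -> derivable (fun x => expR (f x)) x v.
Proof.
move=> /derivable1P/derivable1_diffP df; apply/derivable1P/derivable1_diffP.
apply: (@differentiable_comp _ _ _ _ (fun h : R => f (h *: v + x)) expR) => //.
exact/derivable1_diffP/derivable_expR.
Qed.

Lemma derive_exp f x v : derivable f x v ->
  'D_v (fun x => expR (f x)) x = expR (f x) * 'D_v f x.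
Proof.
move=> /derivable1P df; rewrite !(derive_line _ _ v) -!derive1E.
have de : derivable (@expR R) (f (0 *: v + x)) 1 by exact: derivable_expR.
rewrite [LHS](@derive1_comp _ (fun h : R => f (h *: v + x)) expR _ df de).
by rewrite [X in X * _]derive1E [X in X * _]derive_val scale0r add0r.
Qed.

Lemma partial_exp i f : (forall x, derivable f x (delta_mx 0 i)) ->
  partial i (fun x => expR (f x)) = fun x => expR (f x) * partial i f x.
Proof. by move=> df; apply/funext => x; exact: derive_exp. Qed.

(** Differentiating an exponential produces a product, and a product a sum of
    products: only the closure under all these operations at once is stable
    under partial derivatives. *)
Inductive smooth_alg : ('rV[R]_n -> R) -> Prop :=
| alg_smooth f : smooth f -> smooth_alg f
| alg_cst a : smooth_alg (fun=> a)
| alg_add f g : smooth_alg f -> smooth_alg g -> smooth_alg (fun x => f x + g x)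
| alg_mul f g : smooth_alg f -> smooth_alg g -> smooth_alg (fun x => f x * g x)
| alg_exp f : smooth_alg f -> smooth_alg (fun x => expR (f x)).

Lemma smooth_algP f : smooth_alg f -> smooth f.
Proof.
apply: smooth_coind => {}f; elim => {f}.
- move=> f sf; split; first exact: smooth_diff1.
  by move=> i; apply: alg_smooth; exact: smooth_partial.
- move=> a; split; last by move=> i; rewrite partial_cst; exact: alg_cst.
  by split => [x|i x]; [exact: cst_continuous|exact: derivable_cst].
- move=> f g af [[cf df] Df] ag [[cg dg] Dg]; split.
    by split => [x|i x]; [exact: continuousD (cf x) (cg x)|exact: derivableD].
  move=> i; rewrite partialD; [exact: alg_add|exact: df|exact: dg].
- move=> f g af [[cf df] Df] ag [[cg dg] Dg]; split.
    by split => [x|i x]; [exact: continuousM (cf x) (cg x)|exact: derivableM].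
  move=> i; rewrite partialM; [|exact: df|exact: dg].
  by apply: alg_add; apply: alg_mul.
- move=> f af [[cf df] Df]; split.
    split => [x|i x]; last exact: derivable_exp.
    by apply: continuous_comp; [exact: cf|exact: continuous_expR].
  move=> i; rewrite partial_exp; [|exact: df].
  by apply: alg_mul => //; exact: alg_exp.
Qed.

Lemma smooth_cst (a : R) : smooth (fun _ : 'rV[R]_n => a).
Proof. exact/smooth_algP/alg_cst. Qed.

Lemma smoothD f g : smooth f -> smooth g -> smooth (fun x => f x + g x).
Proof. by move=> sf sg; apply/smooth_algP/alg_add; exact: alg_smooth. Qed.

Lemma smoothM f g : smooth f -> smooth g -> smooth (fun x => f x * g x).
Proof. by move=> sf sg; apply/smooth_algP/alg_mul; exact: alg_smooth. Qed.

Lemma smooth_exp f : smooth f -> smooth (fun x => expR (f x)).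
Proof. by move=> sf; apply/smooth_algP/alg_exp; exact: alg_smooth. Qed.

Lemma smoothB f g : smooth f -> smooth g -> smooth (fun x => f x - g x).
Proof.
move=> sf sg; rewrite (_ : (fun _ => _) = (fun x => f x + -1 * g x)).
  by apply: smoothD; [exact: sf|apply: smoothM; [exact: smooth_cst|exact: sg]].
by apply/funext => x; rewrite mulN1r.
Qed.

Lemma smooth_prod I (r : seq I) (F : I -> 'rV[R]_n -> R) :
  (forall i, smooth (F i)) -> smooth (fun x => \prod_(i <- r) F i x).
Proof.
move=> sF; elim: r => [|i r IH].
  rewrite (_ : (fun _ => _) = (fun=> 1)); first exact: smooth_cst.
  by apply/funext => x; rewrite big_nil.
rewrite (_ : (fun _ => _) = (fun x => F i x * \prod_(j <- r) F j x)).
  by apply: smoothM; [exact: sF|exact: IH].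
by apply/funext => x; rewrite big_cons.
Qed.

End smooth_closure.

Lemma partialB {R : realType} n i (f g : 'rV[R]_n -> R) : smooth f -> smooth g ->
  partial i (fun x => f x - g x) = (fun x => partial i f x - partial i g x).
Proof.
move=> sf sg; apply/funext => x; rewrite /partial.
exact: (deriveB (@smooth_derivable _ _ _ sf i x) (@smooth_derivable _ _ _ sg i x)).
Qed.

Section affine_comp.
Context {R : realType} {U V W : normedModType R}.

(** An affine map sends difference quotients to difference quotients, so this
    chain rule concerns a single direction and holds without total
    differentiability. *)
Lemma derive_affine (L : U -> V) (g : V -> W) x v w :
  (forall h : R, L (h *: v + x) = h *: w + L x) ->
  'D_v (g \o L) x = 'D_w g (L x).
Proof.
move=> HL; rewrite /derive; set a := fun h => _; set b := fun h => _.
by suff -> : a = b by []; apply/funext => h; rewrite /a /b /= HL.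
Qed.

Lemma derivable_affine (L : U -> V) (g : V -> W) x v w :
  (forall h : R, L (h *: v + x) = h *: w + L x) ->
  derivable g (L x) w -> derivable (g \o L) x v.
Proof.
move=> HL; rewrite /derivable.
set a := fun h => _; set b := fun h => _; suff -> : a = b by [].
by apply/funext => h; rewrite /a /b /= HL.
Qed.
End affine_comp.

Section rho.
Context {R : realType}.
Implicit Types (p : {poly R}) (x : R).

(** The flat function exp (- 1 / x) on x > 0, with a polynomial factor in 1 / x
    that makes the family stable under differentiation. *)
Definition rho p x : R := if 0 < x then p.[x^-1] * expR (- x^-1) else 0.

(** Induction on p; the free exponent k absorbs the factor y that each step
    of Horner's scheme produces. *)
Lemma poly_exp_bounded p k : exists2 C : R, 0 <= C &
  forall y : R, 0 < y -> y ^+ k * `|p.[y]| * expR (- y) <= C.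
Proof.
elim/poly_ind: p k => [|p c IH] k.
  by exists 0 => // y _; rewrite horner0 normr0 mulr0 mul0r.
have [C C0 HC] := IH k.+1.
have mon (y : R) : 0 < y -> y ^+ k * expR (- y) <= k`!%:R.
  move=> y0; rewrite expRN ler_pdivrMr ?expR_gt0//.
  case: k {IH HC} => [|k].
    rewrite expr0 fact0 mul1r; have := expR_ge1Dx y; lra.
  have := @expR_ge1Dxn R y k (ltW y0).
  rewrite -ler_pdivrMl ?ltr0n ?fact_gt0// mulrC; apply: le_trans.
  by rewrite lerDr.
exists (C + `|c| * k`!%:R); first by rewrite addr_ge0// mulr_ge0.
move=> y y0; rewrite hornerMXaddC.
apply: (@le_trans _ _ (y ^+ k.+1 * `|p.[y]| * expR (- y) + `|c| * (y ^+ k * expR (- y)))).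
  rewrite [X in _ <= X](_ : _ = y ^+ k * (`|p.[y]| * y + `|c|) * expR (- y)); last first.
    by rewrite exprS; ring.
  rewrite ler_wpM2r ?expR_ge0// ler_wpM2l ?exprn_ge0 ?(ltW y0)//.
  by rewrite (le_trans (ler_normD _ _))// normrM [`|y|]gtr0_norm.
by rewrite lerD ?HC// ler_wpM2l ?mon.
Qed.

Lemma rho_le p : exists2 C : R, 0 <= C & forall x, `|rho p x| <= C * `|x|.
Proof.
have [C C0 HC] := poly_exp_bounded p 1.
exists C => // x; rewrite /rho; case: ifPn => [x0|_]; last first.
  by rewrite normr0 mulr_ge0.
have x1 : 0 < x^-1 by rewrite invr_gt0.
rewrite normrM [`|expR _|]ger0_norm ?expR_ge0// [`|x|]gtr0_norm//.
by have := HC _ x1; rewrite expr1 -mulrA ler_pdivrMl// [x * C]mulrC.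
Qed.

Lemma rho0 p x : x <= 0 -> rho p x = 0.
Proof. by rewrite /rho leNgt => /negbTE->. Qed.

Lemma is_derive_comp1 (f g : R -> R) x (df dg : R) : is_derive x (1:R) f df ->
  is_derive (f x) (1:R) g dg -> is_derive x (1:R) (fun y => g (f y)) (dg * df).
Proof.
move=> [f1 <-] [g1 <-]; apply: DeriveDef.
  apply/derivable1_diffP; apply: (@differentiable_comp _ _ _ _ f g).
    exact/derivable1_diffP.
  exact/derivable1_diffP.
by rewrite -!derive1E; exact: (@derive1_comp _ f g x f1 g1).
Qed.

(** The only delicate point is 0, where rho p x / x = rho ('X * p) x, which is
    O(x) by [rho_le]. *)
Lemma is_derive_rho p x : is_derive x (1:R) (rho p) (rho ('X^2 * (p - p^`())) x).
Proof.
have [x0|x0|->] := ltgtP x 0.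
- rewrite (rho0 _ (ltW x0)); apply: (@near_eq_is_derive _ _ _ (cst 0)).
  near=> y; rewrite rho0//; apply: ltW; near: y; exact: lt_nbhsl.
- apply: (@near_eq_is_derive _ R R (fun y : R => p.[y^-1] * expR (- y^-1))).
    near=> y; rewrite /rho ifT//; near: y; exact: lt_nbhsr.
  have xn0 : x != 0 by rewrite gt_eqF.
  have dV : is_derive x (1:R) (fun y : R => y^-1) (- x^-2).
    apply: DeriveDef; first by apply: derivableV => //; exact: derivable_id.
    by rewrite deriveV// derive_id; exact: mulr1.
  have dp := is_derive_comp1 dV (is_derive_poly p x^-1).
  have de := is_derive_comp1 (is_deriveN dV) (is_derive_expR (- x^-1)).
  apply: (is_derive_eq (is_deriveM dp de)).
  rewrite /rho x0 hornerM hornerXn hornerD hornerN !/GRing.scale/=.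
  by rewrite exprVn; ring.
- rewrite [X in is_derive _ _ _ X]rho0//.
  have [C C0 HC] := rho_le ('X * p).
  have lim0 : h^-1 *: (rho p (h *: 1 + 0) - rho p 0) @[h --> 0^'] --> (0 : R).
    apply/cvgrPdist_le => e e0; near=> h.
    rewrite sub0r normrN (@rho0 p 0)// subr0 addr0 [_ *: 1]mulr1.
    have -> : h^-1 *: rho p h = rho ('X * p) h.
      rewrite /rho; case: ifPn => h0; last by rewrite scaler0.
      by rewrite hornerM hornerX /GRing.scale/= mulrA.
    apply: le_trans (HC h) _.
    rewrite (@le_trans _ _ (C * (e / (C + 1))))// ?ler_wpM2l//.
      by near: h; apply: dnbhs0_le; rewrite divr_gt0// ltr_wpDl.
    by rewrite mulrA ler_pdivrMr ?ltr_wpDl// mulrDr mulr1 mulrC lerDl ltW.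
  apply: DeriveDef; first by apply/cvg_ex; exists 0.
  exact/cvg_lim.
Unshelve. all: by end_near. Qed.

Lemma continuous_rho p : continuous (rho p).
Proof.
move=> x; apply/differentiable_continuous/derivable1_diffP.
by have [] := is_derive_rho p x.
Qed.

Lemma rho_gt0 x : 0 < x -> 0 < rho 1 x.
Proof. by move=> x0; rewrite /rho x0 hornerC mul1r expR_gt0. Qed.

Lemma rho_ge0 x : 0 <= rho 1 x.
Proof. by have [/rho_gt0/ltW//|/rho0->] := ltP 0 x. Qed.

Lemma smooth_rho n (i : 'I_n) p (a b : R) :
  smooth (fun x : 'rV[R]_n => rho p (a * x 0 i + b)).
Proof.
(* differentiating changes c and q but not the affine argument *)
pose P (f : 'rV[R]_n -> R) := exists c q, f = (fun x : 'rV[R]_n => c * rho q (a * x 0 i + b)).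
suff : forall f, P f -> smooth f.
  by apply; exists 1, p; apply/funext => x; rewrite mul1r.
pose L (x : 'rV[R]_n) : R := a * x 0 i + b.
have LE (v x : 'rV[R]_n) (h : R) : L (h *: v + x) = h *: (a * v 0 i) + L x.
  by rewrite /L !mxE /GRing.scale/=; ring.
have dr q (y w : R) : derivable (rho q) y w.
  apply: diff_derivable; apply/derivable1_diffP.
  by have [] := is_derive_rho q y.
have drho q (y w : R) : 'D_w (rho q) y = w * rho ('X^2 * (q - q^`())) y.
  have dq : differentiable (rho q) y.
    by apply/derivable1_diffP; have [] := is_derive_rho q y.
  rewrite deriveE// -[in LHS](mulr1 w) -[w * 1]/(w *: (1 : R)) linearZ/= -deriveE//.
  by have [_ ->] := is_derive_rho q y.
have dq q (v x : 'rV[R]_n) : derivable (fun x : 'rV[R]_n => rho q (a * x 0 i + b)) x v.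
  by apply: (derivable_affine (L := L) (LE v x)); exact: dr.
apply: smooth_coind => f [c [q ->]]; split.
  split => [x|j x].
    apply: (@continuousM _ _ (cst c) (fun x : 'rV[R]_n => rho q (a * x 0 i + b))).
      exact: cst_continuous.
    apply: (@continuous_comp _ _ _ L (rho q)); last exact: continuous_rho.
    apply: continuousD; last exact: cst_continuous.
    apply: continuousM; first exact: cst_continuous.
    exact: coord_continuous.
  by apply: derivableM; [exact: derivable_cst|exact: dq].
move=> j; exists (c * (a * (i == j)%:R)), ('X^2 * (q - q^`())).
apply/funext => x; rewrite /partial deriveM; [|exact: derivable_cst|exact: dq].
rewrite derive_cst scaler0 addr0.
rewrite (derive_affine (L := L) _ (LE _ x)) drho /GRing.scale/= mxE eqxx/=.
by rewrite /L -!mulrA.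
Qed.

Lemma rho_mono x y : x <= y -> rho 1 x <= rho 1 y.
Proof.
move=> xy; have [x0|x0] := ltP 0 x; last by rewrite rho0// rho_ge0.
have y0 := lt_le_trans x0 xy.
by rewrite /rho x0 y0 !hornerC !mul1r ler_expR lerN2 lef_pV2.
Qed.

(** A bump on ]a, b[ written with products and exp only, so that its smoothness
    follows from [smooth_alg]. It vanishes outside [a + 1/(m+1), b - 1/(m+1)],
    and tends to 1 inside ]a, b[ because m times a positive number tends to
    infinity. *)
Definition cutoff (a b : R) (m : nat) (x : R) : R :=
  1 - expR (-1 * (m%:R * (rho 1 (1 * x + (- a - m.+1%:R^-1)) *
                          rho 1 (-1 * x + (b - m.+1%:R^-1))))).

Lemma smooth_cutoff n (i : 'I_n) a b m :
  smooth (fun x : 'rV[R]_n => cutoff a b m (x 0 i)).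
Proof.
apply: (smoothB (smooth_cst _)); apply: smooth_exp.
apply: (smoothM (smooth_cst _)); apply: (smoothM (smooth_cst _)).
by apply: smoothM; exact: smooth_rho.
Qed.

Lemma cutoff_ge0 (a b : R) m x : 0 <= cutoff a b m x.
Proof.
by rewrite subr_ge0 expR_le1 mulN1r oppr_le0 !mulr_ge0// rho_ge0.
Qed.

Lemma cutoff_le1 (a b : R) m x : cutoff a b m x <= 1.
Proof. by rewrite lerBlDr lerDl expR_ge0. Qed.

Lemma cutoff_norm_le1 (a b : R) m x : `|cutoff a b m x| <= 1.
Proof. by rewrite ger0_norm ?cutoff_ge0// cutoff_le1. Qed.

Lemma cutoff_eq0 (a b : R) m x : ~~ (a + m.+1%:R^-1 <= x <= b - m.+1%:R^-1) ->
  cutoff a b m x = 0.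
Proof.
rewrite negb_and -!ltNge => /orP[]xm; rewrite /cutoff.
  rewrite (@rho0 1 (1 * x + _)); first by rewrite mul0r !mulr0 expR0 subrr.
  by rewrite mul1r; move: xm; set d := _^-1; lra.
rewrite (@rho0 1 (-1 * x + _)); first by rewrite !mulr0 expR0 subrr.
by rewrite mulN1r; move: xm; set d := _^-1; lra.
Qed.

Lemma cutoff_cvg (a b : R) x : cutoff a b m x @[m --> \oo] --> (\1_(`]a, b[%classic) x : R).
Proof.
rewrite indicE mem_setE; have [|xab] := boolP (x \in `]a, b[).
  rewrite in_itv/= => /andP[ax xb].
  pose e0 := Num.min (x - a) (b - x) / 2.
  have m0 : 0 < Num.min (x - a) (b - x) by rewrite lt_min !subr_gt0 ax.
  have e00 : 0 < e0 by rewrite divr_gt0.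
  pose c := rho 1 e0 * rho 1 e0.
  have c0 : 0 < c by rewrite mulr_gt0 ?rho_gt0.
  apply/cvgrPdist_le => e ep; near=> m.
  rewrite /cutoff opprB addrCA subrr addr0 ger0_norm ?expR_ge0//.
  have ecm : (e * c)^-1 <= m%:R by near: m; exact: nbhs_infty_ger.
  have me : m.+1%:R^-1 <= e0.
    rewrite -[leRHS]invrK lef_pV2 ?posrE ?ltr0n ?invr_gt0//.
    rewrite (@le_trans _ _ m%:R)// ?ler_nat//; near: m; exact: nbhs_infty_ger.
  have minl : Num.min (x - a) (b - x) <= x - a by rewrite ge_min lexx.
  have minr : Num.min (x - a) (b - x) <= b - x by rewrite ge_min lexx orbT.
  rewrite mulN1r expRN.
  set s := _ * _; have cs : m%:R * c <= s.
    rewrite ler_wpM2l// ler_pM ?rho_ge0// rho_mono//.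
      by rewrite mul1r; move: me; rewrite /e0; set d := m.+1%:R^-1; lra.
    by rewrite mulN1r; move: me; rewrite /e0; set d := m.+1%:R^-1; lra.
  rewrite -[leRHS]invrK lef_pV2 ?posrE ?expR_gt0 ?invr_gt0//.
  apply: le_trans (expR_ge1Dx _).
  apply: (@le_trans _ _ (m%:R * c)); last by move: cs; lra.
  by rewrite -ler_pdivrMr// -invfM.
apply: cvg_near_cst; apply: nearW => m; rewrite cutoff_eq0//.
apply: contraNN xab => /andP[ax xb]; rewrite in_itv/=; apply/andP; split.
  by apply: lt_le_trans ax; rewrite ltrDl invr_gt0.
by apply: le_lt_trans xb _; rewrite ltrBlDr ltrDl invr_gt0.
Unshelve. all: by end_near. Qed.

End rho.

(** * Vertical lines and integrals of partial derivatives *)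
Lemma cvg_rV {R : realType} n T (F : set_system T) {FF : Filter F}
    (f : T -> 'rV[R]_n) (l : 'rV[R]_n) :
  (forall i, f t 0 i @[t --> F] --> l 0 i) -> f @ F --> l.
Proof.
move=> H A [P Pn sPA].
have : \forall t \near F, forall j, P 0 j (f t 0 j).
  by apply: filter_forall => j; apply: H; exact: Pn.
by apply: filterS => t Pt; apply: sPA => i j; rewrite ord1; exact: Pt.
Qed.

Section rcons_lin.
Context {R : realType} {n : nat}.
Implicit Types (x v : 'rV[R]_n) (t s h : R).

Lemma rcons_affine h v x s t : rcons_rV (h *: v + x, h * s + t) =
  h *: rcons_rV (v, s) + rcons_rV (x, t).
Proof.
by apply/rowP => i; rewrite !mxE /=; case: unliftP => [j _|_] //=; rewrite !mxE.
Qed.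

Lemma rcons_delta_space (i : 'I_n) :
  rcons_rV (delta_mx 0 i, 0 : R) = delta_mx 0 (lift ord_max i).
Proof.
apply/rowP => k; rewrite !mxE eqxx /=; case: unliftP => [j ->|->] /=.
  by rewrite mxE eqxx (inj_eq lift_inj).
by rewrite (negbTE (neq_lift _ _)).
Qed.

Lemma rcons_delta_time : rcons_rV (0 : 'rV[R]_n, 1 : R) = delta_mx 0 ord_max.
Proof.
apply/rowP => k; rewrite !mxE eqxx /=; case: unliftP => [j ->|->] /=.
  by rewrite mxE eq_sym (negbTE (neq_lift _ _)).
by rewrite eqxx.
Qed.

Lemma continuous_rcons_space t : continuous (fun x : 'rV[R]_n => rcons_rV (x, t)).
Proof.
move=> x; apply: (@cvg_rV _ _ _ (nbhs x) (nbhs_filter x)) => i; rewrite mxE.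
case: (unliftP ord_max i) => [j ->|->] /=.
  apply: (@cvg_trans _ ((fun y : 'rV[R]_n => y 0 j) @ x)); last exact: coord_continuous.
  by apply: near_eq_cvg; apply: nearW => y; rewrite mxE liftK.
rewrite (_ : (fun _ => _) = (fun=> t)); first exact: cvg_cst.
by apply/funext => y; rewrite mxE unlift_none.
Qed.

Lemma continuous_rcons_time x : continuous (fun t : R => rcons_rV (x, t)).
Proof.
move=> t; apply: (@cvg_rV _ _ _ (nbhs t) (nbhs_filter t)) => i; rewrite mxE.
case: (unliftP ord_max i) => [j ->|->] /=.
  rewrite (_ : (fun _ => _) = (fun=> x 0 j)); first exact: cvg_cst.
  by apply/funext => y; rewrite mxE liftK.
by rewrite (_ : (fun _ => _) = id)//; apply/funext => y; rewrite mxE unlift_none.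
Qed.

Variable F : 'rV[R]_n.+1 -> R.

Lemma partial_rcons (t : R) (i : 'I_n) :
  partial i (fun x : 'rV[R]_n => F (rcons_rV (x, t))) =
  (fun x => partial (lift ord_max i) F (rcons_rV (x, t))).
Proof.
apply/funext => x; rewrite /partial.
rewrite (@derive_affine _ _ _ _ (fun x => rcons_rV (x, t)) F x _ (rcons_rV (delta_mx 0 i, 0))).
  by rewrite rcons_delta_space.
by move=> h; rewrite -rcons_affine mulr0 add0r.
Qed.

Lemma derivable_rcons_space (t : R) (i : 'I_n) x :
  derivable F (rcons_rV (x, t)) (delta_mx 0 (lift ord_max i)) ->
  derivable (fun x : 'rV[R]_n => F (rcons_rV (x, t))) x (delta_mx 0 i).
Proof.
rewrite -rcons_delta_space.
apply: (@derivable_affine _ _ _ _ (fun x => rcons_rV (x, t)) F).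
by move=> h; rewrite -rcons_affine mulr0 add0r.
Qed.

Lemma is_derive_rcons_time x t : smooth F ->
  is_derive t (1:R) (fun t => F (rcons_rV (x, t))) (partial ord_max F (rcons_rV (x, t))).
Proof.
move=> sF.
have E (h : R) : rcons_rV (x, h *: (1 : R) + t) =
    h *: (delta_mx 0 ord_max : 'rV[R]_n.+1) + rcons_rV (x, t).
  rewrite -rcons_delta_time -rcons_affine scaler0 add0r.
  by congr rcons_rV; congr pair.
apply: DeriveDef.
  apply: (@derivable_affine _ _ _ _ (fun t => rcons_rV (x, t)) F _ _ _ E).
  exact: smooth_derivable.
exact: (@derive_affine _ _ _ _ (fun t => rcons_rV (x, t)) F _ _ _ E).
Qed.
End rcons_lin.

Lemma smooth_rcons {R : realType} n (F : 'rV[R]_n.+1 -> R) (t : R) : smooth F ->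
  smooth (fun x : 'rV[R]_n => F (rcons_rV (x, t))).
Proof.
move=> sF; pose P (f : 'rV[R]_n -> R) := exists2 G : 'rV[R]_n.+1 -> R, smooth G &
  f = (fun x : 'rV[R]_n => G (rcons_rV (x, t))).
apply: (@smooth_coind _ _ P); last by exists F.
move=> f [G sG ->]; split; [split=> [x|i x]|move=> i].
- apply: (@continuous_comp _ _ _ (fun x => rcons_rV (x, t)) G).
    exact: continuous_rcons_space.
  exact: smooth_continuous.
- by apply: derivable_rcons_space; exact: smooth_derivable.
- rewrite partial_rcons; exists (partial (lift ord_max i) G); last by [].
  exact: smooth_partial.
Qed.

Section compact_support.
Context {R : realType}.
Local Notation mu := (@lebesgue_rV R).
Local Notation leb := (@lebesgue_measure R).

Lemma compact_cube n (M : R) : compact (cube n M).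
Proof.
rewrite (_ : cube n M = [set v : 'rV[R]_n | forall i, v ord0 i \in `[-M, M]]).
  apply: (@rV_compact _ _ (fun=> `[-M, M]%classic)).
  by move=> _; exact: segment_compact.
apply/seteqP; split => x /= H i; have := H i; by rewrite in_itv/= -ler_norml.
Qed.

Lemma continuous_bounded_compact n (f : 'rV[R]_n -> R) (K : set 'rV[R]_n) :
  continuous f -> compact K -> exists2 C : R, 0 <= C & forall x, K x -> `|f x| <= C.
Proof.
move=> cf cK; have : bounded_set (f @` K).
  by apply/compact_bounded/continuous_compact => //; exact: continuous_subspaceT.
move=> [C [_ HC]]; exists (`|C| + 1) => // x Kx.
apply: (HC (`|C| + 1)); last by exists x.
by rewrite ltr_pwDr// ler_norm.
Qed.

Lemma compact_support_integrable n (f : 'rV[R]_n -> R) (M : R) : continuous f ->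
  (forall x, ~ cube n M x -> f x = 0) -> (mu n).-integrable setT (EFin \o f).
Proof.
move=> cf f0; have [C C0 HC] := continuous_bounded_compact cf (@compact_cube n M).
have mc := @measurable_cube R n M.
rewrite (_ : f = f \_ (cube n M)); last first.
  apply/funext => x; rewrite /patch; case: ifPn => //.
  by rewrite notin_setE => /f0.
rewrite -restrict_EFin; apply/(integrable_mkcond _ mc).
apply: measurable_bounded_integrable => //; first exact: cube_finite.
  by apply: measurable_funTS; apply: continuous_measurable_rV; exact: cf.
exists C; split; first exact: num_real.
by move=> A CA x cx; apply: le_trans (HC _ cx) (ltW CA).
Qed.

Lemma integral_derive0 (F f : R -> R) (M : R) : 0 < M ->
  (forall t, is_derive t (1:R) F (f t)) -> continuous f ->
  (forall t, M < `|t| -> F t = 0) -> (\int[leb]_t (f t)%:E = 0)%E.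
Proof.
move=> M0 dF cf F0.
have f0 t : M < `|t| -> f t = 0.
  move=> Mt; have [_ <-] := dF t.
  rewrite (@near_eq_derive _ _ _ F (cst 0)) ?derive_cst//.
  near=> s; rewrite /= F0//; near: s.
  have : (fun s : R => `|s|) @ t --> `|t| by apply: cvg_norm.
  by move/cvgr_gt; apply.
rewrite (_ : (fun t => _) = (EFin \o f) \_ `[-(M+1), M+1]); last first.
  apply/funext => t; rewrite /patch; case: ifPn => //.
  rewrite notin_setE /= in_itv/= -ler_norml => /negP; rewrite -ltNge => Mt.
  by rewrite f0//; apply: lt_trans Mt; rewrite ltrDl.
rewrite -integral_mkcond (@continuous_FTC2 _ f F).
- have M1 : M < `|M + 1| by rewrite ger0_norm; lra.
  by rewrite !F0 ?normrN// -EFinB subrr.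
- by lra.
- exact: continuous_subspaceT.
- split => [t _||].
  + by have [] := dF t.
  + apply: cvg_at_right_filter; apply/differentiable_continuous/derivable1_diffP.
    by have [] := dF (- (M + 1)).
  + apply: cvg_at_left_filter; apply/differentiable_continuous/derivable1_diffP.
    by have [] := dF (M + 1).
- by move=> t _; rewrite derive1E; have [_ ->] := dF t.
Unshelve. all: by end_near. Qed.

(** Fubini with respect to the last coordinate. A derivative along it has zero
    integral on each line by the fundamental theorem of calculus; a derivative
    along another coordinate is one of a function of n - 1 variables. *)
Lemma integral_partial0 n (F : 'rV[R]_n -> R) (M : R) (i : 'I_n) : 0 < M ->
  smooth F -> (forall x, ~ cube n M x -> F x = 0) ->
  (\int[mu n]_x (partial i F x)%:E = 0)%E.
Proof.
move=> M0; elim: n F i => [F []//|n IH] F i sF F0.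
have dF0 x : ~ cube n.+1 (M + 1) x -> partial i F x = 0.
  move=> cx; rewrite /partial (@near_eq_derive _ _ _ F (cst 0)) ?derive_cst//.
  have [k /negP] : exists k, ~ (`|x 0 k| <= M + 1) by apply/existsNP.
  rewrite -ltNge => Mk; near=> z; rewrite F0//= => /(_ k); apply/negP.
  rewrite -ltNge; near: z.
  have : (fun z : 'rV[R]_n.+1 => `|z 0 k|) @ x --> `|x 0 k|.
    apply: (@continuous_comp _ _ _ (fun z : 'rV[R]_n.+1 => z 0 k) (@Num.norm _ R)).
      exact: coord_continuous.
    exact: norm_continuous.
  by move/cvgr_gt; apply; apply: lt_trans Mk; rewrite ltrDl.
have ipF : (mu n.+1).-integrable setT (EFin \o partial i F).
  apply: compact_support_integrable dF0.
  exact/smooth_continuous/smooth_partial.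
case: (unliftP ord_max i) => [j ij|ij].
  rewrite (@fubini_rV _ n _ ipF) (eq_integral (cst 0%E)) ?integral0// => t _ /=.
  have := IH (fun x => F (rcons_rV (x, t))) j (smooth_rcons t sF).
  rewrite partial_rcons -ij; apply => x cx; apply: F0 => H; apply: cx => k.
  by have := H (lift ord_max k); rewrite mxE liftK.
rewrite (@fubini_rV' _ n _ ipF) (eq_integral (cst 0%E)) ?integral0// => x _ /=.
apply: (@integral_derive0 (fun t => F (rcons_rV (x, t))) _ M) => //.
- by move=> t; rewrite ij; exact: is_derive_rcons_time.
- move=> t; apply: (@continuous_comp _ _ _ (fun t => rcons_rV (x, t)) (partial i F)).
    exact: continuous_rcons_time.
  exact/smooth_continuous/smooth_partial.
- move=> t Mt; apply: F0 => /(_ ord_max); rewrite mxE unlift_none /=.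
  by apply/negP; rewrite -ltNge.
Unshelve. all: by end_near. Qed.

End compact_support.

(** * Test functions and the fundamental lemma *)
Section test_functions.
Context {R : realType} {n : nat}.
Local Notation mu := (lebesgue_rV n).
Implicit Types (D K : set 'rV[R]_n) (f g w phi : 'rV[R]_n -> R).

Lemma smooth_bounded D f : bounded_set D -> smooth f ->
  exists2 C : R, 0 <= C & forall z, D z -> `|f z| <= C.
Proof.
move=> /bounded_sub_cube[M _ DM] sf.
have [C C0 HC] := continuous_bounded_compact (smooth_continuous sf) (@compact_cube R n M).
by exists C => // z /DM; exact: HC.
Qed.

Lemma smooth_L2 D f : measurable D -> bounded_set D -> smooth f -> L2 D f.
Proof.
move=> mD bD sf; have [C C0 HC] := smooth_bounded bD sf.
apply: (L2_bounded mD (C := C)) => //; first exact: bounded_finite_measure.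
by apply: measurable_funTS; exact: smooth_measurable.
Qed.

Lemma partial_supp (K : set 'rV[R]_n) phi i : closed K ->
  (forall x, ~ K x -> phi x = 0) -> forall x, ~ K x -> partial i phi x = 0.
Proof.
move=> cK phi0 x Kx; rewrite /partial (@near_eq_derive _ _ _ phi (cst 0)).
  exact: derive_cst.
have : open_nbhs x (~` K) by split => //; exact: closed_openC.
by move=> /open_nbhs_nbhs; apply: filterS => y /phi0.
Qed.

Lemma compact_closed_rV K : compact K -> closed K.
Proof. by apply: compact_closed; exact: norm_hausdorff. Qed.

Lemma test_function_partial D phi i : test_function D phi ->
  test_function D (partial i phi).
Proof.
move=> [sphi [K cK [KD phi0]]]; split; first exact: smooth_partial.
exists K => //; split => // x; apply: partial_supp => //.
exact: compact_closed_rV.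
Qed.

Lemma smooth_mul_test D f phi : smooth f -> test_function D phi ->
  test_function D (fun x => f x * phi x).
Proof.
move=> sf [sphi [K cK [KD phi0]]]; split; first exact: smoothM.
by exists K => //; split => // x /phi0 ->; rewrite mulr0.
Qed.

Lemma integral_partial_test D phi i : measurable D -> test_function D phi ->
  \int[mu]_(z in D) partial i phi z = 0.
Proof.
move=> mD [sphi [K cK [KD phi0]]].
have [M M0 KM] := bounded_sub_cube (compact_bounded cK).
rewrite /Rintegral integral_mkcond restrict_EFin.
rewrite (_ : (partial i phi) \_ D = partial i phi); last first.
  apply/funext => x; rewrite /patch; case: ifPn => //.
  rewrite notin_setE => Dx; apply/esym.
  rewrite (partial_supp i (compact_closed_rV cK) phi0)//.
  by move=> /KD.
rewrite (integral_partial0 i M0 sphi)// => x cx; apply: phi0.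
by move=> /KM.
Qed.

(** The product of f and a test function is a test function, hence the integral
    of its derivative vanishes; f may be arbitrary near the boundary of D. *)
Lemma smooth_weak_partial D f i : measurable D -> bounded_set D -> smooth f ->
  is_weak_partial D i f (partial i f).
Proof.
move=> mD bD sf; split; first exact: (smooth_L2 mD bD (smooth_partial i sf)).
move=> phi tphi; have [sphi _] := tphi.
have := integral_partial_test i mD (smooth_mul_test sf tphi).
rewrite partialM; [|exact: smooth_derivable..].
rewrite RintegralD//.
- move=> /eqP; rewrite addr_eq0 => /eqP ->; congr (- _).
  by apply: eq_Rintegral => x _; rewrite mulrC.
- apply: (L2_integrableM mD); first exact: (smooth_L2 mD bD sf).
  exact: (smooth_L2 mD bD (smooth_partial i sphi)).
- apply: (L2_integrableM mD); first exact: (smooth_L2 mD bD sphi).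
  exact: (smooth_L2 mD bD (smooth_partial i sf)).
Qed.

End test_functions.

Lemma prod01 {R : realType} I (r : seq I) (P : pred I) (F : I -> R) :
  (forall i, P i -> 0 <= F i <= 1) -> 0 <= \prod_(i <- r | P i) F i <= 1.
Proof.
move=> HF; elim/big_ind : _ => [|a b /andP[a0 a1] /andP[b0 b1]|//].
  by rewrite ler01 lexx.
by rewrite mulr_ge0// mulr_ile1.
Qed.

Section fundamental_lemma.
Context {R : realType} {n : nat}.
Local Notation mu := (lebesgue_rV n).
Implicit Types (D K : set 'rV[R]_n) (f g w phi : 'rV[R]_n -> R).

Lemma Rdominated_cvg D (F_ : nat -> 'rV[R]_n -> R) (F G : 'rV[R]_n -> R) :
  measurable D -> (forall k, measurable_fun D (F_ k)) -> measurable_fun D F ->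
  (forall z, D z -> F_ k z @[k --> \oo] --> F z) ->
  mu.-integrable D (EFin \o G) ->
  (forall k z, D z -> `|F_ k z| <= G z) ->
  (\int[mu]_(z in D) F_ k z) @[k --> \oo] --> \int[mu]_(z in D) F z.
Proof.
move=> mD mF_ mF cF iG FG.
have [|||//||iF _ cv] := @dominated_convergence _ _ _ mu D mD (fun k => EFin \o F_ k)
  (EFin \o F) (EFin \o G).
- by move=> k; exact/measurable_EFinP.
- exact/measurable_EFinP.
- by apply: aeW => z Dz; apply: cvg_EFin; [exact: nearW|exact: cF].
- by apply: aeW => z k Dz /=; rewrite lee_fin FG.
apply: fine_cvg; rewrite fineK//.
exact: integrable_fin_num.
Qed.

(** Balls of the norm of row vectors are boxes, hence a product of cutoffs in
    one variable. The first factor is there because the ball is empty when the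
    radius is not positive. *)
Definition ball_cutoff (B : 'rV[R]_n * R) m (x : 'rV[R]_n) : R :=
  ((0 < B.2)%R)%:R * \prod_(i < n) cutoff (B.1 0 i - B.2) (B.1 0 i + B.2) m (x 0 i).

Lemma smooth_ball_cutoff B m : smooth (ball_cutoff B m).
Proof.
apply: smoothM; first exact: smooth_cst.
by apply: smooth_prod => i; exact: smooth_cutoff.
Qed.

Lemma ball_cutoff01 B m x : 0 <= ball_cutoff B m x <= 1.
Proof.
rewrite /ball_cutoff; set p := \prod_(i < n) _.
have /andP[p0 p1] : 0 <= p <= 1.
  by apply: prod01 => i _; rewrite cutoff_ge0 cutoff_le1.
by case: (0 < B.2); rewrite ?mul1r ?mul0r ?p0 ?p1 ?lexx ?ler01.
Qed.

Lemma ball_cutoff_cvg B x :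
  ball_cutoff B m x @[m --> \oo] --> (\1_(ball B.1 B.2) x : R).
Proof.
have -> : \1_(ball B.1 B.2) x = ((0 < B.2)%R)%:R * \prod_(i < n)
   (\1_(`]B.1 0 i - B.2, B.1 0 i + B.2[%classic) (x 0 i)) :> R.
  rewrite !indicE; have [xB|xB] := pselect (ball B.1 B.2 x).
    have [B0 HB] := xB; rewrite mem_set// B0 mul1r big1// => i _.
    rewrite indicE mem_set//= in_itv/=.
    by have := HB 0 i; rewrite /ball/= ltr_distlC.
  rewrite memNset//; have [B0|] := ltP 0 B.2; last by rewrite mul0r.
  apply/esym; rewrite mul1r.
  have /existsNP[i Hi] : ~ (forall i, `|B.1 0 i - x 0 i| < B.2).
    by move=> H; apply: xB; split => // i j; rewrite ord1; exact: H.
  rewrite (bigD1 i)//= indicE memNset ?mul0r//= in_itv/= -ltr_distlC.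
  exact: Hi.
apply: cvgMr; apply: cvg_big => [|i _]; first exact: mul_continuous.
exact: cutoff_cvg.
Qed.

Lemma ball_cutoff_supp B m : exists2 K, compact K & K `<=` ball B.1 B.2 /\
  forall x, ~ K x -> ball_cutoff B m x = 0.
Proof.
have [B0|B0] := ltP 0 B.2; last first.
  exists set0; first exact: compact0.
  by split=> // x _; rewrite /ball_cutoff ltNge B0 mul0r.
pose I i := `[B.1 0 i - B.2 + m.+1%:R^-1, B.1 0 i + B.2 - m.+1%:R^-1].
have m0 : 0 < m.+1%:R^-1 :> R by rewrite invr_gt0.
exists [set v : 'rV[R]_n | forall i, v ord0 i \in I i].
  apply: (@rV_compact _ _ (fun i => [set` I i])).
  by move=> i; exact: segment_compact.
split => [x Hx|x /existsNP[i /negP Hi]].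
  split => // i j; rewrite ord1; have := Hx j; rewrite in_itv/= => /andP[H1 H2].
  rewrite /ball/= ltr_distlC; apply/andP; split.
    by apply: lt_le_trans H1; rewrite ltrDl.
  by apply: le_lt_trans H2 _; rewrite ltrBlDr ltrDl.
by rewrite /ball_cutoff (bigD1 i)//= cutoff_eq0 ?mul0r ?mulr0.
Qed.

(** Close to 1 as soon as one of the factors is close to 0, that is, on the
    union of the first m balls; 0 outside of them. *)
Definition union_cutoff (B : nat -> 'rV[R]_n * R) m (x : 'rV[R]_n) : R :=
  1 - \prod_(k < m) (1 - ball_cutoff (B k) m x).

Lemma union_cutoff_test B m D : (forall k, ball (B k).1 (B k).2 `<=` D) ->
  test_function D (union_cutoff B m).
Proof.
move=> BD; split.
  apply: smoothB; first exact: smooth_cst.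
  apply: smooth_prod => i; apply: smoothB; first exact: smooth_cst.
  exact: smooth_ball_cutoff.
have /choice[K HK] : forall k, exists K : set 'rV[R]_n, compact K /\ K `<=` ball (B k).1 (B k).2 /\
    forall x, ~ K x -> ball_cutoff (B k) m x = 0.
  by move=> k; have [K cK H] := ball_cutoff_supp (B k) m; exists K.
exists (\big[setU/set0]_(k < m) K k).
  by apply: bigsetU_compact => k _; have [] := HK k.
split=> [x|x].
  rewrite -bigcup_mkord => -[k _ Kx]; apply: (BD k).
  by have [_ []] := HK k; move=> + _; apply.
rewrite -bigcup_mkord => Kx; rewrite /union_cutoff big1 ?subrr// => i _.
have [_ [_ ->]] := HK i; rewrite ?subr0// => Ki; apply: Kx.
by exists (val i) => //=.
Qed.

Lemma union_cutoff01 B m x : 0 <= union_cutoff B m x <= 1.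
Proof.
rewrite /union_cutoff; set p := \prod_(k < m) _.
have /andP[p0 p1] : 0 <= p <= 1.
  have H k : 0 <= 1 - ball_cutoff (B k) m x <= 1.
    by have := ball_cutoff01 (B k) m x; lra.
  by apply: prod01 => i _; exact: H.
by lra.
Qed.

Lemma union_cutoff_cvg B x :
  union_cutoff B m x @[m --> \oo] --> (\1_(\bigcup_k ball (B k).1 (B k).2) x : R).
Proof.
rewrite indicE; have [[k _ Bk]|xB] := pselect ((\bigcup_k ball (B k).1 (B k).2) x).
  rewrite mem_set//; last by exists k.
  rewrite -[X in _ --> X]subr0; apply: cvgB; first exact: cvg_cst.
  have c0 : 1 - ball_cutoff (B k) m x @[m --> \oo] --> (0 : R).
    have := @ball_cutoff_cvg (B k) x; rewrite indicE mem_set// => c1.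
    by rewrite -(subrr (1 : R)); apply: cvgB => //; exact: cvg_cst.
  apply: (@squeeze_cvgr _ _ _ _ (cst 0) (fun m => 1 - ball_cutoff (B k) m x)) => //.
    near=> m.
    have H j : 0 <= 1 - ball_cutoff (B j) m x <= 1.
      by have := ball_cutoff01 (B j) m x; lra.
    have P01 (P : pred 'I_m) : 0 <= \prod_(j < m | P j) (1 - ball_cutoff (B j) m x) <= 1.
      by apply: prod01 => j _; exact: H.
    have /andP[-> _] := P01 xpredT; rewrite /=.
    have km : (k < m)%N by near: m; exact: nbhs_infty_gt.
    rewrite (bigD1 (Ordinal km))//= ler_piMr//; first by have /andP[] := H k.
    by have /andP[] := P01 (fun i => i != Ordinal km).
  exact: cvg_cst.
rewrite memNset//; apply: cvg_near_cst; apply: nearW => m.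
rewrite /union_cutoff big1 ?subrr// => i _.
have [K _ [KB ->]] := ball_cutoff_supp (B i) m; first by rewrite subr0.
by move=> /KB Bx; apply: xB; exists (val i).
Unshelve. all: by end_near. Qed.

(** Testing with [union_cutoff] and letting m tend to infinity shows that g has
    zero integral over every open subset of D. These sets are a generating
    pi-system, so the integral of g over every measurable set vanishes. *)
Lemma fundamental_lemma D g : open D -> bounded_set D -> L2 D g ->
  (forall phi, test_function D phi -> \int[mu]_(z in D) (g z * phi z) = 0) ->
  ae_eq mu D g (fun=> 0).
Proof.
move=> oD bD lg Hg; have mD := open_measurable_rV oD.
have ig : mu.-integrable D (EFin \o g).
  have := L2_integrableM mD lg (smooth_L2 mD bD (smooth_cst 1)).
  by under [X in EFin \o X]eq_fun do rewrite mulr1.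
have mg := L2_mfun mD lg.
pose h : 'rV[R]_n -> R := g \_ D.
have ih : mu.-integrable setT (EFin \o h).
  by rewrite /h -restrict_EFin; apply/(integrable_mkcond _ mD).
have ihS S : measurable S -> mu.-integrable S (EFin \o h).
  by move=> mS; apply: (integrableS measurableT).
have hopen U : open U -> (\int[mu]_(x in U) (h x)%:E = 0)%E.
  move=> oU; have mU := open_measurable_rV oU.
  have [B UE] := open_bigcup_ball (openI oU oD).
  have BD k : ball (B k).1 (B k).2 `<=` D.
    move=> x Bx; have [//] : (U `&` D) x by rewrite UE; exists k.
  have : (\int[mu]_(z in D) (g z * union_cutoff B m z)) @[m --> \oo] -->
      \int[mu]_(z in D) (g z * \1_(U `&` D) z).
    apply: (Rdominated_cvg (G := fun z => `|g z|)) => //.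
    - move=> k; apply: measurable_funM => //; apply: measurable_funTS.
      by apply: smooth_measurable; have [] := union_cutoff_test k BD.
    - apply: measurable_funM => //; apply: measurable_indic.
      exact: measurableI.
    - by move=> z Dz; apply: cvgMr; rewrite UE; exact: union_cutoff_cvg.
    - exact: integrable_norm.
    - move=> k z Dz; rewrite normrM ler_piMr//.
      by have /andP[u0 u1] := union_cutoff01 B k z; rewrite ger0_norm.
  rewrite (_ : (fun m => _) = cst 0); last first.
    by apply/funext => m; apply: Hg; exact: union_cutoff_test.
  move=> /(cvg_unique _ (cvg_cst _)) E0.
  have : (\int[mu]_(z in D) (g z * \1_(U `&` D) z)%:E = 0)%E.
    rewrite -[LHS]fineK; first by rewrite -/(Rintegral _ _ _) -E0.
    apply: integrable_fin_num => //; apply: (le_integrable mD _ _ (integrable_norm ig)).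
      apply/measurable_EFinP; apply: measurable_funM => //; apply: measurable_indic.
      exact: measurableI.
    move=> z Dz /=; rewrite lee_fin normr_id normrM ler_piMr//.
    by rewrite indicE; case: (_ \in _); rewrite ?normr0 ?normr1.
  rewrite integral_mkcond [in X in _ -> X]integral_mkcond => <-.
  apply: eq_integral => z _; rewrite /h /patch indicE.
  rewrite in_setI; case: (z \in U); case: (z \in D); by rewrite ?mulr1 ?mulr0.
have hall S : measurable S -> (\int[mu]_(x in S) (h x)%:E = 0)%E.
  rewrite [measurable S](_ : _ = <<s @open 'rV[R]_n >> S); last first.
    by rewrite -measurable_rV_open.
  apply: (dynkin_induction (P := fun S => (\int[mu]_(x in S) (h x)%:E = 0)%E)).
  - exact: measurable_rV_open.
  - exact: openI.
  - by apply: hopen; exact: openT.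
  - exact: hopen.
  - move=> A mA A0; have : (\int[mu]_(x in A `|` ~` A) (h x)%:E = 0)%E.
      by rewrite setUv; apply: hopen; exact: openT.
    rewrite integral_setU ?A0 ?add0e//.
    + exact: measurableC.
    + by rewrite setUv; exact: measurable_int ih.
    + by apply/disj_setPCl.
  - move=> F mF tF HF; rewrite integral_bigcup//.
      by rewrite eseries0// => k _ _; exact: HF.
    by apply: ihS; exact: bigcupT_measurable.
have : ae_eq mu setT (EFin \o h) (cst 0%E).
  apply: integral_ae_eq => // A _ mA; rewrite integral0.
  exact: hall.
apply: filterS => z /(_ I); rewrite /h /patch => /= + Dz.
by rewrite mem_set// => -[].
Qed.

End fundamental_lemma.

(** * Uniqueness of weak derivatives *)
Section weak.
Context {R : realType} {n : nat}.
Local Notation mu := (lebesgue_rV n).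
Variable D : set 'rV[R]_n.
Hypotheses (oD : open D) (bD : bounded_set D).
Implicit Types (f g w phi : 'rV[R]_n -> R).

Let mD : measurable D := open_measurable_rV oD.

Lemma test_L2 phi : test_function D phi -> L2 D phi.
Proof. by move=> [sphi _]; exact: (smooth_L2 mD bD sphi). Qed.

Lemma L2_test_unique g g' : L2 D g -> L2 D g' ->
  (forall phi, test_function D phi -> ip D g phi = ip D g' phi) ->
  ae_eq mu D g g'.
Proof.
move=> lg lg' H.
have /(fundamental_lemma oD bD (L2B mD lg lg')) : forall phi, test_function D phi ->
    \int[mu]_(z in D) ((g z - g' z) * phi z) = 0.
  move=> phi tphi; have lphi := test_L2 tphi.
  by rewrite -[LHS]/(ip D _ _) ipBl// H// subrr.
by apply: filterS => z H0 Dz; apply/eqP; rewrite -subr_eq0; apply/eqP/H0.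
Qed.

Lemma weak_partial_unique i w g g' :
  is_weak_partial D i w g -> is_weak_partial D i w g' -> ae_eq mu D g g'.
Proof.
move=> [lg Hg] [lg' Hg']; apply: L2_test_unique => // phi tphi.
by apply: oppr_inj; rewrite -[LHS]Hg// -[RHS]Hg'.
Qed.

Lemma weak_partialP i w : has_weak_partial D i w ->
  is_weak_partial D i w (weak_partial D i w).
Proof. by move=> Hg; apply: (@xgetPex _ (fun=> 0) [set g | is_weak_partial D i w g] Hg). Qed.

Lemma weak_partial_ae i w g : is_weak_partial D i w g ->
  ae_eq mu D (weak_partial D i w) g.
Proof.
by move=> Hg; apply: weak_partial_unique (Hg); apply: weak_partialP; exists g.
Qed.

Lemma is_weak_partialB i w w' g g' : L2 D w -> L2 D w' ->
  is_weak_partial D i w g -> is_weak_partial D i w' g' ->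
  is_weak_partial D i (w \- w') (fun z => g z - g' z).
Proof.
move=> lw lw' [lg Hg] [lg' Hg']; split; first exact: L2B.
move=> phi tphi; have lphi := test_L2 tphi.
have ldphi := test_L2 (test_function_partial i tphi).
rewrite -[LHS]/(ip D (fun z => w z - w' z) (partial i phi)) ipBl//.
rewrite -[RHS]/(- ip D (fun z => g z - g' z) phi) ipBl//.
by rewrite /ip Hg// Hg'// opprB addrC opprK.
Qed.

Lemma weak_partialB i w w' : L2 D w -> L2 D w' ->
  has_weak_partial D i w -> has_weak_partial D i w' ->
  ae_eq mu D (weak_partial D i (w \- w'))
     (fun z => weak_partial D i w z - weak_partial D i w' z).
Proof.
move=> lw lw' hw hw'; apply: weak_partial_ae.
by apply: is_weak_partialB => //; exact: weak_partialP.
Qed.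

Lemma normL2_ae f g : ae_eq mu D f g -> measurable_fun D f -> measurable_fun D g ->
  normL2 D f = normL2 D g.
Proof.
move=> fg mf mg; apply/eqP; rewrite -(@eqrXn2 _ 2)// ?normL2_ge0//.
by rewrite !normL2E//; apply/eqP/ae_eq_ip.
Qed.

End weak.

(** * Tubes and translations in time *)
Section cylinder.
Context {R : realType} {d : nat}.
Local Notation mu := (lebesgue_rV d.+1).
Implicit Types (Omega : set 'rV[R]_d) (J : set R) (z : 'rV[R]_d.+1).

Lemma rcons_space_time z : rcons_rV (space z, time z) = z.
Proof.
by apply/rowP => i; rewrite mxE; case: unliftP => [j ->|->] //=; rewrite mxE.
Qed.

Lemma space_rcons x (t : R) : space (rcons_rV (x, t)) = x :> 'rV[R]_d.
Proof. by apply/rowP => j; rewrite !mxE liftK. Qed.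

Lemma time_rcons (x : 'rV[R]_d) (t : R) : time (rcons_rV (x, t)) = t.
Proof. by rewrite /time mxE unlift_none. Qed.

Lemma continuous_space : continuous (@space R d).
Proof.
move=> z; apply: (@cvg_rV _ _ _ (nbhs z) (nbhs_filter z)) => i; rewrite mxE.
rewrite (_ : (fun _ => _) = (fun z : 'rV[R]_d.+1 => z 0 (lift ord_max i))).
  exact: coord_continuous.
by apply/funext => y; rewrite mxE.
Qed.

Lemma continuous_time : continuous (@time R d).
Proof. by move=> z; exact: coord_continuous. Qed.

(** Besides the cylinder, the proof uses the slabs of height h at the bottom
    and at the top of it, and the part of the cylinder above time h. *)
Definition tube Omega J : set 'rV[R]_d.+1 :=
  [set z | Omega (space z) /\ J (time z)].

Lemma cylinderE Omega T : cylinder Omega T = tube Omega `]0, T[.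
Proof. by apply/seteqP; split => z [Oz zT]; split => //; move: zT; rewrite /= in_itv. Qed.

Lemma subset_tube Omega J J' : J `<=` J' -> tube Omega J `<=` tube Omega J'.
Proof. by move=> JJ z [Oz /JJ]. Qed.

Lemma open_tube Omega J : open Omega -> open J -> open (tube Omega J).
Proof.
move=> oO oJ; rewrite (_ : tube Omega J = (@space R d) @^-1` Omega `&` (@time R d) @^-1` J)//.
apply: openI; apply: open_comp => // z _; first exact: continuous_space.
exact: continuous_time.
Qed.

Lemma measurable_space : measurable_fun setT (@space R d).
Proof.
apply: measurable_fun_rVP => i.
rewrite (_ : (fun _ => _) = (fun z : 'rV[R]_d.+1 => z 0 (lift ord_max i))).
  exact: measurable_coord.
by apply/funext => y; rewrite mxE.
Qed.

Lemma measurable_time : measurable_fun setT (@time R d).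
Proof. exact: measurable_coord. Qed.

Lemma measurable_tube Omega J : measurable Omega -> measurable J ->
  measurable (tube Omega J).
Proof.
move=> mO mJ; rewrite (_ : tube Omega J = (@space R d) @^-1` Omega `&` (@time R d) @^-1` J)//.
by apply: measurableI; rewrite -[X in measurable X]setTI;
  [exact: measurable_space|exact: measurable_time].
Qed.

Lemma bounded_tube Omega J : bounded_set Omega -> bounded_set J ->
  bounded_set (tube Omega J).
Proof.
move=> /bounded_sub_cube[M M0 OM] [N [_ HN]].
exists (Num.max M (`|N| + 1)); split; first exact: num_real.
move=> C; rewrite gt_max => /andP[MC NC] z [Oz Jz].
rewrite /= [leLHS]mx_normrE; apply/bigmax_leP; split => [|[i k] _ /=].
  by rewrite (le_trans (ltW M0))// ltW.
rewrite ord1; case: (unliftP ord_max k) => [j ->|->].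
  by have := OM _ Oz j; rewrite mxE => /le_trans; apply; exact: ltW.
apply: le_trans (ltW NC); apply: HN => //.
by rewrite ltr_pwDr// ler_norm.
Qed.

Lemma bounded_itvR (a b : R) : bounded_set `]a, b[%classic.
Proof.
exists (`|a| + `|b|); split; first exact: num_real.
move=> C HC x /=; rewrite in_itv/= => /andP[ax xb].
rewrite (le_trans _ (ltW HC))// ler_norml.
have := ler_norm a; have := ler_norm b; have := ler_norm (- a); have := ler_norm (- b).
rewrite !normrN; lra.
Qed.

Lemma patch_tube Omega J (f : 'rV[R]_d.+1 -> \bar R) x t :
  (f \_ (tube Omega J)) (rcons_rV (x, t)) =
  ((fun t => ((fun x => f (rcons_rV (x, t))) \_ Omega) x) \_ J) t.
Proof.
rewrite /patch.
have -> : (rcons_rV (x, t) \in tube Omega J) = (x \in Omega) && (t \in J).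
  apply/idP/andP; rewrite !inE /tube/= space_rcons time_rcons.
    by move=> [].
  by move=> [].
by case: (x \in Omega); case: (t \in J).
Qed.

Lemma tonelli_tube Omega J (f : 'rV[R]_d.+1 -> \bar R) :
  measurable Omega -> measurable J -> measurable_fun (tube Omega J) f ->
  (forall z, 0 <= f z)%E ->
  (\int[mu]_(z in tube Omega J) f z =
   \int[lebesgue_measure]_(t in J) \int[lebesgue_rV d]_(x in Omega) f (rcons_rV (x, t)))%E.
Proof.
move=> mO mJ mf f0; have mt := measurable_tube mO mJ.
rewrite integral_mkcond tonelli_rV; last 2 first.
- exact/(measurable_restrictT _ mt).
- by move=> z; rewrite /patch; case: ifP.
rewrite [RHS]integral_mkcond; apply: eq_integral => t _.
under eq_integral do rewrite patch_tube.
rewrite [RHS]/patch; case: ifPn => tJ; last first.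
  by rewrite -[RHS](@integral0 _ _ _ (lebesgue_rV d) setT); apply: eq_integral => x _; rewrite /patch (negbTE tJ).
rewrite [RHS]integral_mkcond; apply: eq_integral => x _.
by rewrite [LHS]/patch tJ.
Qed.

Lemma tonelli_tube' Omega J (f : 'rV[R]_d.+1 -> \bar R) :
  measurable Omega -> measurable J -> measurable_fun (tube Omega J) f ->
  (forall z, 0 <= f z)%E ->
  (\int[mu]_(z in tube Omega J) f z =
   \int[lebesgue_rV d]_(x in Omega) \int[lebesgue_measure]_(t in J) f (rcons_rV (x, t)))%E.
Proof.
move=> mO mJ mf f0; have mt := measurable_tube mO mJ.
rewrite integral_mkcond tonelli_rV'; last 2 first.
- exact/(measurable_restrictT _ mt).
- by move=> z; rewrite /patch; case: ifP.
rewrite [RHS]integral_mkcond; apply: eq_integral => x _.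
under eq_integral do rewrite patch_tube.
rewrite [RHS]/patch; case: ifPn => xO; last first.
  rewrite -[RHS](@integral0 _ _ _ (@lebesgue_measure R) setT); apply: eq_integral => t _.
  by rewrite /patch (negbTE xO); case: ifP.
rewrite [RHS]integral_mkcond; apply: eq_integral => t _.
by rewrite /patch xO.
Qed.

Lemma fubini_tube Omega J (f : 'rV[R]_d.+1 -> \bar R) :
  measurable Omega -> measurable J -> mu.-integrable (tube Omega J) f ->
  (\int[mu]_(z in tube Omega J) f z =
   \int[lebesgue_measure]_(t in J) \int[lebesgue_rV d]_(x in Omega) f (rcons_rV (x, t)))%E.
Proof.
move=> mO mJ intf; have mt := measurable_tube mO mJ.
rewrite integral_mkcond fubini_rV; last exact/(integrable_mkcond _ mt).
rewrite [RHS]integral_mkcond; apply: eq_integral => t _.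
under eq_integral do rewrite patch_tube.
rewrite [RHS]/patch; case: ifPn => tJ; last first.
  by rewrite -[RHS](@integral0 _ _ _ (lebesgue_rV d) setT); apply: eq_integral => x _; rewrite /patch (negbTE tJ).
rewrite [RHS]integral_mkcond; apply: eq_integral => x _.
by rewrite [LHS]/patch tJ.
Qed.

(** A function composed with [tshift h] takes at time t the value of the original
    at time t - h. *)
Definition tshift (h : R) z : 'rV[R]_d.+1 := z - h *: delta_mx 0 ord_max.

Lemma tshift_rcons h (x : 'rV[R]_d) t :
  tshift h (rcons_rV (x, t)) = rcons_rV (x, t - h).
Proof.
rewrite /tshift -rcons_delta_time -scaleNr.
rewrite -[RHS]/(rcons_rV (x, t - h)).
have := @rcons_affine R d (- h) 0 x 1 t.
by rewrite scaler0 add0r mulr1 (addrC (- h)) => ->; rewrite addrC.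
Qed.

Lemma space_tshift h z : space (tshift h z) = space z.
Proof. by rewrite -[z]rcons_space_time tshift_rcons !space_rcons. Qed.

Lemma time_tshift h z : time (tshift h z) = time z - h.
Proof. by rewrite -[z]rcons_space_time tshift_rcons !time_rcons. Qed.

Lemma measurable_tshift h : measurable_fun setT (tshift h).
Proof.
apply: measurable_fun_rVP => i.
rewrite (_ : (fun _ => _) = (fun z : 'rV[R]_d.+1 => z 0 i - h * (delta_mx 0 ord_max : 'rV[R]_d.+1) 0 i)).
  apply: measurable_funB; first exact: measurable_coord.
  exact: measurable_cst.
by apply/funext => y; rewrite !mxE.
Qed.

Lemma integral_tshift h (f : 'rV[R]_d.+1 -> \bar R) : measurable_fun setT f ->
  (forall z, 0 <= f z)%E ->
  (\int[mu]_z f (tshift h z) = \int[mu]_z f z)%E.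
Proof.
move=> mf f0.
have mft : measurable_fun setT (fun z => f (tshift h z)).
  exact: (measurableT_comp mf (measurable_tshift h)).
rewrite (tonelli_rV mft); last by move=> z; exact: f0.
rewrite (tonelli_rV mf f0).
rewrite -[RHS](integral_shift (- h)).
- apply: eq_integral => t _; apply: eq_integral => x _.
  by rewrite tshift_rcons.
- exact: measurable_tonelli_rV.
- by move=> t; apply: integral_ge0.
Qed.

End cylinder.

(** * Convergence in L^2 *)
Section subset_L2.
Context {R : realType} {n : nat}.
Local Notation mu := (lebesgue_rV n).
Implicit Types (D : set 'rV[R]_n) (f g w : 'rV[R]_n -> R).

Lemma L2S D D' w : measurable D -> measurable D' -> D' `<=` D -> L2 D w -> L2 D' w.
Proof.
move=> mD mD' DD /(L2P mD)[mw iw]; apply/(L2P mD'); split.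
  exact: measurable_funS mw.
exact: (integrableS mD).
Qed.

Lemma normL2S D D' w : measurable D -> measurable D' -> D' `<=` D -> L2 D w ->
  normL2 D' w <= normL2 D w.
Proof.
move=> mD mD' DD lw; rewrite -(@ler_pXn2r _ 2)// ?nnegrE ?normL2_ge0//.
have lw' := L2S mD mD' DD lw.
rewrite !normL2E /ip /Rintegral fine_le//.
- by apply: integrable_fin_num => //; exact: L2_integrableM.
- by apply: integrable_fin_num => //; exact: L2_integrableM.
apply: ge0_subset_integral => //.
  exact: (measurable_int _ (L2_integrableM mD lw lw)).
by move=> x _; rewrite lee_fin -expr2 sqr_ge0.
Qed.

Lemma normL2_distC D f g : measurable D ->
  normL2 D (fun z => f z - g z) = normL2 D (fun z => g z - f z).
Proof.
move=> mD; apply/eqP; rewrite -(@eqrXn2 _ 2)// ?normL2_ge0// !normL2E //; apply/eqP.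
by apply: eq_Rintegral => z _; ring.
Qed.

Lemma integrable_Rsum D I (r : seq I) (F : I -> 'rV[R]_n -> R) : measurable D ->
  (forall i, mu.-integrable D (EFin \o F i)) ->
  mu.-integrable D (EFin \o (fun z => \sum_(i <- r) F i z)) /\
  \int[mu]_(z in D) (\sum_(i <- r) F i z) = \sum_(i <- r) \int[mu]_(z in D) F i z.
Proof.
move=> mD iF; elim: r => [|i r [IH1 IH2]].
  rewrite big_nil (_ : (fun z => _) = fun=> 0); last first.
    by apply/funext => z; rewrite big_nil.
  by split; [exact: integrable0|rewrite /Rintegral integral0].
rewrite big_cons -IH2.
rewrite (_ : (fun z => _) = fun z => F i z + \sum_(j <- r) F j z); last first.
  by apply/funext => z; rewrite big_cons.
split; last by rewrite RintegralD.
exact: (integrableD mD (iF i) IH1).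
Qed.

Lemma ip_cvg D (f_ : nat -> 'rV[R]_n -> R) f g : measurable D ->
  (forall k, L2 D (f_ k)) -> L2 D f -> L2 D g ->
  normL2 D (fun z => f_ k z - f z) @[k --> \oo] --> (0 : R) ->
  ip D (f_ k) g @[k --> \oo] --> ip D f g.
Proof.
move=> mD lf_ lf lg cf.
apply: cvg_zero; apply: norm_cvg0.
have cM : normL2 D (fun z => f_ k z - f z) * normL2 D g @[k --> \oo] --> (0 : R).
  by rewrite -(mul0r (normL2 D g)); apply: cvgMl.
apply: (squeeze_cvgr _ (cvg_cst 0) cM).
near=> k; rewrite normr_ge0/= (le_trans _ (ip_CS mD _ lg))//; last exact: L2B.
by rewrite ipBl.
Unshelve. all: by end_near. Qed.

Lemma normL2_cvg D (f_ : nat -> 'rV[R]_n -> R) f : measurable D ->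
  (forall k, L2 D (f_ k)) -> L2 D f ->
  normL2 D (fun z => f_ k z - f z) @[k --> \oo] --> (0 : R) ->
  normL2 D (f_ k) @[k --> \oo] --> normL2 D f.
Proof.
move=> mD lf_ lf cf; apply: cvg_zero; apply: norm_cvg0.
apply: (squeeze_cvgr _ (cvg_cst 0) cf).
near=> k; rewrite normr_ge0/= ler_norml; apply/andP; split.
  rewrite lerBrDl lerBlDr.
  have := normL2_triangle mD (lf_ k) (L2B mD lf (lf_ k)).
  rewrite (_ : (fun z => _ + _) = f); last by apply/funext => z; ring.
  by rewrite normL2_distC// addrC.
have := normL2_triangle mD lf (L2B mD (lf_ k) lf).
rewrite (_ : (fun z => _ + _) = f_ k); last by apply/funext => z; ring.
by rewrite lerBlDl.
Unshelve. all: by end_near. Qed.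
End subset_L2.

(** * Functions that vanish near the lateral boundary *)
Section smooth_cylinder.
Context {R : realType} {d : nat}.
Local Notation mu := (lebesgue_rV d.+1).
Implicit Types (Omega K : set 'rV[R]_d) (phi psi : 'rV[R]_d.+1 -> R).

Lemma tshift_affine (h k : R) (v x : 'rV[R]_d.+1) :
  tshift h (k *: v + x) = k *: v + tshift h x.
Proof. by rewrite /tshift addrA. Qed.

Lemma partial_tshift h i phi :
  partial i (fun z => phi (tshift h z)) = (fun z => partial i phi (tshift h z)).
Proof.
apply/funext => z; rewrite /partial.
by apply: (@derive_affine _ _ _ _ (tshift h) phi) => k; exact: tshift_affine.
Qed.

Lemma continuous_tshift (h : R) : continuous (@tshift R d h).
Proof.
move=> z; apply: (@cvgB _ _ _ (nbhs z) (nbhs_filter z) id (cst (h *: delta_mx 0 ord_max))).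
  exact: cvg_id.
exact: cvg_cst.
Qed.

Lemma smooth_tshift h phi : smooth phi -> smooth (fun z => phi (tshift h z)).
Proof.
move=> sphi; pose P (f : 'rV[R]_d.+1 -> R) := exists2 G : 'rV[R]_d.+1 -> R, smooth G &
  f = (fun z => G (tshift h z)).
apply: (@smooth_coind _ _ P); last by exists phi.
move=> f [G sG ->]; split; [split=> [x|i x]|move=> i].
- apply: (@continuous_comp _ _ _ (tshift h) G); first exact: continuous_tshift.
  exact: smooth_continuous.
- apply: (@derivable_affine _ _ _ _ (tshift h) G _ _ (delta_mx 0 i)).
    by move=> k; exact: tshift_affine.
  exact: smooth_derivable.
- rewrite partial_tshift; exists (partial i G); last by [].
  exact: smooth_partial.
Qed.

Lemma space_affine (k : R) (v x : 'rV[R]_d.+1) :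
  space (k *: v + x) = k *: space v + space x.
Proof. by apply/rowP => i; rewrite !mxE. Qed.

Lemma space_delta_space (j : 'I_d) :
  space (delta_mx 0 (lift ord_max j)) = delta_mx 0 j :> 'rV[R]_d.
Proof. by rewrite -rcons_delta_space space_rcons. Qed.

Lemma space_delta_time : space (delta_mx 0 ord_max) = 0 :> 'rV[R]_d.
Proof. by rewrite -rcons_delta_time space_rcons. Qed.

Lemma partial_space j (eta : 'rV[R]_d -> R) :
  partial (lift ord_max j) (fun z => eta (space z)) = (fun z => partial j eta (space z)).
Proof.
apply/funext => z; rewrite /partial -space_delta_space.
by apply: (@derive_affine _ _ _ _ (@space R d) eta) => k; exact: space_affine.
Qed.

Lemma partial_space_time (eta : 'rV[R]_d -> R) :
  partial ord_max (fun z => eta (space z)) = (fun=> 0).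
Proof.
apply/funext => z; rewrite /partial.
rewrite (@derive_affine _ _ _ _ (@space R d) eta _ _ 0) ?derive0// => k.
by rewrite space_affine space_delta_time.
Qed.

Lemma smooth_space (eta : 'rV[R]_d -> R) : smooth eta ->
  smooth (fun z => eta (space z)).
Proof.
move=> seta; pose P (f : 'rV[R]_d.+1 -> R) := exists2 G : 'rV[R]_d -> R, smooth G &
  f = (fun z => G (space z)).
apply: (@smooth_coind _ _ P); last by exists eta.
move=> f [G sG ->]; split; [split=> [x|i x]|move=> i].
- apply: (@continuous_comp _ _ _ (@space R d) G); first exact: continuous_space.
  exact: smooth_continuous.
- apply: (@derivable_affine _ _ _ _ (@space R d) G _ _ (space (delta_mx 0 i))).
    by move=> k; exact: space_affine.
  case: (unliftP ord_max i) => [j ->|->]; last by rewrite space_delta_time; exact: derivable0.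
  by rewrite space_delta_space; exact: smooth_derivable.
case: (unliftP ord_max i) => [j ->|->].
  by rewrite partial_space; exists (partial j G); [exact: smooth_partial|].
by rewrite partial_space_time; exists (fun=> 0); [exact: smooth_cst|].
Qed.

Lemma partial_time j (th : R -> R) :
  partial (lift ord_max j) (fun z : 'rV[R]_d.+1 => th (time z)) = (fun=> 0).
Proof.
apply/funext => z; rewrite /partial.
rewrite (@derive_affine _ _ R R (@time R d) th _ _ 0) ?derive0// => k.
by rewrite /time !mxE scaler0 eqxx (negbTE (neq_lift _ _)) mulr0.
Qed.

Lemma closed_preimage (T U : topologicalType) (f : T -> U) (A : set U) :
  continuous f -> closed A -> closed (f @^-1` A).
Proof. by move=> cf cA; apply: closed_comp => // x _; exact: cf. Qed.

(** The cutoff in time supplies the missing compactness of the support in the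
    time direction. *)
Lemma lateral_cutoff_test Omega K (T a b : R) psi m : compact K -> K `<=` Omega ->
  0 <= a -> b <= T -> smooth psi -> (forall z, ~ K (space z) -> psi z = 0) ->
  test_function (cylinder Omega T) (fun z => psi z * cutoff a b m (time z)).
Proof.
move=> cK KO a0 bT spsi psi0; split.
  by apply: (smoothM spsi); exact: (smooth_cutoff ord_max).
have m0 : 0 < m.+1%:R^-1 :> R by rewrite invr_gt0.
set l := a + m.+1%:R^-1; set r := b - m.+1%:R^-1.
exists (tube K `[l, r]).
  apply: bounded_closed_compact.
    apply: bounded_tube; first exact: compact_bounded.
    apply: compact_bounded; exact: segment_compact.
  rewrite (_ : tube K _ = (@space R d) @^-1` K `&` (@time R d) @^-1` `[l, r]%classic)//.
  apply: closedI; apply: closed_preimage.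
  - exact: continuous_space.
  - exact: compact_closed_rV.
  - exact: continuous_time.
  - exact: itv_closed.
split=> [z [Kz]|z Kz].
  rewrite /= in_itv/= => /andP[lz zr]; split; first exact: KO.
  rewrite (lt_le_trans _ lz) /l ?ltr_wpDl//=.
  by rewrite (le_lt_trans zr)// /r ltrBlDr (le_lt_trans bT)// ltrDl.
have [Ksz|Ksz] := pselect (K (space z)); last by rewrite psi0// mul0r.
rewrite cutoff_eq0 ?mulr0//; apply/negP => lzr; exact: Kz.
Qed.

Lemma cutoff_integral_cvg Omega (T a b : R) (F : 'rV[R]_d.+1 -> R) :
  measurable Omega -> 0 <= a -> b <= T ->
  mu.-integrable (cylinder Omega T) (EFin \o F) ->
  \int[mu]_(z in cylinder Omega T) (F z * cutoff a b m (time z)) @[m --> \oo] -->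
  \int[mu]_(z in tube Omega `]a, b[) F z.
Proof.
move=> mO a0 bT iF.
have mQ : measurable (cylinder Omega T) by rewrite cylinderE; exact: measurable_tube.
have mF : measurable_fun (cylinder Omega T) F.
  by apply/measurable_EFinP; exact: measurable_int iF.
have mcut m : measurable_fun setT (fun z : 'rV[R]_d.+1 => cutoff a b m (time z)).
  by apply: smooth_measurable; exact: (smooth_cutoff ord_max).
have -> : \int[mu]_(z in tube Omega `]a, b[) F z =
    \int[mu]_(z in cylinder Omega T) (F z * \1_(`]a, b[%classic) (time z)).
  rewrite Rintegral_mkcond [RHS]Rintegral_mkcond; apply: eq_Rintegral => z _.
  rewrite /patch indicE.
  have [zO|zO] := pselect (Omega (space z)); last first.
    by rewrite !memNset// => -[].
  have [zJ|zJ] := pselect (`]a, b[%classic (time z)).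
    rewrite !mem_set ?mulr1//; split=> //; move: zJ; rewrite /= in_itv/=.
    by move=> /andP[az zb]; rewrite (le_lt_trans a0 az) (lt_le_trans zb bT).
  rewrite (memNset zJ) mulr0 memNset; first by case: ifP.
  by move=> [].
apply: (Rdominated_cvg (G := fun z => `|F z|)) => //.
- by move=> m; apply: measurable_funM => //; exact: measurable_funTS.
- apply: measurable_funM => //; apply: measurable_funTS.
  rewrite (_ : (fun _ => _) = \1_((@time R d) @^-1` `]a, b[)); last first.
    by apply/funext => z; rewrite !indicE; congr (_%:R); rewrite !in_setE.
  apply: measurable_indic; rewrite -[X in measurable X]setTI.
  exact: measurable_time.
- by move=> z _; apply: cvgMr; exact: cutoff_cvg.
- exact: integrable_norm.
- by move=> m z _; rewrite normrM ler_piMr// cutoff_norm_le1.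
Qed.

Section divergence.
Variables (Omega : set 'rV[R]_d) (T : R).
Hypotheses (oO : open Omega) (bO : bounded_set Omega).
Local Notation Q := (cylinder Omega T).

Lemma open_cylinder : open Q.
Proof. by rewrite cylinderE; apply: open_tube. Qed.

Lemma bounded_cylinder : bounded_set Q.
Proof. by rewrite cylinderE; apply: bounded_tube => //; exact: bounded_itvR. Qed.

Let mO := open_measurable_rV oO.
Let mQ := open_measurable_rV open_cylinder.
Let bQ := bounded_cylinder.

(** The cutoff in time of [lateral_cutoff_test] has no spatial derivative, so it
    factors out of the identity that defines the divergence, and it can be sent
    to the indicator of ]a, b[: integrating by parts in space on a slab creates
    no term at times a and b. *)
Lemma divx_lateral (K : set 'rV[R]_d) (a b : R) (y : 'rV[R]_d.+1 -> 'rV[R]_d) g psi :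
  L2v Q y -> is_divx Omega T y g -> 0 <= a -> b <= T ->
  compact K -> K `<=` Omega -> smooth psi -> (forall z, ~ K (space z) -> psi z = 0) ->
  \sum_j ip (tube Omega `]a, b[) (fun z => y z 0 j) (partial (lift ord_max j) psi) =
  - ip (tube Omega `]a, b[) g psi.
Proof.
move=> ly [lg Hg] a0 bT cK KO spsi psi0.
have mab : measurable (tube Omega `]a, b[) by exact: measurable_tube.
have abQ : tube Omega `]a, b[ `<=` Q.
  rewrite cylinderE; apply: subset_tube => t /=; rewrite !in_itv/=.
  by move=> /andP[at_ tb]; rewrite (le_lt_trans a0)//= (lt_le_trans tb).
have lpsi := smooth_L2 mQ bQ spsi.
have lDpsi j := smooth_L2 mQ bQ (smooth_partial (lift ord_max j) spsi).
pose F z := \sum_j y z 0 j * partial (lift ord_max j) psi z.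
have [iF _] := integrable_Rsum (index_enum 'I_d) mQ (fun j =>
  L2_integrableM mQ (ly j) (lDpsi j)).
have ig := L2_integrableM mQ lg lpsi.
have cF := cutoff_integral_cvg mO a0 bT iF.
have cg := cutoff_integral_cvg mO a0 bT ig.
have E m : \int[mu]_(z in Q) (F z * cutoff a b m (time z)) =
    - \int[mu]_(z in Q) (g z * psi z * cutoff a b m (time z)).
  have tf := lateral_cutoff_test m cK KO a0 bT spsi psi0.
  have := Hg _ tf; rewrite (_ : (fun z => g z * _) = (fun z => g z * psi z * cutoff a b m (time z))).
    move=> <-; apply: eq_Rintegral => z _; rewrite /F mulr_suml.
    apply: eq_bigr => j _; rewrite partialM.
    + rewrite (partial_time j (cutoff a b m)) mulr0 add0r.
      by rewrite -mulrA (mulrC (cutoff _ _ _ _)).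
    + exact: smooth_derivable.
    + by apply: smooth_derivable; exact: (smooth_cutoff ord_max).
  by apply/funext => z; rewrite mulrA.
have {}cF : (- \int[mu]_(z in Q) (g z * psi z * cutoff a b m (time z))) @[m --> \oo] -->
     \int[mu]_(z in tube Omega `]a, b[) F z.
  apply: cvg_trans cF; by apply: near_eq_cvg; apply: nearW => m; exact: E.
have <- := cvg_unique (@norm_hausdorff _ _) cF (cvgN cg).
have lyab j : L2 (tube Omega `]a, b[) (fun z => y z 0 j) by apply: L2S (ly j).
have lDpsiab j := L2S mQ mab abQ (lDpsi j).
have [_ ->] := integrable_Rsum (index_enum 'I_d) mab (fun j =>
  L2_integrableM mab (lyab j) (lDpsiab j)).
by [].
Qed.

Section shift.
Variables (J J' : set R) (h : R).
Hypotheses (mJ : measurable J) (mJ' : measurable J').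
Hypothesis JJ' : forall t, J' t <-> J (t - h).
Implicit Types w : 'rV[R]_d.+1 -> R.

Let mtJ : measurable (tube Omega J). Proof. exact: measurable_tube. Qed.
Let mtJ' : measurable (tube Omega J'). Proof. exact: measurable_tube. Qed.

Lemma tube_tshift z : tube Omega J' z <-> tube Omega J (tshift h z).
Proof. by rewrite /tube/= space_tshift time_tshift JJ'. Qed.

Lemma integral_tube_tshift (f : 'rV[R]_d.+1 -> \bar R) :
  measurable_fun (tube Omega J) f -> (forall z, 0 <= f z)%E ->
  (\int[mu]_(z in tube Omega J') f (tshift h z) = \int[mu]_(z in tube Omega J) f z)%E.
Proof.
move=> mf f0; rewrite integral_mkcond [RHS]integral_mkcond.
rewrite -[RHS](integral_tshift h).
- apply: eq_integral => z _; rewrite /patch.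
  have [zJ|zJ] := pselect (tube Omega J' z).
    by rewrite !mem_set//; exact/tube_tshift.
  by rewrite !memNset// => /tube_tshift.
- exact/(measurable_restrictT _ mtJ).
- by move=> z; rewrite /patch; case: ifP.
Qed.

Lemma measurable_fun_tube_tshift w : measurable_fun (tube Omega J) w ->
  measurable_fun (tube Omega J') (fun z => w (tshift h z)).
Proof.
move=> mw; apply/(measurable_restrictT _ mtJ').
rewrite (_ : _ \_ _ = (w \_ (tube Omega J)) \o tshift h).
  apply: measurableT_comp; last exact: measurable_tshift.
  exact/(measurable_restrictT _ mtJ).
apply/funext => z; rewrite /patch /=.
have [zJ|zJ] := pselect (tube Omega J' z).
  by rewrite !mem_set//; exact/tube_tshift.
by rewrite !memNset// => /tube_tshift.
Qed.

Lemma L2_tshift w : L2 (tube Omega J) w -> L2 (tube Omega J') (fun z => w (tshift h z)).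
Proof.
move=> /(L2P mtJ)[mw /integrableP[mw2 iw2]]; apply/(L2P mtJ'); split.
  exact: measurable_fun_tube_tshift.
apply/integrableP; split.
  apply/measurable_EFinP; apply: measurable_funX.
  exact: measurable_fun_tube_tshift.
rewrite [X in (X < _)%E](integral_tube_tshift (f := fun z : 'rV[R]_d.+1 => `|(w z ^+ 2)%:E|%E))//.
exact: measurableT_comp.
Qed.

Lemma normL2_tshift w : measurable_fun (tube Omega J) w ->
  normL2 (tube Omega J') (fun z => w (tshift h z)) = normL2 (tube Omega J) w.
Proof.
move=> mw; apply/eqP; rewrite -(@eqrXn2 _ 2)// ?normL2_ge0// !normL2E //; apply/eqP.
rewrite /ip /Rintegral (integral_tube_tshift (f := fun z => (w z * w z)%:E))//.
  by apply/measurable_EFinP; exact: measurable_funM.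
by move=> z; rewrite lee_fin -expr2 sqr_ge0.
Qed.

End shift.

Lemma tube_sub_cylinder (J : set R) : J `<=` `]0, T[ -> tube Omega J `<=` Q.
Proof. by rewrite cylinderE; exact: subset_tube. Qed.

Lemma shiftJ (h a b : R) t : (`]a + h, b + h[%classic t) <-> (`]a, b[%classic (t - h)).
Proof. by rewrite /= !in_itv/= ltrBrDr ltrBlDr. Qed.

(** The smooth functions by which [zero_on_Sigma] approximates. *)
Definition lateral phi := smooth phi /\ exists2 K : set 'rV[R]_d, compact K &
  K `<=` Omega /\ forall z, ~ K (space z) -> phi z = 0.

(** Translation in time preserves the vanishing near the lateral boundary, hence
    a translate of e is an admissible factor in the integration by parts. For
    y the gradient of e, this expresses the difference quotients in time of the
    gradient by those of e, so that mixed derivatives in space and time never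
    appear. *)
Lemma divx_shift (y : 'rV[R]_d.+1 -> 'rV[R]_d) g (e : 'rV[R]_d.+1 -> R)
    (G : 'I_d -> 'rV[R]_d.+1 -> R) (phi : nat -> 'rV[R]_d.+1 -> R) (h : R) :
  0 <= h -> L2v Q y -> is_divx Omega T y g ->
  L2 Q e -> (forall j, L2 Q (G j)) -> (forall k, lateral (phi k)) ->
  normL2 Q (fun z => phi k z - e z) @[k --> \oo] --> (0 : R) ->
  (forall j, normL2 Q (fun z => partial (lift ord_max j) (phi k) z - G j z) @[k --> \oo]
     --> (0 : R)) ->
  \sum_j ip (tube Omega `]h, T[) (fun z => y z 0 j) (fun z => G j (tshift h z)) =
  - ip (tube Omega `]h, T[) g (fun z => e (tshift h z)).
Proof.
move=> h0 ly Hg le lG lphi ce cG; have [lg _] := Hg.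
have mhT : measurable (tube Omega `]h, T[) by exact: measurable_tube.
have hTQ : tube Omega `]h, T[ `<=` Q.
  apply: tube_sub_cylinder => t /=; rewrite !in_itv/= => /andP[ht ->].
  by rewrite andbT (le_lt_trans h0).
have m0T : measurable (tube Omega `]0, T - h[) by exact: measurable_tube.
have h0TQ : tube Omega `]0, T - h[ `<=` Q.
  apply: tube_sub_cylinder => t /=; rewrite !in_itv/= => /andP[-> ht] /=.
  by rewrite (lt_le_trans ht)// lerBlDr lerDl.
have sJ t : `]h, T[%classic t <-> `]0, T - h[%classic (t - h).
  by have := shiftJ h 0 (T - h) t; rewrite add0r subrK.
have L2h w : L2 Q w -> L2 (tube Omega `]h, T[) (fun z => w (tshift h z)).
  by move=> lw; apply: (L2_tshift _ _ sJ) => //; exact: L2S lw.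
have L2r w : L2 Q w -> L2 (tube Omega `]h, T[) w by move=> lw; exact: L2S lw.
have cvgh (w_ : nat -> 'rV[R]_d.+1 -> R) w v : (forall k, L2 Q (w_ k)) -> L2 Q w ->
    normL2 Q (fun z => w_ k z - w z) @[k --> \oo] --> (0 : R) -> L2 Q v ->
    ip (tube Omega `]h, T[) v (fun z => w_ k (tshift h z)) @[k --> \oo] -->
    ip (tube Omega `]h, T[) v (fun z => w (tshift h z)).
  move=> lw_ lw cw lv; under eq_fun do rewrite ipC; rewrite ipC.
  apply: ip_cvg; [by []|by move=> k; exact: L2h|exact: L2h|exact: L2r|].
  apply: (squeeze_cvgr _ (cvg_cst 0) cw).
  near=> k; rewrite normL2_ge0/=.
  have lwk := L2B mQ (lw_ k) lw.
  rewrite (normL2_tshift (J := `]0, T - h[%classic) _ sJ (w := fun z => w_ k z - w z))//.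
    exact: normL2S.
  exact: L2_mfun (L2S mQ m0T h0TQ lwk).
have L2phi k : L2 Q (phi k) by have [sp _] := lphi k; exact: (smooth_L2 mQ bQ sp).
have L2Dphi k i : L2 Q (partial i (phi k)).
  by have [sp _] := lphi k; exact: (smooth_L2 mQ bQ (smooth_partial i sp)).
have E k : \sum_j ip (tube Omega `]h, T[) (fun z => y z 0 j)
     (fun z => partial (lift ord_max j) (phi k) (tshift h z)) =
    - ip (tube Omega `]h, T[) g (fun z => phi k (tshift h z)).
  have [sp [K cK [KO phi0]]] := lphi k.
  rewrite -(@divx_lateral K h T y g _ ly Hg h0 (lexx T) cK KO (smooth_tshift h sp)).
    by apply: eq_bigr => j _; rewrite partial_tshift.
  by move=> z Kz; apply: phi0; rewrite space_tshift.
have c1 : \sum_j ip (tube Omega `]h, T[) (fun z => y z 0 j)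
     (fun z => partial (lift ord_max j) (phi k) (tshift h z)) @[k --> \oo] -->
   \sum_j ip (tube Omega `]h, T[) (fun z => y z 0 j) (fun z => G j (tshift h z)).
  apply: cvg_big => [|j _]; first exact: add_continuous.
  apply: (cvgh (fun k => partial (lift ord_max j) (phi k)) (G j)).
  - by move=> k; exact: L2Dphi.
  - exact: lG.
  - exact: cG.
  - exact: ly.
have c2 := cvgN (cvgh _ _ _ L2phi le ce lg).
rewrite (funext E) in c1.
exact: (cvg_unique (@norm_hausdorff _ _) c1 (c2 _)).
Unshelve. all: by end_near. Qed.

End divergence.
End smooth_cylinder.

(** * Difference quotients in one variable *)
Section one_dim.
Context {R : realType}.
Local Notation leb := (@lebesgue_measure R).
Variables (psi q : R -> R).
Hypotheses (dpsi : forall t, is_derive t (1:R) psi (q t)) (cq : continuous q).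

Let cpsi : continuous psi.
Proof.
by move=> t; apply/differentiable_continuous/derivable1_diffP; have [] := dpsi t.
Qed.

Let mq : measurable_fun setT q.
Proof. exact: continuous_measurable_fun. Qed.

Let mpsi : measurable_fun setT psi.
Proof. exact: continuous_measurable_fun. Qed.

Let mq2 D : measurable_fun D (fun r => (q r ^+ 2)%:E).
Proof. by apply/measurable_EFinP/measurable_funTS; exact: measurable_funX. Qed.

(** The integral of (q - c) ^+ 2 is nonnegative for c the mean slope of psi; this
    is Cauchy-Schwarz for the increment of psi. *)
Lemma sqr_increment (s t : R) : s < t ->
  (((psi t - psi s) ^+ 2)%:E <=
   (t - s)%:E * \int[leb]_(r in `[s, t]) (q r ^+ 2)%:E)%E.
Proof.
move=> st; have sc := @segment_compact R s t.
have iq : leb.-integrable `[s, t] (EFin \o q).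
  by apply: continuous_compact_integrable => //; exact: continuous_subspaceT.
have iq2 : leb.-integrable `[s, t] (EFin \o (fun r => q r ^+ 2)).
  apply: continuous_compact_integrable => //; apply: continuous_subspaceT => r.
  by apply: (@continuous_comp _ _ _ q (fun x => x ^+ 2)); [exact: cq|exact: exprn_continuous].
have I1 : (\int[leb]_(r in `[s, t]) (q r)%:E = (psi t - psi s)%:E)%E.
  rewrite (@continuous_FTC2 _ q psi)//.
  - exact: continuous_subspaceT.
  - split => [r _||]; first by have [] := dpsi r.
      by apply: cvg_at_right_filter; exact: cpsi.
    by apply: cvg_at_left_filter; exact: cpsi.
  - by move=> r _; rewrite derive1E; have [_ ->] := dpsi r.
set c := (psi t - psi s) / (t - s).
have ts0 : 0 < t - s by rewrite subr_gt0.
have mst : leb `[s, t]%classic = (t - s)%:E.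
  by rewrite lebesgue_measure_itv/= lte_fin st.
have icst (k : R) : leb.-integrable `[s, t] (EFin \o cst k).
  apply: continuous_compact_integrable => //; apply: continuous_subspaceT => r.
  exact: cvg_cst.
have : (0 <= \int[leb]_(r in `[s, t]) ((q r - c) ^+ 2)%:E)%E.
  by apply: integral_ge0 => r _; rewrite lee_fin sqr_ge0.
have -> : (\int[leb]_(r in `[s, t]) ((q r - c) ^+ 2)%:E =
   \int[leb]_(r in `[s, t]) (q r ^+ 2)%:E + ((- 2 * c) * (psi t - psi s) + c ^+ 2 * (t - s))%:E)%E.
  transitivity (\int[leb]_(r in `[s, t]) ((q r ^+ 2)%:E + ((-2 * c)%:E * (q r)%:E + (cst (c ^+ 2) r)%:E)))%E.
    by apply: eq_integral => r _; rewrite -EFinM -!EFinD; congr (_%:E); rewrite /=; ring.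
  rewrite integralD//=; last first.
    by apply: (@integrableD _ _ _ leb _ _ (fun r => (-2 * c)%:E * (q r)%:E)%E (EFin \o cst (c ^+ 2))) => //; exact: (integrableZl _ (-2 * c) iq).
  have iZ : leb.-integrable `[s, t] (fun r => ((-2 * c)%:E * (q r)%:E)%E).
    apply: (@integrableZl _ _ _ leb) => //; exact: iq.
  congr (_ + _)%E; rewrite (integralD _ iZ (icst (c ^+ 2)))//=.
  rewrite integralZl// I1 -EFinM.
  by rewrite (integral_cst _ _ (c ^+ 2)%:E)// [X in (_ * X)%E]mst -!EFinM -EFinD.
have := integrable_fin_num _ iq2; move=> /(_ (measurable_itv _)).
move: (\int[leb]_(r in _) _)%E => [I| |]//= _; rewrite -EFinD -EFinM !lee_fin.
have -> : -2 * c * (psi t - psi s) + c ^+ 2 * (t - s) = - ((psi t - psi s) ^+ 2 / (t - s)).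
  by rewrite /c; field; rewrite gt_eqF.
by rewrite subr_ge0 ler_pdivrMr// mulrC.
Qed.

(** [sqr_increment] on [t - h, t], integrated over t. After Tonelli each r is
    counted for the t in [r, r + h], a set of measure h. *)
Lemma integral_quotient (T h : R) : 0 < h -> h < T ->
  (\int[leb]_(t in `]h, T[) ((psi t - psi (t - h)) ^+ 2)%:E <=
   (h ^+ 2)%:E * \int[leb]_(t in `]0%R, T[) (q t ^+ 2)%:E)%E.
Proof.
move=> h0 hT.
(* supported by the pairs p with p.1 - h <= p.2 <= p.1 *)
pose F (p : R * R) : \bar R :=
  (\1_(`]h, T[%classic) p.1 * \1_(`[0, h]%classic) (p.1 - p.2) * q p.2 ^+ 2)%:E.
have F0 p : (0 <= F p)%E by rewrite lee_fin mulr_ge0 ?sqr_ge0// mulr_ge0// indicE ler0n.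
have mF : measurable_fun [set: measurableTypeR R * measurableTypeR R] F.
  apply/measurable_EFinP; apply: measurable_funM.
    apply: measurable_funM.
      exact: (measurableT_comp (measurable_indic (measurable_itv `]h, T[)) measurable_fst).
    apply: (measurableT_comp (measurable_indic (measurable_itv `[0, h]))).
    by apply: measurable_funB.
  apply: measurable_funX; exact: (measurableT_comp mq measurable_snd).
apply: (@le_trans _ _ (h%:E * \int[leb]_t \int[leb]_s F (t, s))%E).
  rewrite integral_mkcond -ge0_integralZl//; last 3 first.
  - exact: (@measurable_fun_fubini_tonelli_F _ _ _ _ _ leb F mF F0).
  - by move=> t _; apply: integral_ge0.
  - by rewrite lee_fin ltW.
  apply: ge0_le_integral => //.
  - by move=> t _; rewrite /patch; case: ifP => // _; rewrite lee_fin sqr_ge0.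
  - apply/(measurable_restrictT _ (measurable_itv _)); apply/measurable_EFinP/measurable_funTS.
    apply: measurable_funX; apply: measurable_funB => //.
    by apply: (measurableT_comp mpsi); exact: measurable_funB.
  - by apply: measurable_funeM; exact: (@measurable_fun_fubini_tonelli_F _ _ _ _ _ leb F mF F0).
  move=> t _; rewrite /patch; case: ifPn => [tI|_]; last first.
    by apply: mule_ge0; [rewrite lee_fin ltW|apply: integral_ge0].
  have tht : t - h < t by rewrite ltrBlDr ltrDl.
  apply: le_trans (sqr_increment tht) _.
  rewrite (_ : t - (t - h) = h); last by ring.
  apply: lee_wpmul2l; first by rewrite lee_fin ltW.
  rewrite integral_mkcond le_eqVlt; apply/orP; left; apply/eqP.
  apply: eq_integral => s _; rewrite /F/= indicE tI mul1r /patch indicE !mem_setE.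
  rewrite !in_itv/= (_ : (0 <= t - s <= h) = (t - h <= s <= t)).
    by case: ifP => _; rewrite ?mul1r ?mul0r.
  by rewrite subr_ge0 lerBlDr andbC lerBlDr addrC.
rewrite expr2 EFinM -muleA; apply: lee_wpmul2l; first by rewrite lee_fin ltW.
rewrite (@fubini_tonelli _ _ _ _ _ leb leb F mF F0) [in leRHS]integral_mkcond.
rewrite -ge0_integralZl//; last 3 first.
- by apply/(measurable_restrictT _ (measurable_itv _)); exact: mq2.
- by move=> t _; rewrite /patch; case: ifP => // _; rewrite lee_fin sqr_ge0.
- by rewrite lee_fin ltW.
apply: ge0_le_integral => //.
- by move=> s _; apply: integral_ge0.
- exact: (@measurable_fun_fubini_tonelli_G _ _ _ _ _ leb F mF F0).
- by apply: measurable_funeM; by apply/(measurable_restrictT _ (measurable_itv _)); exact: mq2.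
move=> s _; rewrite /patch; case: ifPn => [sI|sI]; last first.
  rewrite mule0 [leLHS](_ : _ = 0%E)//; rewrite -[RHS](@integral0 _ _ _ leb setT).
  apply: eq_integral => t _; rewrite /F/=.
  suff -> : \1_(`]h, T[%classic) t * \1_(`[0, h]%classic) (t - s) = 0 :> R by rewrite mul0r.
  rewrite !indicE !mem_setE !in_itv/=.
  move: sI; rewrite mem_setE in_itv/=; case: (ltP 0 s) => //= s0.
    rewrite -leNgt => Ts; case: (ltP t T) => tT; last by rewrite andbF mul0r.
    by rewrite subr_ge0 [s <= t]leNgt (lt_le_trans tT Ts) mulr0.
  move=> _; case: (ltP h t) => ht; last by rewrite mul0r.
  by rewrite lerBlDr [t <= _]leNgt (le_lt_trans _ ht) ?andbF ?mulr0// gerDl.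
apply: (@le_trans _ _ (\int[leb]_t ((q s ^+ 2)%:E * (\1_(`[s, s + h]%classic) t)%:E))%E).
  apply: ge0_le_integral => //.
  - exact: (measurableT_comp mF (measurable_pair2 s)).
  - apply: measurable_funeM; apply/measurable_EFinP; exact: measurable_indic.
  move=> t _; rewrite -EFinM lee_fin mulrC ler_wpM2l ?sqr_ge0//.
  rewrite !indicE !mem_setE !in_itv/= subr_ge0 lerBlDr (addrC h s).
  by case: (_ && _); case: (_ && _); rewrite ?mulr1 ?mulr0 ?mul0r ?ler01.
rewrite ge0_integralZl//.
- have msh : leb `[s, s + h]%classic = h%:E.
    by rewrite lebesgue_measure_itv/= lte_fin ltrDl h0 -EFinD addrAC subrr add0r.
  by rewrite integral_indic// setIT [X in (_ * X)%E]msh muleC.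
- by apply/measurable_EFinP; exact: measurable_indic.
- by rewrite lee_fin sqr_ge0.
Qed.

(** psi t is the sum of psi 0 and of an increment controlled by
    [sqr_increment]; the factors 2 come from the square of the sum. *)
Lemma integral_initial (T h : R) : 0 < h -> h < T ->
  (\int[leb]_(t in `]0%R, h]) (psi t ^+ 2)%:E <=
   (2 * h * psi 0 ^+ 2)%:E + (2 * h ^+ 2)%:E * \int[leb]_(t in `]0%R, T[) (q t ^+ 2)%:E)%E.
Proof.
move=> h0 hT; set I := (\int[leb]_(t in `]0%R, T[) _)%E.
have I0 : (0 <= I)%E by apply: integral_ge0 => t _; rewrite lee_fin sqr_ge0.
apply: (@le_trans _ _ (\int[leb]_(t in `]0%R, h]) (cst ((2 * psi 0 ^+ 2)%:E + (2 * h)%:E * I) t))%E).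
  apply: ge0_le_integral => //.
  - by move=> t _; rewrite lee_fin sqr_ge0.
  - by apply/measurable_EFinP/measurable_funTS; exact: measurable_funX.
  move=> t; rewrite /= in_itv/= => /andP[t0 th].
  apply: (@le_trans _ _ ((2 * psi 0 ^+ 2)%:E + 2%:E * ((psi t - psi 0) ^+ 2)%:E)%E).
    by rewrite -EFinM -EFinD lee_fin; have := sqr_ge0 (psi t - 2 * psi 0); nra.
  rewrite leeD2l// (EFinM 2 h) -muleA lee_wpmul2l ?lee_fin//.
  apply: le_trans (sqr_increment t0) _; rewrite subr0.
  apply: (@le_trans _ _ (t%:E * I)%E); last by rewrite lee_wpmul2r// lee_fin.
  rewrite lee_wpmul2l ?lee_fin ?(ltW t0)// -integral_itv_obnd_cbnd//.
  apply: ge0_subset_integral => //; first exact: mq2.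
  + by move=> r _; rewrite lee_fin sqr_ge0.
  + by move=> r; rewrite /= !in_itv/= => /andP[-> rt]; rewrite (le_lt_trans rt)// (le_lt_trans th).
have m0h : leb `]0, h]%classic = h%:E.
  by rewrite lebesgue_measure_itv/= lte_fin h0 -EFinD subr0.
rewrite integral_cst// [X in (_ * X)%E]m0h.
rewrite ge0_muleDl; last 2 first.
- by rewrite lee_fin mulr_ge0 ?sqr_ge0.
- by apply: mule_ge0 => //; rewrite lee_fin mulr_ge0 ?ltW.
rewrite -EFinM -muleA (muleC I) muleA -EFinM.
by rewrite (_ : 2 * psi 0 ^+ 2 * h = 2 * h * psi 0 ^+ 2) 1?(_ : 2 * h * h = 2 * h ^+ 2)//; ring.
Qed.

End one_dim.

(** * Difference quotients in time *)
Section quotient_limit.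
Context {R : realType}.
Variables (psi q : R -> R).
Hypotheses (dpsi : forall t, is_derive t (1:R) psi (q t)) (cq : continuous q).

Lemma quotient_mvt (s t : R) : s < t ->
  exists2 c, s <= c <= t & (psi t - psi s) / (t - s) = q c.
Proof.
move=> st.
have [|c] := @MVT_segment _ psi q s t (ltW st) (fun x _ => dpsi x).
  apply: continuous_subspaceT => x.
  by apply/differentiable_continuous/derivable1_diffP; have [] := dpsi x.
rewrite in_itv/= => cst ->; exists c => //.
by rewrite mulfK// subr_eq0 gt_eqF.
Qed.

Lemma quotient_cvg (t : R) (h : nat -> R) : (forall n, 0 < h n) ->
  h n @[n --> \oo] --> (0 : R) ->
  (psi t - psi (t - h n)) / h n @[n --> \oo] --> q t.
Proof.
move=> h0 ch; apply/cvgrPdist_lt => eps eps0.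
have /cvgrPdist_lt/(_ _ eps0)[del/= del0 Hdel] := @cq t.
have /cvgrPdist_lt/(_ _ del0) hdel := ch.
near=> n.
have hn : `|h n| < del.
  by rewrite -normrN -[X in `|X|]add0r; near: n; exact: hdel.
have [|c /andP[c1 c2]] := @quotient_mvt (t - h n) t; first by rewrite gtrBl.
rewrite (_ : t - (t - h n) = h n) => [->|]; last by ring.
apply: Hdel => /=.
apply: le_lt_trans hn; rewrite ger0_norm ?subr_ge0// (ger0_norm (ltW (h0 n))).
by rewrite lerBlDr -lerBlDl.
Unshelve. all: by end_near. Qed.
End quotient_limit.

Section normL2_ereal.
Context {R : realType} {n : nat}.
Local Notation mu := (lebesgue_rV n).
Implicit Types (D : set 'rV[R]_n) (w : 'rV[R]_n -> R).

Lemma normL2_ereal D w : measurable D -> L2 D w ->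
  (\int[mu]_(z in D) (w z ^+ 2)%:E)%E = (normL2 D w ^+ 2)%:E.
Proof.
move=> mD lw; rewrite normL2E// /ip /Rintegral fineK; last first.
  by apply: integrable_fin_num => //; exact: L2_integrableM.
by apply: eq_integral => z _; rewrite expr2.
Qed.
End normL2_ereal.

(** The limits for a step h tending to 0 are taken along this sequence, which
    remains in ]0, T[. *)
Definition step {R : realType} (T : R) (n : nat) : R := T / n.+2%:R.

Section step.
Context {R : realType}.
Variable T : R.
Hypothesis T0 : 0 < T.

Lemma step_gt0 n : 0 < step T n.
Proof. by rewrite divr_gt0. Qed.

Lemma step_lt n : step T n < T.
Proof. by rewrite ltr_pdivrMr// ltr_pMr// ltr1n. Qed.

Lemma step_cvg : step T n @[n --> \oo] --> (0 : R).
Proof.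
rewrite -(mulr0 T); apply: cvgMr.
rewrite (_ : (fun n : nat => n.+2%:R^-1) = [sequence (@harmonic R) (n + 1)%N]_n).
  by rewrite (cvg_shiftn 1 (@harmonic R)); exact: cvg_harmonic.
by apply/funext => n; rewrite /= addn1.
Qed.
End step.

Section quotient_tube.
Context {R : realType} {d : nat}.
Local Notation mu := (lebesgue_rV d.+1).
Variables (Omega : set 'rV[R]_d) (T : R).
Hypotheses (oO : open Omega) (bO : bounded_set Omega) (T0 : 0 < T).
Local Notation Q := (cylinder Omega T).
Implicit Types (phi : 'rV[R]_d.+1 -> R) (h : R).

Let mO : measurable Omega := open_measurable_rV oO.
Let mQ : measurable Q := open_measurable_rV (open_cylinder oO).
Let bQ : bounded_set Q := bounded_cylinder T bO.

Let mtube J : measurable J -> measurable (tube Omega J).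
Proof. by move=> mJ; exact: measurable_tube. Qed.

Lemma measurable_tube_inner (f : 'rV[R]_d.+1 -> \bar R) J : measurable J ->
  measurable_fun (tube Omega J) f -> (forall z, 0 <= f z)%E ->
  measurable_fun Omega
    (fun x => (\int[@lebesgue_measure R]_(t in J) f (rcons_rV (x, t)))%E).
Proof.
move=> mJ mf f0; have mt := mtube mJ.
apply/(measurable_restrictT _ mO).
rewrite (_ : _ \_ _ = fun x => (\int[@lebesgue_measure R]_t (f \_ (tube Omega J)) (rcons_rV (x, t)))%E).
  apply: measurable_tonelli_rV'; first exact/(measurable_restrictT _ mt).
  by move=> z; rewrite /patch; case: ifP.
apply/funext => x; under [RHS]eq_integral do rewrite patch_tube.
rewrite [LHS]/patch; case: ifPn => xO; last first.
  rewrite -[LHS](@integral0 _ _ _ (@lebesgue_measure R) setT); apply: eq_integral => t _.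
  by rewrite /patch (negbTE xO); case: ifP.
rewrite [LHS]integral_mkcond; apply: eq_integral => t _.
by rewrite /patch xO.
Qed.

Lemma late_sub h : 0 <= h -> tube Omega `]h, T[ `<=` Q.
Proof.
move=> h0; apply: tube_sub_cylinder => t /=; rewrite !in_itv/= => /andP[ht ->].
by rewrite andbT (le_lt_trans h0).
Qed.

Lemma early_sub h : h < T -> tube Omega `]0, h] `<=` Q.
Proof.
move=> hT; apply: tube_sub_cylinder => t /=; rewrite !in_itv/= => /andP[-> th].
by rewrite (le_lt_trans th).
Qed.

Lemma ip_split f g h : 0 < h -> h < T -> L2 Q f -> L2 Q g ->
  ip Q f g = ip (tube Omega `]0, h]) f g + ip (tube Omega `]h, T[) f g.
Proof.
move=> h0 hT lf lg.
have QE : Q = tube Omega `]0, h] `|` tube Omega `]h, T[.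
  rewrite cylinderE; apply/seteqP; split=> [z [Oz]|z].
    rewrite /= in_itv/= => /andP[z0 zT]; case: (leP (time z) h) => zh; [left|right]; split=> //=;
    by rewrite in_itv/= ?z0 ?zh ?zT.
  by move=> [|] [Oz]; rewrite /= in_itv/= => /andP[za zb]; split=> //=;
    rewrite in_itv/= ?za ?zb ?(le_lt_trans zb hT) ?(lt_trans h0 za).
rewrite /ip {1}QE Rintegral_setU//.
- exact: mtube.
- exact: mtube.
- by rewrite -QE; exact: L2_integrableM.
- apply/disj_setPS => z [[_ /=]]; rewrite in_itv/= => /andP[_ zh] [_ /=].
  by rewrite in_itv/= ltNge zh.
Qed.

Lemma normL2_quotient phi h : smooth phi -> 0 < h -> h < T ->
  normL2 (tube Omega `]h, T[) (fun z => phi z - phi (tshift h z)) <=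
  h * normL2 Q (partial ord_max phi).
Proof.
move=> sp h0 hT; have mh := mtube (measurable_itv `]h, T[).
have bh : bounded_set (tube Omega `]h, T[).
  by apply: bounded_tube => //; exact: bounded_itvR.
have ld : L2 (tube Omega `]h, T[) (fun z => phi z - phi (tshift h z)).
  by apply: (smooth_L2 mh bh); apply: (smoothB sp); exact: (smooth_tshift h sp).
have sq := smooth_partial ord_max sp.
have lq := smooth_L2 mQ bQ sq.
rewrite -(@ler_pXn2r _ 2)// ?nnegrE ?mulr_ge0 ?normL2_ge0 ?(ltW h0)//.
rewrite exprMn -lee_fin (EFinM (h ^+ 2)) -!normL2_ereal// cylinderE.
have msq D (f : 'rV[R]_d.+1 -> R) : smooth f -> measurable_fun D (fun z => (f z ^+ 2)%:E).
  move=> sf; apply/measurable_EFinP/measurable_funTS; apply: measurable_funX.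
  exact: smooth_measurable.
rewrite tonelli_tube'//; last 2 first.
- by apply: msq; apply: (smoothB sp); exact: (smooth_tshift h sp).
- by move=> z; rewrite lee_fin sqr_ge0.
rewrite tonelli_tube'//; last 2 first.
- exact: msq.
- by move=> z; rewrite lee_fin sqr_ge0.
rewrite -ge0_integralZl//; last 3 first.
- apply: (@measurable_tube_inner (fun z => (partial ord_max phi z ^+ 2)%:E)) => //.
    exact: msq.
  by move=> z; rewrite lee_fin sqr_ge0.
- by move=> x _; apply: integral_ge0 => t _; rewrite lee_fin sqr_ge0.
- by rewrite lee_fin sqr_ge0.
apply: ge0_le_integral => //.
- by move=> x _; apply: integral_ge0 => t _; rewrite lee_fin sqr_ge0.
- apply: (@measurable_tube_inner (fun z => ((phi z - phi (tshift h z)) ^+ 2)%:E)) => //.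
  + by apply: msq; apply: (smoothB sp); exact: (smooth_tshift h sp).
  + by move=> z; rewrite lee_fin sqr_ge0.
- apply: measurable_funeM.
  apply: (@measurable_tube_inner (fun z => (partial ord_max phi z ^+ 2)%:E)) => //.
  + exact: msq.
  + by move=> z; rewrite lee_fin sqr_ge0.
move=> x _; under eq_integral do rewrite tshift_rcons.
apply: (@integral_quotient _ (fun t => phi (rcons_rV (x, t)))
  (fun t => partial ord_max phi (rcons_rV (x, t)))) => //.
  by move=> t; exact: is_derive_rcons_time.
move=> t; apply: (@continuous_comp _ _ _ (fun t => rcons_rV (x, t)) (partial ord_max phi)).
  exact: continuous_rcons_time.
exact: (smooth_continuous sq).
Qed.

Let msq D (f : 'rV[R]_d.+1 -> R) : smooth f -> measurable_fun D (fun z => (f z ^+ 2)%:E).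
Proof.
move=> sf; apply/measurable_EFinP/measurable_funTS; apply: measurable_funX.
exact: smooth_measurable.
Qed.

Lemma normL2_initial phi h : smooth phi -> 0 < h -> h < T ->
  normL2 (tube Omega `]0, h]) phi ^+ 2 <=
  2 * h * normL2 Omega (fun x => phi (rcons_rV (x, 0))) ^+ 2 +
  2 * h ^+ 2 * normL2 Q (partial ord_max phi) ^+ 2.
Proof.
move=> sp h0 hT; have mh := mtube (measurable_itv `]0, h]).
have lp : L2 (tube Omega `]0, h]) phi.
  by apply: (L2S mQ mh (early_sub hT)); exact: (smooth_L2 mQ bQ sp).
have sq := smooth_partial ord_max sp.
have lq := smooth_L2 mQ bQ sq.
have sp0 := smooth_rcons 0 sp.
have lp0 := smooth_L2 mO bO sp0.
have mp0 : measurable_fun Omega (fun x => (phi (rcons_rV (x, 0)) ^+ 2)%:E).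
  apply/measurable_EFinP/measurable_funTS; apply: measurable_funX.
  exact: (smooth_measurable sp0).
have c0 : 0 <= 2 * h by rewrite mulr_ge0// ltW.
have c1 : 0 <= 2 * h ^+ 2 by rewrite mulr_ge0// sqr_ge0.
rewrite -lee_fin EFinD !EFinM -!EFinM (EFinM (2 * h)) (EFinM (2 * h ^+ 2)).
rewrite -!normL2_ereal// cylinderE.
rewrite tonelli_tube'//; last 2 first.
- exact: msq.
- by move=> z; rewrite lee_fin sqr_ge0.
rewrite tonelli_tube'//; last 2 first.
- exact: msq.
- by move=> z; rewrite lee_fin sqr_ge0.
have mi : measurable_fun Omega (fun x =>
    (\int[@lebesgue_measure R]_(t in `]0%R, T[) (partial ord_max phi (rcons_rV (x, t)) ^+ 2)%:E)%E).
  apply: (@measurable_tube_inner (fun z => (partial ord_max phi z ^+ 2)%:E)) => //.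
    exact: msq.
  by move=> z; rewrite lee_fin sqr_ge0.
rewrite -ge0_integralZl//; last by move=> x _; rewrite lee_fin sqr_ge0.
rewrite -ge0_integralZl//; last first.
  by move=> x _; apply: integral_ge0 => t _; rewrite lee_fin sqr_ge0.
rewrite -ge0_integralD//; last 4 first.
- by move=> x _; rewrite -EFinM lee_fin mulr_ge0// sqr_ge0.
- exact: measurable_funeM.
- move=> x _; apply: mule_ge0; first by rewrite lee_fin.
  by apply: integral_ge0 => t _; rewrite lee_fin sqr_ge0.
- exact: measurable_funeM.
apply: ge0_le_integral => //.
- by move=> x _; apply: integral_ge0 => t _; rewrite lee_fin sqr_ge0.
- apply: (@measurable_tube_inner (fun z => (phi z ^+ 2)%:E)) => //.
    exact: msq.
  by move=> z; rewrite lee_fin sqr_ge0.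
- by apply: emeasurable_funD; exact: measurable_funeM.
move=> x _; rewrite -EFinM.
apply: (@integral_initial _ (fun t => phi (rcons_rV (x, t)))
  (fun t => partial ord_max phi (rcons_rV (x, t)))) => //.
  by move=> t; exact: is_derive_rcons_time.
move=> t; apply: (@continuous_comp _ _ _ (fun t => rcons_rV (x, t)) (partial ord_max phi)).
  exact: continuous_rcons_time.
exact: (smooth_continuous sq).
Qed.

Lemma normL2_early_cvg l : L2 Q l ->
  normL2 (tube Omega `]0, step T n]) l @[n --> \oo] --> (0 : R).
Proof.
move=> ll.
have c2 : normL2 (tube Omega `]0, step T n]) l ^+ 2 @[n --> \oo] --> (0 : R).
  rewrite (_ : (fun n => _ ^+ 2) =
    (fun n => \int[mu]_(z in Q) (l z * l z * \1_(`]0, step T n]%classic) (time z)))); last first.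
    apply/funext => n; rewrite normL2E ?mtube// /ip Rintegral_mkcond [RHS]Rintegral_mkcond.
    apply: eq_Rintegral => z _; rewrite /patch indicE.
    have [zJ|zJ] := pselect (tube Omega `]0, step T n]%classic z).
      rewrite !mem_set ?mulr1//; first by move: zJ => [].
      exact: (early_sub (step_lt T0 n)).
    rewrite (memNset zJ); case: ifPn => //; rewrite inE => -[zO _].
    by rewrite memNset ?mulr0// => zt; apply: zJ; split.
  rewrite -[X in _ --> X](_ : \int[mu]_(z in Q) 0 = 0); last first.
    by rewrite /Rintegral integral0.
  have ill := L2_integrableM mQ ll ll.
  apply: (Rdominated_cvg (G := fun z => `|l z * l z|)) => //.
  - move=> n; apply: measurable_funM.
      by apply/measurable_EFinP; exact: (measurable_int _ ill).
    apply: measurable_funTS.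
    apply: (measurableT_comp (measurable_indic (measurable_itv `]0, step T n]))).
    exact: measurable_time.
  - move=> z [zO /andP[z0 zT]].
    apply/cvgrPdist_lt => eps eps0.
    have /cvgrPdist_lt/(_ _ z0) hdel := step_cvg T.
    near=> n; rewrite indicE memNset ?mulr0 ?subrr ?normr0//=.
    rewrite in_itv/= z0/= => zn.
    have : `|0 - step T n| < time z by near: n; exact: hdel.
    by rewrite sub0r normrN gtr0_norm ?step_gt0// ltNge zn.
  - exact: integrable_norm.
  - by move=> n z _; rewrite normrM ler_piMr// indicE; case: (_ \in _); rewrite ?normr1 ?normr0.
have := cvg_comp _ _ c2 (@sqrt_continuous R 0).
rewrite sqrtr0; apply: cvg_trans; apply: near_eq_cvg; apply: nearW => n.
by rewrite /= sqrtr_sqr ger0_norm// normL2_ge0.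
Unshelve. all: by end_near. Qed.

(** Dominated convergence: the quotients of phi converge pointwise to its time
    derivative, which bounds them by the mean value theorem; the indicator of
    ]h, T[ tends to 1 at each point of the cylinder. *)
Lemma quotient_smooth_cvg l phi : L2 Q l -> smooth phi ->
  ip (tube Omega `]step T n, T[) l (fun z => phi z - phi (tshift (step T n) z)) / step T n
    @[n --> \oo] --> ip Q l (partial ord_max phi).
Proof.
move=> ll sp; set h := step T.
have sq := smooth_partial ord_max sp.
have dphi x t := @is_derive_rcons_time R d phi x t sp.
have cphi x : continuous (fun t => partial ord_max phi (rcons_rV (x, t))).
  move=> t; apply: (@continuous_comp _ _ _ (fun t => rcons_rV (x, t)) (partial ord_max phi)).
    exact: continuous_rcons_time.
  exact: (smooth_continuous sq).
have [C C0 HC] := smooth_bounded bQ sq.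
have shiftE n z : tshift (h n) z = rcons_rV (space z, time z - h n).
  by rewrite -{1}[z]rcons_space_time tshift_rcons.
pose F n z := l z * (\1_(`]h n, T[%classic) (time z) * ((phi z - phi (tshift (h n) z)) / h n)).
have E n : ip (tube Omega `]h n, T[) l (fun z => phi z - phi (tshift (h n) z)) / h n =
    \int[mu]_(z in Q) F n z.
  have hn0 := ltW (step_gt0 T0 n).
  have sd : smooth (fun z => phi z - phi (tshift (h n) z)).
    by apply: (smoothB sp); exact: (smooth_tshift (h n) sp).
  have mt := mtube (measurable_itv `]h n, T[).
  have lt_ := L2S mQ mt (late_sub hn0) ll.
  have ld := L2S mQ mt (late_sub hn0) (smooth_L2 mQ bQ sd).
  rewrite mulrC ipC -ipZl// /ip Rintegral_mkcond [RHS]Rintegral_mkcond.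
  apply: eq_Rintegral => z _; rewrite /patch /F indicE.
  have [zJ|zJ] := pselect (tube Omega `]h n, T[%classic z).
    rewrite !mem_set; [by rewrite mul1r; ring|by case: zJ|exact: (late_sub hn0 zJ)|by []].
  rewrite (memNset zJ); case: ifPn => //; rewrite inE => -[zO _].
  by rewrite memNset ?mul0r ?mulr0// => zt; apply: zJ; split.
rewrite (funext E).
have mlQ := L2_mfun mQ ll.
have iG : mu.-integrable Q (EFin \o (fun z => `|l z| * C)).
  have lC : L2 Q (fun=> C) by apply: (smooth_L2 mQ bQ); exact: smooth_cst.
  have := L2_integrableM mQ ll lC => /integrable_norm; congr (_.-integrable _ _).
  by apply/funext => z /=; rewrite normrM (ger0_norm C0).
apply: (Rdominated_cvg (G := fun z => `|l z| * C)) => //.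
- move=> n; apply: measurable_funM => //; apply: measurable_funTS.
  apply: measurable_funM.
    apply: (measurableT_comp (measurable_indic (measurable_itv `]h n, T[))).
    exact: measurable_time.
  apply: measurable_funM; last exact: measurable_cst.
  by apply: smooth_measurable; apply: (smoothB sp); exact: (smooth_tshift (h n) sp).
- apply: measurable_funM => //; apply: measurable_funTS.
  exact: (smooth_measurable sq).
- move=> z [zO /andP[z0 zT]]; rewrite /F.
  apply: cvgMr; rewrite -[X in _ --> X]mul1r; apply: cvgM.
    apply/cvgrPdist_lt => eps eps0.
    have /cvgrPdist_lt/(_ _ z0) hdel := step_cvg T.
    near=> n; rewrite indicE mem_set ?subrr ?normr0//=.
    rewrite in_itv/= zT andbT.
    have : `|0 - step T n| < time z by near: n; exact: hdel.
    by rewrite sub0r normrN gtr0_norm ?step_gt0.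
  have := @quotient_cvg _ _ _ (dphi (space z)) (cphi (space z)) (time z) h (step_gt0 T0) (step_cvg T).
  by rewrite rcons_space_time; under eq_fun => n do rewrite -shiftE.
- move=> n z [zO /andP[z0 zT]]; rewrite /F normrM ler_wpM2l// normrM indicE.
  have [zt|zt] := pselect (`]h n, T[%classic (time z)); last first.
    by rewrite memNset// normr0 mul0r.
  rewrite mem_set// normr1 mul1r.
  have hn0 := step_gt0 T0 n.
  have [|c /andP[c1 c2]] := @quotient_mvt _ _ _ (dphi (space z)) (time z - h n) (time z).
    by rewrite gtrBl.
  rewrite rcons_space_time -shiftE (_ : time z - _ = h n); last by ring.
  move=> ->; apply: HC; split; first by rewrite space_rcons.
  rewrite time_rcons (le_lt_trans c2 zT) andbT (lt_le_trans _ c1)// subr_gt0.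
  by move: zt; rewrite /= in_itv/= => /andP[].
Unshelve. all: by end_near. Qed.

Section limit.
(** Smooth approximations phi k of a function e with time derivative g and zero
    initial values. *)
Variables (e g : 'rV[R]_d.+1 -> R) (phi : nat -> 'rV[R]_d.+1 -> R).
Hypotheses (le : L2 Q e) (lg : L2 Q g) (sphi : forall k, smooth (phi k)).
Hypotheses
  (ce : normL2 Q (fun z => phi k z - e z) @[k --> \oo] --> (0 : R))
  (cg : normL2 Q (fun z => partial ord_max (phi k) z - g z) @[k --> \oo] --> (0 : R))
  (c0 : normL2 Omega (fun x => phi k (rcons_rV (x, 0))) @[k --> \oo] --> (0 : R)).

Let lphi k : L2 Q (phi k) := smooth_L2 mQ bQ (sphi k).
Let ldphi k : L2 Q (partial ord_max (phi k)) :=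
  smooth_L2 mQ bQ (smooth_partial ord_max (sphi k)).

Let cg2 : normL2 Q (partial ord_max (phi k)) @[k --> \oo] --> normL2 Q g.
Proof. exact: normL2_cvg. Qed.

(** In [normL2_initial] the initial values of phi k contribute a term of order h,
    which disappears as k tends to infinity; there remains a term of order h^2.
    This is where the zero initial condition enters. *)
Lemma normL2_early h : 0 < h -> h < T ->
  normL2 (tube Omega `]0, h]) e <= 2 * h * normL2 Q g.
Proof.
move=> h0 hT; have mh := mtube (measurable_itv `]0, h]).
have sub := early_sub hT.
have le' := L2S mQ mh sub le.
have lphi' k := L2S mQ mh sub (lphi k).
have ce' : normL2 (tube Omega `]0, h]) (fun z => phi k z - e z) @[k --> \oo] --> (0 : R).
  apply: (squeeze_cvgr _ (cvg_cst 0) ce); apply: nearW => k.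
  by rewrite normL2_ge0/= normL2S//; exact: L2B.
have c1 : normL2 (tube Omega `]0, h]) (phi k) ^+ 2 @[k --> \oo] -->
    normL2 (tube Omega `]0, h]) e ^+ 2.
  by rewrite expr2; under eq_fun do rewrite expr2; apply: cvgM; exact: normL2_cvg.
have c2 : 2 * h * normL2 Omega (fun x => phi k (rcons_rV (x, 0))) ^+ 2 +
  2 * h ^+ 2 * normL2 Q (partial ord_max (phi k)) ^+ 2 @[k --> \oo] -->
  2 * h * (0 * 0) + 2 * h ^+ 2 * (normL2 Q g * normL2 Q g).
  under eq_fun do rewrite !(expr2 (normL2 _ _)).
  by apply: cvgD; apply: cvgMr; apply: cvgM => //; exact: cg2.
have H : normL2 (tube Omega `]0, h]) e ^+ 2 <= 2 * h ^+ 2 * normL2 Q g ^+ 2.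
  rewrite (_ : 2 * h ^+ 2 * _ = 2 * h * (0 * 0) + 2 * h ^+ 2 * (normL2 Q g * normL2 Q g)); last by ring.
  by apply: (ler_cvg_to c1 c2); apply: nearW => k; exact: normL2_initial.
rewrite -(@ler_pXn2r _ 2)// ?nnegrE ?mulr_ge0 ?normL2_ge0 ?(ltW h0)//.
apply: le_trans H _; rewrite !exprMn ler_wpM2r ?sqr_ge0// ler_wpM2r ?sqr_ge0//.
by rewrite expr2 ler_peMr// ler1n.
Qed.

(** [normL2_quotient] for phi k' - phi k is uniform in the step; letting k' tend
    to infinity transfers the bound to e - phi k. *)
Lemma quotient_approx l n k : L2 Q l ->
  `|ip (tube Omega `]step T n, T[) l (fun z => e z - e (tshift (step T n) z)) / step T n -
    ip (tube Omega `]step T n, T[) l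
      (fun z => phi k z - phi k (tshift (step T n) z)) / step T n| <=
  normL2 Q l * normL2 Q (fun z => partial ord_max (phi k) z - g z).
Proof.
move=> ll; set h := step T n; have h0 := step_gt0 T0 n; have hT := step_lt T0 n.
have mh := mtube (measurable_itv `]h, T[).
have sub := late_sub (ltW h0).
have ll' := L2S mQ mh sub ll.
have m0h := mtube (measurable_itv `]0, T - h[).
have sub0 : tube Omega `]0, T - h[ `<=` Q.
  apply: tube_sub_cylinder => t /=; rewrite !in_itv/= => /andP[-> ht] /=.
  by rewrite (lt_le_trans ht)// lerBlDr lerDl ltW.
have sJ t : `]h, T[%classic t <-> `]0, T - h[%classic (t - h).
  by have := shiftJ h 0 (T - h) t; rewrite add0r subrK.
have lsh w : L2 Q w -> L2 (tube Omega `]h, T[) (fun z => w (tshift h z)).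
  by move=> lw; apply: (L2_tshift oO _ _ sJ) => //; exact: (L2S mQ m0h sub0 lw).
have lD w : L2 Q w -> L2 (tube Omega `]h, T[) (fun z => w z - w (tshift h z)).
  by move=> lw; apply: L2B => //; [exact: (L2S mQ mh sub lw)|exact: lsh].
have B k' : `|ip (tube Omega `]h, T[) l (fun z => phi k' z - phi k' (tshift h z)) / h -
    ip (tube Omega `]h, T[) l (fun z => phi k z - phi k (tshift h z)) / h| <=
    normL2 Q l * normL2 Q (fun z => partial ord_max (phi k) z - partial ord_max (phi k') z).
  rewrite -mulrBl -ipBr//; try exact: lD.
  have sd := smoothB (sphi k') (sphi k).
  rewrite (_ : (fun z => _) = (fun z => (phi k' z - phi k z) -
      (phi k' (tshift h z) - phi k (tshift h z)))); last by apply/funext => z; ring.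
  rewrite normrM normfV (gtr0_norm h0) ler_pdivrMr//.
  apply: (le_trans (ip_CS mh ll' _)).
    by apply: (lD (fun z => phi k' z - phi k z)); exact: L2B.
  rewrite -mulrA ler_pM ?normL2_ge0//; first exact: normL2S.
  rewrite [leRHS]mulrC (normL2_distC (partial ord_max (phi k)) (partial ord_max (phi k')) mQ).
  rewrite -(partialB ord_max (sphi k') (sphi k)).
  exact: normL2_quotient.
have cL (w_ : nat -> 'rV[R]_d.+1 -> R) w : (forall k, L2 Q (w_ k)) -> L2 Q w ->
    normL2 Q (fun z => w_ k z - w z) @[k --> \oo] --> (0 : R) ->
    ip (tube Omega `]h, T[) l (fun z => w_ k z - w_ k (tshift h z)) @[k --> \oo] -->
    ip (tube Omega `]h, T[) l (fun z => w z - w (tshift h z)).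
  move=> lw_ lw cw; under eq_fun do rewrite ipC; rewrite ipC.
  apply: ip_cvg; [by []|by move=> j; exact: lD|exact: lD|by []|].
  have c2 : normL2 Q (fun z => w_ k z - w z) + normL2 Q (fun z => w_ k z - w z)
      @[k --> \oo] --> (0 : R).
    by rewrite -[X in _ --> X](addr0 0); exact: cvgD.
  apply: (squeeze_cvgr _ (cvg_cst 0) c2); apply: nearW => j; rewrite normL2_ge0/=.
  have lj := L2B mQ (lw_ j) lw.
  rewrite (_ : (fun z => _) = (fun z => (w_ j z - w z) + - (w_ j (tshift h z) - w (tshift h z)))); last first.
    by apply/funext => z; ring.
  have lsj := lsh _ lj.
  apply: (le_trans (normL2_triangle mh (L2S mQ mh sub lj) (L2N mh lsj))).
  apply: lerD; first exact: normL2S.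
  rewrite (_ : normL2 _ _ = normL2 (tube Omega `]h, T[) (fun z => w_ j (tshift h z) - w (tshift h z))); last first.
    rewrite -[RHS]normL2_distC//; congr normL2; apply/funext => z; ring.
  rewrite (normL2_tshift oO _ sJ (w := fun z => w_ j z - w z))//.
    exact: normL2S.
  exact: L2_mfun m0h _ (L2S mQ m0h sub0 lj).
have c1 : `|ip (tube Omega `]h, T[) l (fun z => phi k' z - phi k' (tshift h z)) / h -
    ip (tube Omega `]h, T[) l (fun z => phi k z - phi k (tshift h z)) / h| @[k' --> \oo] -->
   `|ip (tube Omega `]h, T[) l (fun z => e z - e (tshift h z)) / h -
    ip (tube Omega `]h, T[) l (fun z => phi k z - phi k (tshift h z)) / h|.
  apply: cvg_norm; apply: cvgB; last exact: cvg_cst.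
  by apply: cvgMl; exact: cL.
have c2 : normL2 Q l * normL2 Q (fun z => partial ord_max (phi k) z - partial ord_max (phi k') z)
    @[k' --> \oo] --> normL2 Q l * normL2 Q (fun z => partial ord_max (phi k) z - g z).
  apply: cvgMr; apply: normL2_cvg => //.
  - by move=> k'; exact: L2B.
  - exact: L2B.
  apply: cvg_trans cg; apply: near_eq_cvg; apply: nearW => k'.
  rewrite -normL2_distC//; congr normL2; apply/funext => z; ring.
apply: (ler_cvg_to c1 c2); apply: nearW => k'; exact: B.
Qed.

(** The difference quotients in time of e, with e extended by 0 before time 0,
    converge weakly to g. On ]0, h] the product is o(h), since e is O(h) there by
    [normL2_early] while the norm of l on that slab tends to 0. On ]h, T[ the
    quotients of e are uniformly close to those of phi k, for which the limit
    is known. *)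
Lemma quotient_weak_cvg l : L2 Q l ->
  (ip Q l e - ip (tube Omega `]step T n, T[) l (fun z => e (tshift (step T n) z))) / step T n
    @[n --> \oo] --> ip Q l g.
Proof.
move=> ll.
pose B w n := ip (tube Omega `]step T n, T[) l
  (fun z => w z - w (tshift (step T n) z)) / step T n.
have cB : B e n @[n --> \oo] --> ip Q l g.
  apply/cvgrPdist_le => eps eps0.
  pose N k := normL2 Q l * normL2 Q (fun z => partial ord_max (phi k) z - g z).
  have cN : N k @[k --> \oo] --> (0 : R).
    by rewrite -(mulr0 (normL2 Q l)); exact: cvgMr.
  have e3 : 0 < eps / 3 by rewrite divr_gt0.
  have /cvgrPdist_le/(_ _ e3)[k _ /(_ _ (leqnn k))] := cN.
  rewrite sub0r normrN => Nk.
  have Nk' : N k <= eps / 3 by apply: le_trans Nk; exact: ler_norm.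
  have /cvgrPdist_le/(_ _ e3) H := quotient_smooth_cvg ll (sphi k).
  near=> n.
  have H1 : `|ip Q l (partial ord_max (phi k)) - B (phi k) n| <= eps / 3.
    by near: n; exact: H.
  have H2 := quotient_approx n k ll; rewrite -/(B e n) -/(B (phi k) n) in H2.
  have H3 : `|ip Q l (partial ord_max (phi k)) - ip Q l g| <= N k.
    by rewrite -ipBr// (le_trans (ip_CS mQ ll _))//; exact: L2B.
  have {}H2 := le_trans H2 Nk'; have {}H3 := le_trans H3 Nk'.
  have := ler_normB (ip Q l (partial ord_max (phi k)) - B (phi k) n) (B e n - B (phi k) n).
  have := ler_normB (ip Q l (partial ord_max (phi k)) - B e n)
    (ip Q l (partial ord_max (phi k)) - ip Q l g).
  rewrite (_ : _ - B e n - (_ - ip Q l g) = ip Q l g - B e n); last by ring.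
  rewrite (_ : _ - B (phi k) n - (_ - _) = ip Q l (partial ord_max (phi k)) - B e n); last by ring.
  move: H1 H2 H3; lra.
have cE : ip (tube Omega `]0, step T n]) l e / step T n @[n --> \oo] --> (0 : R).
  have c1 : normL2 (tube Omega `]0, step T n]) l * (2 * normL2 Q g) @[n --> \oo] --> (0 : R).
    by rewrite -[X in _ --> X](mul0r (2 * normL2 Q g)); apply: cvgMl; exact: normL2_early_cvg.
  apply: norm_cvg0; apply: (squeeze_cvgr _ (cvg_cst 0) c1); apply: nearW => n.
  have h0 := step_gt0 T0 n; have hT := step_lt T0 n.
  have mh := mtube (measurable_itv `]0, step T n]).
  have sub := early_sub hT.
  rewrite normr_ge0/= normrM normfV (gtr0_norm h0) ler_pdivrMr//.
  apply: (le_trans (ip_CS mh (L2S mQ mh sub ll) (L2S mQ mh sub le))).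
  rewrite -mulrA ler_wpM2l ?normL2_ge0//.
  by rewrite mulrAC; exact: normL2_early.
rewrite -[X in _ --> X]add0r.
rewrite (_ : (fun n => _) =
  (fun n => ip (tube Omega `]0, step T n]) l e / step T n + B e n)); first exact: cvgD.
apply/funext => n; rewrite /B.
have h0 := step_gt0 T0 n; have hT := step_lt T0 n.
have mh := mtube (measurable_itv `]step T n, T[).
have m0h := mtube (measurable_itv `]0, T - step T n[).
have sub0 : tube Omega `]0, T - step T n[ `<=` Q.
  apply: tube_sub_cylinder => t /=; rewrite !in_itv/= => /andP[-> ht] /=.
  by rewrite (lt_le_trans ht)// lerBlDr lerDl ltW.
have sJ t : `]step T n, T[%classic t <-> `]0, T - step T n[%classic (t - step T n).
  by have := shiftJ (step T n) 0 (T - step T n) t; rewrite add0r subrK.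
have lsh : L2 (tube Omega `]step T n, T[) (fun z => e (tshift (step T n) z)).
  by apply: (L2_tshift oO _ _ sJ) => //; exact: (L2S mQ m0h sub0 le).
have sub := late_sub (ltW h0).
rewrite ipBr//; [|exact: (L2S mQ mh sub le)|exact: (L2S mQ mh sub ll)].
by rewrite -mulrDl addrA -(ip_split h0 hT ll le).
Unshelve. all: by end_near. Qed.
End limit.
End quotient_tube.

(** * Behaviour near the final time *)
Section space_functions.
Context {R : realType} {d : nat}.
Local Notation mu := (lebesgue_rV d.+1).
Local Notation leb := (@lebesgue_measure R).
Variables (Omega : set 'rV[R]_d) (J : set R).
Hypotheses (mO : measurable Omega) (mJ : measurable J).

Let mt : measurable (tube Omega J) := measurable_tube mO mJ.

Lemma measurable_tube_space d' (U : measurableType d') (f : 'rV[R]_d -> U) :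
  measurable_fun Omega f -> measurable_fun (tube Omega J) (fun z => f (space z)).
Proof.
move=> mf _ Y mY.
rewrite (_ : _ `&` _ = tube (Omega `&` f @^-1` Y) J); first exact: measurable_tube (mf mO _ mY) mJ.
by apply/seteqP; split=> z /=; [move=> [[]]|move=> [[]]].
Qed.

Lemma measurable_slice d' (U : measurableType d') (w : 'rV[R]_d.+1 -> U) t : J t ->
  measurable_fun (tube Omega J) w -> measurable_fun Omega (fun x => w (rcons_rV (x, t))).
Proof.
move=> Jt mw _ Y mY.
have mr : measurable_fun setT (fun x : 'rV[R]_d => rcons_rV (x, t)).
  apply: measurable_fun_rVP => i; case: (unliftP ord_max i) => [j ->|->].
    rewrite (_ : (fun _ => _) = (fun x : 'rV[R]_d => x 0 j)); first exact: measurable_coord.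
    by apply/funext => x; rewrite mxE liftK.
  rewrite (_ : (fun _ => _) = cst t); first exact: measurable_cst.
  by apply/funext => x; rewrite mxE unlift_none.
rewrite (_ : _ `&` _ = setT `&` (fun x => rcons_rV (x, t)) @^-1` (tube Omega J `&` w @^-1` Y)).
  exact: mr measurableT _ (mw mt _ mY).
by apply/seteqP; split=> x /=; rewrite ?/tube /= space_rcons time_rcons;
  [move=> []|move=> [_ [[]]]].
Qed.

Lemma integral_tube_space (f : 'rV[R]_d -> \bar R) : measurable_fun Omega f ->
  (forall x, 0 <= f x)%E ->
  (\int[mu]_(z in tube Omega J) f (space z) = \int[lebesgue_rV d]_(x in Omega) f x * leb J)%E.
Proof.
move=> mf f0; rewrite tonelli_tube//; last exact: measurable_tube_space.
rewrite -(integral_cst leb mJ); apply: eq_integral => t _ /=.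
by apply: eq_integral => x _; rewrite space_rcons.
Qed.

Lemma measurable_tube_outer (f : 'rV[R]_d.+1 -> \bar R) :
  measurable_fun (tube Omega J) f -> (forall z, 0 <= f z)%E ->
  measurable_fun J (fun t => (\int[lebesgue_rV d]_(x in Omega) f (rcons_rV (x, t)))%E).
Proof.
move=> mf f0; apply/(measurable_restrictT _ mJ).
rewrite (_ : _ \_ _ = fun t => (\int[lebesgue_rV d]_x (f \_ (tube Omega J)) (rcons_rV (x, t)))%E).
  apply: measurable_tonelli_rV; first exact/(measurable_restrictT _ mt).
  by move=> z; rewrite /patch; case: ifP.
apply/funext => t; under [RHS]eq_integral do rewrite patch_tube.
rewrite [LHS]/patch; case: ifPn => tJ; last first.
  rewrite -[LHS](@integral0 _ _ _ (lebesgue_rV d) setT); apply: eq_integral => x _.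
  by rewrite /patch (negbTE tJ).
rewrite [LHS]integral_mkcond; apply: eq_integral => x _.
by rewrite [RHS]/patch tJ.
Qed.

Variable len : R.
Hypothesis lenJ : leb J = len%:E.

Lemma L2_tube_space f : L2 Omega f -> L2 (tube Omega J) (fun z => f (space z)).
Proof.
move=> /(L2P mO)[mf /integrableP[mf2 if2]]; apply/(L2P mt); split.
  exact: measurable_tube_space.
apply/integrableP; split.
  by apply: (measurable_tube_space (f := fun x => (f x ^+ 2)%:E)).
rewrite (integral_tube_space (f := fun x => `|(f x ^+ 2)%:E|%E))//.
  rewrite lenJ muleC lte_mul_pinfty//.
  by rewrite -lenJ measure_ge0.
exact: measurableT_comp.
Qed.

Lemma ip_tube_space f g : L2 Omega f -> L2 Omega g ->
  ip (tube Omega J) (fun z => f (space z)) (fun z => g (space z)) = len * ip Omega f g.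
Proof.
move=> lf lg; have ifg := L2_integrableM mO lf lg.
have i1 := L2_integrableM mt (L2_tube_space lf) (L2_tube_space lg).
rewrite /ip {1}/Rintegral fubini_tube//.
have -> : (\int[leb]_(t in J) \int[lebesgue_rV d]_(x in Omega)
    (f (space (rcons_rV (x, t))) * g (space (rcons_rV (x, t))))%:E =
    \int[leb]_(t in J) cst (ip Omega f g)%:E t)%E.
  apply: eq_integral => t _ /=; rewrite /ip /Rintegral fineK ?integrable_fin_num//.
  by apply: eq_integral => x _; rewrite space_rcons.
by rewrite integral_cst// [X in (_ * X)%E]lenJ -EFinM/= mulrC.
Qed.

End space_functions.

Section abs_CS.
Context {R : realType} {n : nat}.
Local Notation mu := (lebesgue_rV n).
Variable D : set 'rV[R]_n.
Hypothesis mD : measurable D.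
Implicit Types f g w : 'rV[R]_n -> R.

Lemma L2_abs f : L2 D f -> L2 D (fun z => `|f z|).
Proof.
move=> lf; apply: (L2_dominated mD _ lf) => [|z _]; last by rewrite normr_id.
by apply: measurableT_comp => //; exact: (L2_mfun mD lf).
Qed.

Lemma normL2_abs f : normL2 D (fun z => `|f z|) = normL2 D f.
Proof.
apply/eqP; rewrite -(@eqrXn2 _ 2)// ?normL2_ge0// !normL2E //; apply/eqP.
by apply: eq_Rintegral => z _; rewrite -!expr2 -normrX ger0_norm ?sqr_ge0.
Qed.

Lemma integral_abs_CS f g : L2 D f -> L2 D g ->
  (\int[mu]_(z in D) `|f z * g z|%:E <= (normL2 D f * normL2 D g)%:E)%E.
Proof.
move=> lf lg; have laf := L2_abs lf; have lag := L2_abs lg.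
have i1 := L2_integrableM mD laf lag.
have := le_trans (ler_norm _) (ip_CS mD laf lag).
rewrite !normL2_abs -lee_fin; apply: le_trans.
rewrite /ip /Rintegral fineK ?integrable_fin_num//.
rewrite le_eqVlt; apply/orP; left; apply/eqP; apply: eq_integral => z _.
by rewrite normrM.
Qed.

Lemma normr_ip_le f g : L2 D f -> L2 D g ->
  (`|ip D f g|%:E <= \int[mu]_(z in D) `|f z * g z|%:E)%E.
Proof.
move=> lf lg; have i1 := L2_integrableM mD lf lg.
have := le_normr_Rintegral mD i1; rewrite -lee_fin => /le_trans; apply.
rewrite /Rintegral fineK//; apply: integrable_fin_num => //.
exact: (integrable_norm i1).
Qed.
End abs_CS.

Section late.
Context {R : realType} {d : nat}.
Local Notation mu := (lebesgue_rV d.+1).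
Local Notation leb := (@lebesgue_measure R).
Variables (Omega : set 'rV[R]_d) (T : R).
Hypotheses (oO : open Omega) (bO : bounded_set Omega) (T0 : 0 < T).
Local Notation Q := (cylinder Omega T).
Implicit Types (w : 'rV[R]_d.+1 -> R) (h : R).

Let mO : measurable Omega := open_measurable_rV oO.
Let mQ : measurable Q := open_measurable_rV (open_cylinder oO).
Let bQ : bounded_set Q := bounded_cylinder T bO.

Let mtube J : measurable J -> measurable (tube Omega J).
Proof. by move=> mJ; exact: measurable_tube. Qed.

Lemma late_len h : 0 < h -> leb `]T - h, T[%classic = h%:E.
Proof.
move=> h0; rewrite lebesgue_measure_itv/= lte_fin ltrBlDr ltrDl h0 -EFinD.
by rewrite opprB addrC subrK.
Qed.

Lemma final_sub h : h <= T -> tube Omega `]T - h, T[ `<=` Q.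
Proof. by move=> hT; apply: late_sub; rewrite subr_ge0. Qed.

(** From 2 * w z * w (tshift h z) <= w z ^+ 2 + w (tshift h z) ^+ 2: the norm of
    the translate over ]h, T[ is that of w over ]0, T - h[, and the slab at the
    top of the cylinder remains. *)
Lemma energy w h : 0 < h -> h < T -> L2 Q w ->
  2^-1 * normL2 (tube Omega `]T - h, T[) w ^+ 2 <=
  ip Q w w - ip (tube Omega `]h, T[) w (fun z => w (tshift h z)).
Proof.
move=> h0 hT lw.
have mP := mtube (measurable_itv `]h, T[).
have mM := mtube (measurable_itv `]0, T - h[).
have mM' := mtube (measurable_itv `]0, T - h]).
have mE := mtube (measurable_itv `]T - h, T[).
have subP := @late_sub _ _ Omega T h (ltW h0).
have Th : T - h < T by rewrite ltrBlDr ltrDl.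
have Th0 : 0 < T - h by rewrite subr_gt0.
have subM' : tube Omega `]0, T - h] `<=` Q by exact: early_sub.
have subMM : tube Omega `]0, T - h[ `<=` tube Omega `]0, T - h].
  by apply: subset_tube => t /=; rewrite !in_itv/= => /andP[-> /ltW].
have lP := L2S mQ mP subP lw.
have lM' := L2S mQ mM' subM' lw.
have lM := L2S mM' mM subMM lM'.
have sJ t : `]h, T[%classic t <-> `]0, T - h[%classic (t - h).
  by have := shiftJ h 0 (T - h) t; rewrite add0r subrK.
have lsh : L2 (tube Omega `]h, T[) (fun z => w (tshift h z)).
  exact: (L2_tshift oO _ _ sJ).
have H1 := le_trans (ler_norm _) (ip_CS mP lP lsh).
rewrite (normL2_tshift oO _ sJ) in H1 => //; last exact: L2_mfun mM _ lM.
have H2 := ip_split oO Th0 Th lw lw.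
rewrite -!normL2E// in H2 *.
have H3 := normL2S mQ mP subP lw.
have H4 := normL2S mM' mM subMM lM'.
have H5 := normL2_ge0 (tube Omega `]h, T[) w.
have H6 := normL2_ge0 (tube Omega `]0, T - h[) w.
have H7 : normL2 (tube Omega `]h, T[) w ^+ 2 <= normL2 Q w ^+ 2.
  by rewrite ler_pXn2r// nnegrE (le_trans H5).
have H8 : normL2 (tube Omega `]0, T - h[) w ^+ 2 <= normL2 (tube Omega `]0, T - h]) w ^+ 2.
  by rewrite ler_pXn2r// nnegrE (le_trans H6).
have := sqr_ge0 (normL2 (tube Omega `]h, T[) w - normL2 (tube Omega `]0, T - h[) w).
move: H1 H2 H7 H8; lra.
Qed.

(** w ^+ 2 >= 2 * w * psi - psi ^+ 2. The bound is linear in w, so that its limit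
    only requires weak convergence of the averages of w near the final time. *)
Lemma late_lower w (psi : 'rV[R]_d -> R) h : 0 < h -> h < T -> L2 Q w -> L2 Omega psi ->
  2 * ip (tube Omega `]T - h, T[) w (fun z => psi (space z)) - h * normL2 Omega psi ^+ 2 <=
  normL2 (tube Omega `]T - h, T[) w ^+ 2.
Proof.
move=> h0 hT lw lpsi; have mE := mtube (measurable_itv `]T - h, T[).
have lE := L2S mQ mE (final_sub (ltW hT)) lw.
have lp := L2_tube_space mO (measurable_itv `]T - h, T[) (late_len h0) lpsi.
have := @ip_ge0 _ _ (tube Omega `]T - h, T[) (fun z => w z - psi (space z)).
rewrite ipBl//; last exact: L2B.
rewrite !ipBr// (ipC _ (fun z => psi (space z)) w).
rewrite (ip_tube_space mO (measurable_itv `]T - h, T[) (late_len h0) lpsi lpsi).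
by rewrite -!normL2E//; lra.
Qed.

(** Almost every slice of w in the slab is some W t, which is close to W T in
    L^2(Omega) when the slab is thin; Tonelli gives the averages. *)
Lemma slices_average w (W : R -> 'rV[R]_d -> R) psi : L2 Q w -> L2 Omega psi ->
  continuous_slices Omega T w W ->
  ip (tube Omega `]T - step T n, T[) w (fun z => psi (space z)) / step T n @[n --> \oo] -->
  ip Omega (W T) psi.
Proof.
move=> lw lpsi [W0 WT Ww].
have T1 : 0 <= T <= T by rewrite ltW//= lexx.
have lW t : 0 <= t <= T -> L2 Omega (W t) by move=> /W0[[]].
apply/cvgrPdist_le => eps eps0.
pose del := eps / (normL2 Omega psi + 1).
have N0 : 0 < normL2 Omega psi + 1 by rewrite ltr_wpDl// normL2_ge0.
have del0 : 0 < del by rewrite divr_gt0.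
have := WT T T1 => /cvgrPdist_le/(_ _ del0).
rewrite near_withinE => -[r /= r0 Hr].
have /cvgrPdist_lt/(_ _ r0) Hs := step_cvg T.
near=> n.
have sr : step T n < r.
  have : `|0 - step T n| < r by near: n; exact: Hs.
  by rewrite sub0r normrN gtr0_norm ?step_gt0.
have h0 := step_gt0 T0 n; have hT := step_lt T0 n.
set h := step T n in sr h0 hT *.
have mJ : measurable `]T - h, T[%classic by [].
have mE := mtube mJ.
have lE := L2S mQ mE (final_sub (ltW hT)) lw.
have lp := L2_tube_space mO mJ (late_len h0) lpsi.
have lWT := L2_tube_space mO mJ (late_len h0) (lW _ T1).
have cl t : `]T - h, T[%classic t -> normL2 Omega (fun x => W t x - W T x) <= del.
  rewrite /= in_itv/= => /andP[t1 t2].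
  have t0 : 0 <= t by rewrite (le_trans _ (ltW t1))// subr_ge0 ltW.
  have : `|0 - normH1 Omega (W t \- W T)| <= del.
    apply: Hr => /=; last by rewrite in_itv/= t0 ltW.
    rewrite gtr0_norm ?subr_gt0//; move: t1 sr; lra.
  rewrite sub0r normrN ger0_norm ?sqrtr_ge0//; apply: le_trans.
  rewrite -[leLHS]ger0_norm ?normL2_ge0// -sqrtr_sqr ler_wsqrtr//.
  by rewrite lerDl sqr_ge0.
rewrite (_ : ip Omega (W T) psi = ip (tube Omega `]T - h, T[) (fun z => W T (space z))
    (fun z => psi (space z)) / h); last first.
  by rewrite (ip_tube_space mO mJ (late_len h0))// ?lW// mulrC mulKf// gt_eqF.
rewrite distrC -mulrBl -ipBl// normrM normfV (gtr0_norm h0) ler_pdivrMr//.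
rewrite -lee_fin; apply: le_trans (normr_ip_le mE (L2B mE lE lWT) lp) _.
have mF : measurable_fun (tube Omega `]T - h, T[)
    (fun z => `|(w z - W T (space z)) * psi (space z)|%:E).
  apply/measurable_EFinP; apply: measurableT_comp => //.
  apply: measurable_funM; last exact: (L2_mfun mE lp).
  exact: (L2_mfun mE (L2B mE lE lWT)).
rewrite tonelli_tube//.
apply: (@le_trans _ _ (\int[leb]_(t in `](T - h)%R, T[) (cst eps%:E t))%E); last first.
  by rewrite integral_cst// [X in (_ * X)%E]late_len// -EFinM.
apply: ae_ge0_le_integral => //.
- by move=> t _; apply: integral_ge0 => x _; rewrite lee_fin.
- exact: (measurable_tube_outer mO mJ mF).
- by move=> t _; rewrite lee_fin ltW.
move: Ww; apply: (@filterS _ _ (ae_filter_ringOfSetsType _)) => t Ht tJ; have tT : 0 < t < T.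
  move: tJ; rewrite /= in_itv/= => /andP[t1 ->]; rewrite andbT (le_lt_trans _ t1)//.
  by rewrite subr_ge0 ltW.
have tT' : 0 <= t <= T by case/andP: tT => /ltW -> /ltW ->.
have {}Ht := Ht tT.
have lWB := L2B mO (lW _ tT') (lW _ T1).
apply: (@le_trans _ _ (\int[lebesgue_rV d]_(x in Omega) `|(W t x - W T x) * psi x|%:E)%E).
  rewrite le_eqVlt; apply/orP; left; apply/eqP; apply: ae_eq_integral => //.
  - apply/measurable_EFinP; apply: measurableT_comp => //.
    apply: (@measurable_slice _ _ Omega `]T - h, T[%classic mO mJ _ _
      (fun z => (w z - W T (space z)) * psi (space z)) t tJ).
    apply: measurable_funM; last exact: (L2_mfun mE lp).
    exact: (L2_mfun mE (L2B mE lE lWT)).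
  - apply/measurable_EFinP; apply: measurableT_comp => //.
    apply: measurable_funM; last exact: (L2_mfun mO lpsi).
    exact: (L2_mfun mO lWB).
  - by apply: filterS Ht => x Hx Ox; rewrite !space_rcons (Hx Ox).
apply: (le_trans (integral_abs_CS mO lWB lpsi)); rewrite lee_fin.
have H1 := cl _ tJ.
apply: (@le_trans _ _ (del * (normL2 Omega psi + 1))).
  by rewrite ler_pM ?normL2_ge0// lerDl.
by rewrite /del divfK// gt_eqF.
Unshelve. all: by end_near. Qed.

(** The limit of the energy quotients dominates (a, psi) - 1/2 |psi|^2, a
    concave function of psi whose maximum 1/2 |a|^2 is reached at psi = a. A
    family of functions is considered at once because for the gradient only
    the sum over the components of the quotients is known to converge. *)
Lemma terminal m (w : 'I_m -> 'rV[R]_d.+1 -> R) (a : 'I_m -> 'rV[R]_d -> R)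
    (psi : 'I_m -> 'rV[R]_d -> R) (L : R) :
  (forall j, L2 Q (w j)) -> (forall j, L2 Omega (psi j)) ->
  (forall j, ip (tube Omega `]T - step T n, T[) (w j) (fun z => psi j (space z)) / step T n
     @[n --> \oo] --> ip Omega (a j) (psi j)) ->
  (\sum_j (ip Q (w j) (w j) -
     ip (tube Omega `]step T n, T[) (w j) (fun z => w j (tshift (step T n) z)))) / step T n
     @[n --> \oo] --> L ->
  \sum_j (ip Omega (a j) (psi j) - 2^-1 * normL2 Omega (psi j) ^+ 2) <= L.
Proof.
move=> lw lpsi ca cL.
have c1 : \sum_j (ip (tube Omega `]T - step T n, T[) (w j) (fun z => psi j (space z)) / step T n
   - 2^-1 * normL2 Omega (psi j) ^+ 2) @[n --> \oo] -->
   \sum_j (ip Omega (a j) (psi j) - 2^-1 * normL2 Omega (psi j) ^+ 2).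
  apply: cvg_big => [|j _]; first exact: add_continuous.
  by apply: cvgB; [exact: ca|exact: cvg_cst].
apply: (ler_cvg_to c1 cL); apply: nearW => n; rewrite mulr_suml.
apply: ler_sum => j _.
have h0 := step_gt0 T0 n; have hT := step_lt T0 n.
rewrite ler_pdivlMr// mulrBl divfK ?gt_eqF//.
have := energy h0 hT (lw j).
have := late_lower h0 hT (lw j) (lpsi j); lra.
Qed.

Lemma terminal_limit m (w : 'I_m -> 'rV[R]_d.+1 -> R) (a : 'I_m -> 'rV[R]_d -> R)
    (psi : nat -> 'I_m -> 'rV[R]_d -> R) (L : R) :
  (forall j, L2 Q (w j)) -> (forall j, L2 Omega (a j)) -> (forall k j, L2 Omega (psi k j)) ->
  (forall j, normL2 Omega (fun x => psi k j x - a j x) @[k --> \oo] --> (0 : R)) ->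
  (forall k j, ip (tube Omega `]T - step T n, T[) (w j) (fun z => psi k j (space z)) / step T n
     @[n --> \oo] --> ip Omega (a j) (psi k j)) ->
  (\sum_j (ip Q (w j) (w j) -
     ip (tube Omega `]step T n, T[) (w j) (fun z => w j (tshift (step T n) z)))) / step T n
     @[n --> \oo] --> L ->
  2^-1 * \sum_j normL2 Omega (a j) ^+ 2 <= L.
Proof.
move=> lw la lpsi cpsi ca cL.
have H k := terminal lw (lpsi k) (ca k) cL.
have c1 : \sum_j (ip Omega (a j) (psi k j) - 2^-1 * normL2 Omega (psi k j) ^+ 2) @[k --> \oo] -->
   \sum_j (ip Omega (a j) (a j) - 2^-1 * normL2 Omega (a j) ^+ 2).
  apply: cvg_big => [|j _]; first exact: add_continuous.
  apply: cvgB.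
    under eq_fun do rewrite ipC; apply: ip_cvg => //.
  apply: cvgMr; rewrite expr2; under eq_fun do rewrite expr2.
  by apply: cvgM; apply: normL2_cvg.
have H' : \sum_j (ip Omega (a j) (a j) - 2^-1 * normL2 Omega (a j) ^+ 2) <= L.
  by apply: (ler_cvg_to c1 (cvg_cst L)); exact: nearW.
apply: le_trans H'.
rewrite mulr_sumr; apply: ler_sum => j _; rewrite normL2E//; lra.
Qed.
End late.

(** * Calculus of the spatial divergence *)
Section divergence_calculus.
Context {R : realType} {d : nat}.
Local Notation mu := (lebesgue_rV d.+1).
Variables (Omega : set 'rV[R]_d) (T : R).
Hypotheses (oO : open Omega) (bO : bounded_set Omega).
Local Notation Q := (cylinder Omega T).
Implicit Types (y : 'rV[R]_d.+1 -> 'rV[R]_d) (w g : 'rV[R]_d.+1 -> R).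

Let oQ : open Q := open_cylinder oO.
Let mQ : measurable Q := open_measurable_rV oQ.
Let bQ : bounded_set Q := bounded_cylinder T bO.

Lemma divx_ip y phi : L2v Q y -> smooth phi ->
  \int[mu]_(z in Q) (\sum_j y z 0 j * partial (lift ord_max j) phi z) =
  \sum_j ip Q (fun z => y z 0 j) (partial (lift ord_max j) phi).
Proof.
move=> ly sphi; have := integrable_Rsum (index_enum 'I_d) mQ
  (fun j => L2_integrableM mQ (ly j) (smooth_L2 mQ bQ (smooth_partial (lift ord_max j) sphi))).
by case.
Qed.

Lemma is_divx_unique y g g' : is_divx Omega T y g -> is_divx Omega T y g' ->
  ae_eq mu Q g g'.
Proof.
move=> [lg Hg] [lg' Hg']; apply: (L2_test_unique oQ bQ) => // phi tphi.
by apply: oppr_inj; rewrite -[LHS]Hg// -[RHS]Hg'.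
Qed.

Lemma divxP y : has_divx Omega T y -> is_divx Omega T y (divx Omega T y).
Proof. by move=> Hg; apply: (@xgetPex _ (fun=> 0) [set g | is_divx Omega T y g] Hg). Qed.

Lemma divx_ae y g : is_divx Omega T y g -> ae_eq mu Q (divx Omega T y) g.
Proof. by move=> Hg; apply: is_divx_unique (Hg); apply: divxP; exists g. Qed.

Lemma is_divxB y y' g g' : L2v Q y -> L2v Q y' ->
  is_divx Omega T y g -> is_divx Omega T y' g' ->
  is_divx Omega T (fun z => y z - y' z) (fun z => g z - g' z).
Proof.
move=> ly ly' [lg Hg] [lg' Hg']; split; first exact: L2B.
move=> phi tphi; have lphi := test_L2 oQ bQ tphi; have [sphi _] := tphi.
have ld j := smooth_L2 mQ bQ (smooth_partial (lift ord_max j) sphi).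
have lyB : L2v Q (fun z => y z - y' z).
  move=> j; rewrite (_ : (fun z => _) = (fun z => y z 0 j - y' z 0 j)).
    exact: (L2B mQ (ly j) (ly' j)).
  by apply/funext => z; rewrite !mxE.
rewrite divx_ip// -[RHS]/(- ip Q (fun z => g z - g' z) phi) ipBl//.
rewrite -[ip Q g phi]opprK -[- ip Q g phi]Hg// -[ip Q g' phi]opprK -[- ip Q g' phi]Hg'//.
rewrite !divx_ip// opprB opprK addrC -sumrB; apply: eq_bigr => j _.
by rewrite -ipBl//; apply: ip_eq => z _ //; rewrite !mxE.
Qed.

Lemma is_divx_ae y y' g : L2v Q y -> L2v Q y' ->
  (forall j, ae_eq mu Q (fun z => y z 0 j) (fun z => y' z 0 j)) ->
  is_divx Omega T y g -> is_divx Omega T y' g.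
Proof.
move=> ly ly' yy [lg Hg]; split=> // phi tphi; rewrite -Hg//.
have [sphi _] := tphi; rewrite !divx_ip//; apply: eq_bigr => j _.
have ld := smooth_L2 mQ bQ (smooth_partial (lift ord_max j) sphi).
apply: (ae_eq_ip mQ).
- exact: (L2_mfun mQ (ly' j)).
- exact: (L2_mfun mQ (ly j)).
- exact: (L2_mfun mQ ld).
- exact: (L2_mfun mQ ld).
- by apply: filterS (yy j) => z H /H.
- by apply: nearW => z.
Qed.

(** A partial derivative as a divergence, so that [divx_lateral] also integrates
    by parts in one direction. *)
Lemma is_divx_coord w j g : L2 Q w -> is_weak_partial Q (lift ord_max j) w g ->
  is_divx Omega T (fun z => w z *: delta_mx 0 j) g.
Proof.
move=> lw [lg Hg]; split=> // phi tphi; rewrite -Hg//.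
apply: eq_Rintegral => z _; rewrite (bigD1 j)//= big1 ?addr0.
  by rewrite !mxE !eqxx mulr1.
by move=> i ij; rewrite !mxE (negbTE ij) andbF mulr0 mul0r.
Qed.

Lemma normL2v_ge n (D : set 'rV[R]_n) m (y : 'rV[R]_n -> 'rV[R]_m) j :
  normL2 D (fun z => y z 0 j) <= normL2v D y.
Proof.
rewrite -[leLHS]ger0_norm ?normL2_ge0// -sqrtr_sqr ler_wsqrtr//.
by rewrite (bigD1 j)//= lerDl sumr_ge0// => i _; exact: sqr_ge0.
Qed.

Lemma normL2v_sqr n (D : set 'rV[R]_n) m (y : 'rV[R]_n -> 'rV[R]_m) :
  normL2v D y ^+ 2 = \sum_j normL2 D (fun z => y z 0 j) ^+ 2.
Proof. by rewrite sqr_sqrtr// sumr_ge0// => i _; exact: sqr_ge0. Qed.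

(** Cauchy-Schwarz in L^2(D) for each component, then in R^m; the latter by
    2 (B a) (A b) <= (B a)^2 + (A b)^2, summed. *)
Lemma sum_ip_CS n (D : set 'rV[R]_n) m (y y' : 'rV[R]_n -> 'rV[R]_m) : measurable D ->
  L2v D y -> L2v D y' ->
  \sum_j ip D (fun z => y z 0 j) (fun z => y' z 0 j) <= normL2v D y * normL2v D y'.
Proof.
move=> mD ly ly'.
apply: (@le_trans _ _ (\sum_j normL2 D (fun z => y z 0 j) * normL2 D (fun z => y' z 0 j))).
  by apply: ler_sum => j _; apply: le_trans (ler_norm _) _; exact: ip_CS.
set a := fun j => normL2 D (fun z => y z 0 j); set b := fun j => normL2 D (fun z => y' z 0 j).
set A := normL2v D y; set B := normL2v D y'.
have A0 : 0 <= A by rewrite sqrtr_ge0.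
have B0 : 0 <= B by rewrite sqrtr_ge0.
have AE : \sum_j a j ^+ 2 = A ^+ 2 by rewrite normL2v_sqr.
have BE : \sum_j b j ^+ 2 = B ^+ 2 by rewrite normL2v_sqr.
have a0 j : 0 <= a j by exact: normL2_ge0.
have b0 j : 0 <= b j by exact: normL2_ge0.
have aA j : a j <= A by exact: normL2v_ge.
have bB j : b j <= B by exact: normL2v_ge.
have [/eqP A00|A00] := eqVneq A 0.
  rewrite big1 ?mulr_ge0// => j _; apply/eqP; rewrite mulf_eq0; apply/orP; left.
  by rewrite eq_le a0 andbT (le_trans (aA j))// (eqP A00).
have [/eqP B00|B00] := eqVneq B 0.
  rewrite big1 ?mulr_ge0// => j _; apply/eqP; rewrite mulf_eq0; apply/orP; right.
  by rewrite eq_le b0 andbT (le_trans (bB j))// (eqP B00).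
have Ap : 0 < A by rewrite lt_neqAle eq_sym A00.
have Bp : 0 < B by rewrite lt_neqAle eq_sym B00.
rewrite -(ler_pM2l (mulr_gt0 Ap Bp)) mulr_sumr.
have : \sum_j (A * B * (a j * b j)) <= \sum_j (2^-1 * (B ^+ 2 * a j ^+ 2 + A ^+ 2 * b j ^+ 2)).
  apply: ler_sum => j _; have := sqr_ge0 (B * a j - A * b j); lra.
move=> /le_trans; apply; rewrite -mulr_sumr big_split/= -!mulr_sumr AE BE; lra.
Qed.

(** [divx_shift] without translation. *)
Lemma sum_ip_gradx y g w (G : 'rV[R]_d.+1 -> 'rV[R]_d) phi :
  L2v Q y -> is_divx Omega T y g -> L2 Q w -> L2v Q G ->
  (forall k, lateral Omega (phi k)) ->
  normL2 Q (fun z => phi k z - w z) @[k --> \oo] --> (0 : R) ->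
  (forall j, normL2 Q (fun z => partial (lift ord_max j) (phi k) z - G z 0 j) @[k --> \oo]
     --> (0 : R)) ->
  \sum_j ip Q (fun z => y z 0 j) (fun z => G z 0 j) = - ip Q g w.
Proof.
move=> ly yg lw lG lphi cw cG.
have := divx_shift oO bO (lexx 0) ly yg lw lG lphi cw cG.
rewrite cylinderE (_ : (fun z => w (tshift 0 z)) = w).
  move=> <-; apply: eq_bigr => j _; congr ip; apply/funext => z.
  by rewrite /tshift scale0r subr0.
by apply/funext => z; rewrite /tshift scale0r subr0.
Qed.
End divergence_calculus.

(** * Approximation by smooth functions *)

(** The hypotheses control the weak derivative of phi - w, the integrations by
    parts use the classical derivative of phi. *)
Lemma normL2_partialB {R : realType} n (D : set 'rV[R]_n) i (w phi : 'rV[R]_n -> R) :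
  open D -> bounded_set D -> L2 D w -> has_weak_partial D i w -> smooth phi ->
  normL2 D (fun z => partial i phi z - weak_partial D i w z) =
  normL2 D (weak_partial D i (phi \- w)).
Proof.
move=> oD bD lw hw sphi; have mD := open_measurable_rV oD.
have wphi := smooth_weak_partial i mD bD sphi.
have lphi := smooth_L2 mD bD sphi.
have wB := is_weak_partialB oD bD lphi lw wphi (weak_partialP hw).
apply/esym/(normL2_ae oD).
- exact: (weak_partial_ae oD bD wB).
- have [lB _] : is_weak_partial D i (phi \- w) (weak_partial D i (phi \- w)).
    by apply: weak_partialP; exists (fun z => partial i phi z - weak_partial D i w z).
  exact: (L2_mfun mD lB).
- by have [lB _] := wB; exact: (L2_mfun mD lB).
Qed.

Lemma cvg0_le {R : realType} (a b : nat -> R) : (forall k, 0 <= a k) ->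
  (forall k, a k <= b k) -> b k @[k --> \oo] --> (0 : R) -> a k @[k --> \oo] --> (0 : R).
Proof.
move=> a0 ab cb; apply: (squeeze_cvgr _ (cvg_cst 0) cb); apply: nearW => k.
by rewrite a0 ab.
Qed.

Lemma normL2_cvgB {R : realType} n (D : set 'rV[R]_n) (f f' : nat -> 'rV[R]_n -> R)
    (w w' : 'rV[R]_n -> R) : measurable D ->
  (forall k, L2 D (f k)) -> (forall k, L2 D (f' k)) -> L2 D w -> L2 D w' ->
  normL2 D (fun z => f k z - w z) @[k --> \oo] --> (0 : R) ->
  normL2 D (fun z => f' k z - w' z) @[k --> \oo] --> (0 : R) ->
  normL2 D (fun z => (f k z - f' k z) - (w z - w' z)) @[k --> \oo] --> (0 : R).
Proof.
move=> mD lf lf' lw lw' c c'.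
have cc : normL2 D (fun z => f k z - w z) + normL2 D (fun z => f' k z - w' z)
    @[k --> \oo] --> (0 : R).
  by rewrite -[X in _ --> X](addr0 0); exact: cvgD.
apply: cvg0_le cc => k; first exact: normL2_ge0.
rewrite (normL2_distC (f' k) w' mD).
have := normL2_triangle mD (L2B mD (lf k) lw) (L2B mD lw' (lf' k)).
by congr (_ <= _); congr normL2; apply/funext => z; ring.
Qed.

Section approximation.
Context {R : realType} {d : nat}.
Local Notation mu := (lebesgue_rV d.+1).
Variables (Omega : set 'rV[R]_d) (T : R).
Hypotheses (oO : open Omega) (bO : bounded_set Omega).
Local Notation Q := (cylinder Omega T).
Implicit Types (w : 'rV[R]_d.+1 -> R).

Let oQ : open Q := open_cylinder oO.
Let mQ : measurable Q := open_measurable_rV oQ.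
Let bQ : bounded_set Q := bounded_cylinder T bO.
Let mO : measurable Omega := open_measurable_rV oO.

(** In this form the approximations of two functions can be subtracted, and
    [divx_shift] applies to them. *)
Lemma zero_on_Sigma_lateral w : L2H1 Omega T w -> zero_on_Sigma Omega T w <->
  exists phi : nat -> 'rV[R]_d.+1 -> R, [/\ forall k, lateral Omega (phi k),
    normL2 Q (fun z => phi k z - w z) @[k --> \oo] --> (0 : R) &
    forall j, normL2 Q (fun z => partial (lift ord_max j) (phi k) z - gradx Omega T w z 0 j)
      @[k --> \oo] --> (0 : R)].
Proof.
move=> [lw hw].
have E (phi : nat -> 'rV[R]_d.+1 -> R) j k : smooth (phi k) ->
    normL2 Q (fun z => partial (lift ord_max j) (phi k) z - gradx Omega T w z 0 j) =
    normL2 Q (fun z => gradx Omega T (phi k \- w) z 0 j).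
  move=> sp; rewrite (_ : (fun z => gradx _ _ _ z 0 j) =
      weak_partial Q (lift ord_max j) (phi k \- w)); last first.
    by apply/funext => z; rewrite mxE.
  rewrite -normL2_partialB//.
  by congr normL2; apply/funext => z; rewrite mxE.
split=> -[phi [lphi cw cG]]; exists phi; split=> //.
  move=> j; apply: cvg0_le cG => k; first exact: normL2_ge0.
  by have [sp _] := lphi k; rewrite (E phi)//; exact: normL2v_ge.
have cs : \sum_j normL2 Q (fun z => gradx Omega T (phi k \- w) z 0 j) ^+ 2
    @[k --> \oo] --> (0 : R).
  rewrite -[X in _ --> X](_ : \sum_(j < d) (0 : R) * 0 = 0); last first.
    by rewrite big1// => j _; rewrite mul0r.
  apply: cvg_big => [|j _]; first exact: add_continuous.
  under eq_fun => k do rewrite expr2.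
  have := cG j; rewrite (funext (fun k => E phi j k (proj1 (lphi k)))) => c.
  exact: cvgM.
have := cvg_comp _ _ cs (@sqrt_continuous R 0).
by rewrite sqrtr0.
Qed.

Lemma zero_on_Sigma0_smooth w : H1 Q w -> zero_on_Sigma0 Omega T w ->
  exists phi : nat -> 'rV[R]_d.+1 -> R, [/\ forall k, smooth (phi k),
    normL2 Q (fun z => phi k z - w z) @[k --> \oo] --> (0 : R),
    normL2 Q (fun z => partial ord_max (phi k) z - dt Omega T w z) @[k --> \oo] --> (0 : R) &
    normL2 Omega (fun x => phi k (rcons_rV (x, 0))) @[k --> \oo] --> (0 : R)].
Proof.
move=> [lw hw] [phi [sphi cH c0]]; exists phi; split=> //.
  apply: cvg0_le cH => k; first exact: normL2_ge0.
  rewrite -[leLHS]ger0_norm ?normL2_ge0// -sqrtr_sqr ler_wsqrtr//.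
  by rewrite lerDl sqr_ge0.
apply: cvg0_le cH => k; first exact: normL2_ge0.
rewrite /dt normL2_partialB//.
rewrite -[leLHS]ger0_norm ?normL2_ge0// -sqrtr_sqr ler_wsqrtr//.
rewrite ler_wpDl ?sqr_ge0// normL2v_sqr (bigD1 ord_max)//=.
rewrite (_ : (fun z => _) = weak_partial Q ord_max (phi k \- w)) ?lerDl ?sumr_ge0//.
  by move=> i _; exact: sqr_ge0.
by apply/funext => z; rewrite mxE.
Qed.

Lemma zero_on_SigmaB w w' : L2H1 Omega T w -> L2H1 Omega T w' ->
  zero_on_Sigma Omega T w -> zero_on_Sigma Omega T w' -> L2H1 Omega T (w \- w') ->
  zero_on_Sigma Omega T (w \- w').
Proof.
move=> hw hw' /(zero_on_Sigma_lateral hw)[phi [lphi cw cG]].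
move=> /(zero_on_Sigma_lateral hw')[phi' [lphi' cw' cG']] hB.
have [lw pw] := hw; have [lw' pw'] := hw'.
have sl f : lateral Omega f -> smooth f by case.
apply/(zero_on_Sigma_lateral hB); exists (fun k z => phi k z - phi' k z); split.
- move=> k; have [sp [K cK [KO K0]]] := lphi k.
  have [sp' [K' cK' [KO' K0']]] := lphi' k.
  split; first exact: smoothB.
  exists (K `|` K'); first exact: compactU.
  split=> [x [/KO|/KO']//|z /not_orP[Kz Kz']]; by rewrite K0// K0'// subr0.
- apply: (normL2_cvgB mQ _ _ lw lw') => // k.
    exact: (smooth_L2 mQ bQ (sl _ (lphi k))).
  exact: (smooth_L2 mQ bQ (sl _ (lphi' k))).
- move=> j.
  have lG := proj1 (weak_partialP (pw j)).
  have lG' := proj1 (weak_partialP (pw' j)).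
  have := normL2_cvgB mQ
    (fun k => smooth_L2 mQ bQ (smooth_partial (lift ord_max j) (sl _ (lphi k))))
    (fun k => smooth_L2 mQ bQ (smooth_partial (lift ord_max j) (sl _ (lphi' k)))) lG lG'.
  have EG v : (fun z => gradx Omega T v z 0 j) = weak_partial Q (lift ord_max j) v.
    by apply/funext => z; rewrite mxE.
  have := cG j; have := cG' j.
  under eq_fun => k do under [X in normL2 _ X]eq_fun do rewrite mxE.
  move=> c'.
  under eq_fun => k do under [X in normL2 _ X]eq_fun do rewrite mxE.
  move=> c /(_ c c'); apply: cvg_trans; apply: near_eq_cvg; apply: nearW => k /=.
  rewrite (partialB _ (sl _ (lphi k)) (sl _ (lphi' k))).
  apply: (normL2_ae oQ).
  + apply: filterS (weak_partialB oQ bQ lw lw' (pw j) (pw' j)) => z H Qz.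
    by rewrite mxE H.
  + apply: (L2_mfun mQ); apply: L2B => //; apply: L2B => //.
      exact: (smooth_L2 mQ bQ (smooth_partial (lift ord_max j) (sl _ (lphi k)))).
    exact: (smooth_L2 mQ bQ (smooth_partial (lift ord_max j) (sl _ (lphi' k)))).
  + apply: (L2_mfun mQ); apply: L2B => //.
      apply: L2B => //.
        exact: (smooth_L2 mQ bQ (smooth_partial (lift ord_max j) (sl _ (lphi k)))).
      exact: (smooth_L2 mQ bQ (smooth_partial (lift ord_max j) (sl _ (lphi' k)))).
    by rewrite EG; exact: (proj1 (weak_partialP (proj2 hB j))).
Qed.

Lemma zero_on_Sigma0B w w' : H1 Q w -> H1 Q w' ->
  zero_on_Sigma0 Omega T w -> zero_on_Sigma0 Omega T w' ->
  exists phi : nat -> 'rV[R]_d.+1 -> R, [/\ forall k, smooth (phi k),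
    normL2 Q (fun z => phi k z - (w \- w') z) @[k --> \oo] --> (0 : R),
    normL2 Q (fun z => partial ord_max (phi k) z - dt Omega T (w \- w') z)
      @[k --> \oo] --> (0 : R) &
    normL2 Omega (fun x => phi k (rcons_rV (x, 0))) @[k --> \oo] --> (0 : R)].
Proof.
move=> hw hw' /(zero_on_Sigma0_smooth hw)[phi [sphi cw cg c0]].
move=> /(zero_on_Sigma0_smooth hw')[phi' [sphi' cw' cg' c0']].
have [lw pw] := hw; have [lw' pw'] := hw'.
have ls k := smooth_L2 mQ bQ (sphi k).
have ls' k := smooth_L2 mQ bQ (sphi' k).
have ld k := smooth_L2 mQ bQ (smooth_partial ord_max (sphi k)).
have ld' k := smooth_L2 mQ bQ (smooth_partial ord_max (sphi' k)).
have lg := proj1 (weak_partialP (pw ord_max)).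
have lg' := proj1 (weak_partialP (pw' ord_max)).
have isB := is_weak_partialB oQ bQ lw lw' (weak_partialP (pw ord_max)) (weak_partialP (pw' ord_max)).
have lgB : L2 Q (dt Omega T (w \- w')).
  have hB : has_weak_partial Q ord_max (w \- w') by exists
    (fun z => weak_partial Q ord_max w z - weak_partial Q ord_max w' z).
  exact: (proj1 (weak_partialP hB)).
exists (fun k z => phi k z - phi' k z); split.
- by move=> k; exact: smoothB.
- exact: normL2_cvgB.
- have := normL2_cvgB mQ ld ld' lg lg' cg cg'.
  apply: cvg_trans; apply: near_eq_cvg; apply: nearW => k /=.
  rewrite (partialB _ (sphi k) (sphi' k)); apply: (normL2_ae oQ).
  + by apply: filterS (weak_partial_ae oQ bQ isB) => z H Qz; rewrite /dt H.
  + by apply: (L2_mfun mQ); apply: L2B => //; exact: L2B.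
  + by apply: (L2_mfun mQ); apply: L2B => //; exact: L2B.
- have l0 k := smooth_L2 mO bO (smooth_rcons 0 (sphi k)).
  have l0' k := smooth_L2 mO bO (smooth_rcons 0 (sphi' k)).
  have := @normL2_cvgB _ _ Omega (fun k x => phi k (rcons_rV (x, 0)))
    (fun k x => phi' k (rcons_rV (x, 0))) (fun=> 0) (fun=> 0) mO l0 l0' (L20 mO) (L20 mO).
  have s0 (f : nat -> 'rV[R]_d -> R) : (fun k => normL2 Omega (fun x => f k x - 0)) =
      (fun k => normL2 Omega (f k)).
    by apply/funext => k; congr normL2; apply/funext => x; rewrite subr0.
  by rewrite subrr !s0; apply.
Qed.
End approximation.

(** * Energy inequalities at the final time *)
Section identity.
Context {R : realType} {d : nat}.
Local Notation mu := (lebesgue_rV d.+1).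
Variables (Omega : set 'rV[R]_d) (T : R).
Hypotheses (oO : open Omega) (bO : bounded_set Omega) (T0 : 0 < T).
Local Notation Q := (cylinder Omega T).

Let oQ : open Q := open_cylinder oO.
Let mQ : measurable Q := open_measurable_rV oQ.
Let bQ : bounded_set Q := bounded_cylinder T bO.
Let mO : measurable Omega := open_measurable_rV oO.

Variables (e l : 'rV[R]_d.+1 -> R) (E : R -> 'rV[R]_d -> R).
Local Notation g := (dt Omega T e).
Local Notation G := (gradx Omega T e).
Hypotheses (H1e : H1 Q e) (e0 : zero_on_Sigma Omega T e) (le : is_divx Omega T G l)
  (cE : continuous_slices Omega T e E).
Variable psi : nat -> 'rV[R]_d.+1 -> R.
Hypotheses (spsi : forall k, smooth (psi k))
  (ce : normL2 Q (fun z => psi k z - e z) @[k --> \oo] --> (0 : R))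
  (cg : normL2 Q (fun z => partial ord_max (psi k) z - g z) @[k --> \oo] --> (0 : R))
  (c0 : normL2 Omega (fun x => psi k (rcons_rV (x, 0))) @[k --> \oo] --> (0 : R)).

Let L2e : L2 Q e. Proof. by case: H1e. Qed.
Let L2g : L2 Q g. Proof. by case: H1e => _ /(_ ord_max)/weak_partialP[]. Qed.
Let L2l : L2 Q l. Proof. by case: le. Qed.

Let GE j : (fun z => G z 0 j) = weak_partial Q (lift ord_max j) e.
Proof. by apply/funext => z; rewrite mxE. Qed.

Let wG j : is_weak_partial Q (lift ord_max j) e (fun z => G z 0 j).
Proof. by rewrite GE; apply: weak_partialP; case: H1e. Qed.

Let L2G : L2v Q G. Proof. by move=> j; case: (wG j). Qed.

Let T1 : 0 <= T <= T. Proof. by rewrite ltW//= lexx. Qed.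

Let H10T : H10 Omega (E T). Proof. by case: cE => /(_ _ T1). Qed.

Lemma final_test_functions : exists phi : nat -> 'rV[R]_d -> R,
  [/\ forall k, test_function Omega (phi k),
    normL2 Omega (fun x => phi k x - E T x) @[k --> \oo] --> (0 : R) &
    forall j, normL2 Omega (fun x => partial j (phi k) x - weak_grad Omega (E T) x 0 j)
      @[k --> \oo] --> (0 : R)].
Proof.
have [[lE wE] [phi [tphi cphi]]] := H10T; exists phi; split=> // [|j].
  apply: cvg0_le cphi => k; first exact: normL2_ge0.
  rewrite -[leLHS]ger0_norm ?normL2_ge0// -sqrtr_sqr ler_wsqrtr//.
  by rewrite lerDl sqr_ge0.
apply: cvg0_le cphi => k; first exact: normL2_ge0.
rewrite (_ : (fun x => _) = (fun x => partial j (phi k) x - weak_partial Omega j (E T) x)); last first.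
  by apply/funext => x; rewrite mxE.
have [sp _] := tphi k; rewrite normL2_partialB//.
rewrite -[leLHS]ger0_norm ?normL2_ge0// -sqrtr_sqr ler_wsqrtr//.
rewrite ler_wpDl ?sqr_ge0// normL2v_sqr (bigD1 j)//=.
rewrite (_ : (fun z => _) = weak_partial Omega j (phi k \- E T)) ?lerDl ?sumr_ge0//.
  by move=> i _; exact: sqr_ge0.
by apply/funext => z; rewrite mxE.
Qed.

(** [terminal_limit] for the single function e: its energy quotients tend to
    ip Q e g. *)
Lemma final_value_le : 2^-1 * normL2 Omega (E T) ^+ 2 <= ip Q e g.
Proof.
have [[lE _] _] := H10T; have [phi [tphi cphi _]] := final_test_functions.
have lphi k : L2 Omega (phi k) by exact: (test_L2 oO bO (tphi k)).
have := @terminal_limit _ _ Omega T oO T0 1 (fun=> e) (fun=> E T) (fun k _ => phi k) (ip Q e g).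
rewrite big_ord1; apply=> //.
- by move=> k _; exact: slices_average.
- under eq_fun => n do rewrite big_ord1.
  exact: (quotient_weak_cvg oO bO T0 L2e L2g spsi ce cg c0 L2e).
Qed.

(** [terminal_limit] for the components of the gradient of e. By [divx_shift] the
    sum of their energy quotients is the opposite of the difference quotient of
    e tested with l, whose limit is ip Q l g. In the averages near the final
    time, integrating by parts in space moves the derivative of e onto the test
    function, which reduces them to averages of e. *)
Lemma final_gradient_le :
  2^-1 * normL2v Omega (weak_grad Omega (E T)) ^+ 2 <= - ip Q l g.
Proof.
have [[lE wE] _] := H10T; have [phi [tphi cphi cDphi]] := final_test_functions.
have lphi k : L2 Omega (phi k) by exact: (test_L2 oO bO (tphi k)).
have tD k j := test_function_partial j (tphi k).
have lD k j : L2 Omega (partial j (phi k)) := test_L2 oO bO (tD k j).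
have wG0 j : is_weak_partial Omega j (E T) (fun x => weak_grad Omega (E T) x 0 j).
  rewrite (_ : (fun x => _) = weak_partial Omega j (E T)); first exact: weak_partialP.
  by apply/funext => x; rewrite mxE.
have [phi' [lat c' cG']] : exists phi : nat -> 'rV[R]_d.+1 -> R, [/\ forall k, lateral Omega (phi k),
    normL2 Q (fun z => phi k z - e z) @[k --> \oo] --> (0 : R) &
    forall j, normL2 Q (fun z => partial (lift ord_max j) (phi k) z - G z 0 j)
      @[k --> \oo] --> (0 : R)].
  apply/(zero_on_Sigma_lateral oO bO) => //; split=> // j.
  by case: H1e.
rewrite normL2v_sqr.
apply: (@terminal_limit _ _ Omega T oO T0 d (fun j z => G z 0 j)
  (fun j x => weak_grad Omega (E T) x 0 j) (fun k j => partial j (phi k))) => //.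
- by move=> j; case: (wG0 j).
- move=> k j; have [sp [K cK [KO K0]]] := tD k j.
  have -> : ip Omega (fun x => weak_grad Omega (E T) x 0 j) (partial j (phi k)) =
     - ip Omega (E T) (partial j (partial j (phi k))).
    have [_ Hw] := wG0 j; rewrite /ip (Hw _ (tD k j)) opprK.
    by [].
  have := slices_average oO T0 L2e (test_L2 oO bO (test_function_partial j (tD k j))) cE.
  move=> /cvgN; apply: cvg_trans; apply: near_eq_cvg; apply: nearW => n /=.
  rewrite -mulNr; congr (_ / _).
  have h0 := step_gt0 T0 n; have hT := step_lt T0 n.
  have a0 : 0 <= T - step T n by rewrite subr_ge0 ltW.
  have := @divx_lateral _ _ Omega T oO bO K (T - step T n) T
    (fun z => e z *: delta_mx 0 j) (fun z => G z 0 j) (fun z => partial j (phi k) (space z)).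
  move=> H; rewrite -[RHS]opprK -H//.
  + congr (- _); rewrite (bigD1 j)//= big1 ?addr0.
      rewrite partial_space; apply: ip_eq => // z _.
      by rewrite !mxE !eqxx mulr1.
    move=> i ij; rewrite /ip; under eq_Rintegral do rewrite !mxE (negbTE ij) andbF mulr0 mul0r.
    by rewrite /Rintegral integral0.
  + move=> i; rewrite (_ : (fun z => _) = (fun z => (i == j)%:R * e z)); last first.
      by apply/funext => z; rewrite !mxE eqxx mulrC.
    exact: (L2Z mQ).
  + exact: is_divx_coord.
  + exact: (smooth_space sp).
  + by move=> z; exact: K0.
- have := quotient_weak_cvg oO bO T0 L2e L2g spsi ce cg c0 L2l.
  move=> /cvgN; apply: cvg_trans; apply: near_eq_cvg; apply: nearW => n /=.
  rewrite sumrB -mulNr; congr (_ / _).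
  have h0 := ltW (step_gt0 T0 n).
  rewrite (divx_shift oO bO h0 L2G le L2e L2G lat c' cG').
  by rewrite (sum_ip_gradx oO bO L2G le L2e L2G lat c' cG')
    -[LHS]/(- (_ - _)) opprB opprK [RHS]addrC.
Qed.

End identity.

(** * The majorant *)

(** Young's inequality with weight gamma for 2 * x * (A + B), then with weight
    alpha for the cross term of (A + B) ^+ 2. *)
Lemma young {R : realType} (x A B P gamma alpha : R) : 0 < gamma -> 0 < alpha -> 2^-1 * P + x ^+ 2 <= x * (A + B) ->
  (2 - gamma^-1) * x ^+ 2 + P <= gamma * ((1 + alpha) * A ^+ 2 + (1 + alpha^-1) * B ^+ 2).
Proof.
move=> g0 a0 H.
have H1 : 2 * (x * (A + B)) <= gamma^-1 * x ^+ 2 + gamma * (A + B) ^+ 2.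
  rewrite -subr_ge0 (_ : _ - _ = gamma * (gamma^-1 * x - (A + B)) ^+ 2).
    by rewrite mulr_ge0 ?sqr_ge0// ltW.
  by field; rewrite gt_eqF.
have H2 : (A + B) ^+ 2 <= (1 + alpha) * A ^+ 2 + (1 + alpha^-1) * B ^+ 2.
  rewrite -subr_ge0 (_ : _ - _ = alpha * (A - alpha^-1 * B) ^+ 2).
    by rewrite mulr_ge0 ?sqr_ge0// ltW.
  by field; rewrite gt_eqF.
have {}H2 : gamma * (A + B) ^+ 2 <= gamma * ((1 + alpha) * A ^+ 2 + (1 + alpha^-1) * B ^+ 2).
  by rewrite ler_pM2l.
apply: le_trans H2; rewrite mulrBl.
move: H H1; move: (gamma^-1 * _) (gamma * _) (x * _) => p q r; lra.
Qed.
Theorem theorem2 (R : realType) (d : nat) (Omega : set 'rV[R]_d)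
    (T C_F lambda mu : R) (f u : 'rV[R]_d.+1 -> R)
    (hd : (1 <= d <= 3)%N)
    (hOmega : bounded_lipschitz_domain Omega)
    (hT : 0 < T)
    (hC_F : 0 < C_F) (hF : friedrichs Omega T C_F)
    (hlambda : 0 < lambda) (hmu : 0 < mu)
    (hf : L2 (cylinder Omega T) f)
    (hu : heat_solution Omega T f u)
    (v : 'rV[R]_d.+1 -> R) (y : 'rV[R]_d.+1 -> 'rV[R]_d)
    (hv : V00 Omega T v) (hy : Hdivx0 Omega T y)
    (E : R -> 'rV[R]_d -> R) :
  let Q := cylinder Omega T in
  let e := u \- v in
  continuous_slices Omega T e E ->
  forall gamma alpha1 alpha2 : R,
    2^-1 <= gamma -> 0 < alpha1 -> 0 < alpha2 ->
    (2 - gamma^-1) * (lambda * normL2v Q (gradx Omega T e) ^+ 2 +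
                      mu * normL2 Q (dt Omega T e) ^+ 2) +
      mu * normL2v Omega (weak_grad Omega (E T)) ^+ 2 +
      lambda * normL2 Omega (E T) ^+ 2
    <= majorant Omega T C_F lambda mu f v y gamma alpha1 alpha2.
Proof.
move=> Q e cE gamma alpha1 alpha2 gamma_ge a1 a2.
have [_ oO _ bO _] := hOmega.
have oQ : open Q := open_cylinder oO.
have mQ : measurable Q := open_measurable_rV oQ.
have bQ : bounded_set Q := bounded_cylinder T bO.
have [[[[lu wu] zu] du z0u] heat] := hu.
have [[[lv wv] zv] dv z0v] := hv.
have [ly dy] := hy.
have GE w j : (fun z => gradx Omega T w z 0 j) = weak_partial Q (lift ord_max j) w.
  by apply/funext => z; rewrite mxE.
have lG w : (forall i, has_weak_partial Q i w) -> L2v Q (gradx Omega T w).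
  by move=> hw j; rewrite GE; case: (weak_partialP (hw (lift ord_max j))).
have we i : has_weak_partial Q i e.
  exists (fun z => weak_partial Q i u z - weak_partial Q i v z).
  by apply: (is_weak_partialB oQ bQ) => //; exact: weak_partialP.
have le : L2 Q e by exact: (L2B mQ lu lv).
have lGu := lG u wu; have lGv := lG v wv; have lGe := lG e we.
have lgv : L2 Q (dt Omega T v) by case: (weak_partialP (wv ord_max)).
have lg : L2 Q (dt Omega T e) by case: (weak_partialP (we ord_max)).
have LBv (y1 y2 : 'rV[R]_d.+1 -> 'rV[R]_d) : L2v Q y1 -> L2v Q y2 -> L2v Q (fun z => y1 z - y2 z).
  move=> l1 l2 j; rewrite (_ : (fun z => _) = (fun z => y1 z 0 j - y2 z 0 j)).
    exact: (L2B mQ (l1 j) (l2 j)).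
  by apply/funext => z; rewrite !mxE.
have ze : zero_on_Sigma Omega T e.
  by apply: (zero_on_SigmaB oO bO) => //; split=> // j.
pose l := fun z => lapx Omega T u z - lapx Omega T v z.
have lapu := divxP du; have lapv := divxP dv; have divy := divxP dy.
have ldy : L2 Q (divx Omega T y) by case: divy.
have lape : is_divx Omega T (gradx Omega T e) l.
  have lapB := is_divxB oO bO lGu lGv lapu lapv.
  have lGB := LBv _ _ lGu lGv.
  have aeG j : ae_eq (lebesgue_rV d.+1) Q
      (fun z => (gradx Omega T u z - gradx Omega T v z) 0 j) (fun z => gradx Omega T e z 0 j).
    apply: filterS (weak_partialB oQ bQ lu lv (wu (lift ord_max j)) (wv (lift ord_max j))).
    by move=> z H Qz; rewrite !mxE [RHS]H.
  exact: (is_divx_ae oO bO lGB lGe aeG lapB).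
have ll : L2 Q l by case: lape.
have [phi [sphi ce cg c0]] : exists phi : nat -> 'rV[R]_d.+1 -> R, [/\ forall k, smooth (phi k),
    normL2 Q (fun z => phi k z - e z) @[k --> \oo] --> (0 : R),
    normL2 Q (fun z => partial ord_max (phi k) z - dt Omega T e z) @[k --> \oo] --> (0 : R) &
    normL2 Omega (fun x => phi k (rcons_rV (x, 0))) @[k --> \oo] --> (0 : R)].
  exact: (zero_on_Sigma0B oO bO).
have final := final_value_le oO bO hT (conj le we) cE sphi ce cg c0.
have final_grad := final_gradient_le oO bO hT (conj le we) ze lape cE sphi ce cg c0.
have [psi [lpsi cpsi cGpsi]] := (zero_on_Sigma_lateral oO bO (conj le (fun j => we (lift ord_max j)))).1 ze.
rewrite /majorant -/Q; set r_eq := (fun z => f z - _ + _); set r_d := (fun z => y z - _).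
have lreq : L2 Q r_eq := L2D mQ (L2B mQ hf lgv) ldy.
have lrd : L2v Q r_d := LBv _ _ ly lGv.
have divrd0 : is_divx Omega T r_d (fun z => divx Omega T y z - lapx Omega T v z).
  exact: (is_divxB oO bO ly lGv divy lapv).
have divrd : is_divx Omega T r_d (divx Omega T r_d).
  by apply: divxP; exists (fun z => divx Omega T y z - lapx Omega T v z).
have ldrd : L2 Q (divx Omega T r_d) by case: divrd.
(* the heat equation eliminates f from r_eq *)
have key : ae_eq (lebesgue_rV d.+1) Q (fun z => dt Omega T e z - l z)
    (fun z => r_eq z - divx Omega T r_d z).
  have A1 := weak_partialB oQ bQ lu lv (wu ord_max) (wv ord_max).
  have A2 := divx_ae oO bO divrd0.
  have A12 : {ae lebesgue_rV d.+1, forall z, Q z ->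
      dt Omega T e z = dt Omega T u z - dt Omega T v z /\
      divx Omega T r_d z = divx Omega T y z - lapx Omega T v z}.
    by apply: filterS2 A1 A2 => z H1 H2 Qz; split; [exact: H1|exact: H2].
  apply: filterS2 A12 heat => z H12 H3 Qz.
  have [E1 E2] := H12 Qz.
  rewrite E1 E2 /l /r_eq -(H3 Qz).
  move: (dt Omega T u z) (dt Omega T v z) (lapx Omega T u z) (lapx Omega T v z).
  move: (divx Omega T y z) => a1' a2' a3' a4' a5'.
  ring.
have lgl := L2B mQ lg ll; have lrr := L2B mQ lreq ldrd.
have keyip w : L2 Q w -> ip Q w (dt Omega T e) - ip Q w l =
    ip Q w r_eq - ip Q w (divx Omega T r_d).
  move=> lw; rewrite -!ipBr//; apply: (ae_eq_ip mQ) => //; try exact: L2_mfun.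
  by apply: nearW => z.
set nG := normL2v Q (gradx Omega T e); set ng := normL2 Q (dt Omega T e).
have nGE : nG ^+ 2 = - ip Q l e.
  rewrite -(sum_ip_gradx oO bO lGe lape le lGe lpsi cpsi cGpsi) normL2v_sqr.
  by apply: eq_bigr => j _; rewrite normL2E.
have ngE : ng ^+ 2 = ip Q (dt Omega T e) (dt Omega T e) by rewrite normL2E.
have nreq0 := normL2_ge0 Q r_eq.
have gamma0 : 0 < gamma by rewrite (lt_le_trans _ gamma_ge).
(* the identity above tested with e; the divergence of r_d is integrated by
   parts back onto the gradient of e *)
have est1 : 2^-1 * normL2 Omega (E T) ^+ 2 + nG ^+ 2 <=
    nG * (normL2v Q r_d + C_F * normL2 Q r_eq).
  apply: (@le_trans _ _ (ip Q e r_eq - ip Q e (divx Omega T r_d))).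
    by rewrite -keyip// nGE (ipC _ l e) lerD2r.
  rewrite mulrDr addrC; apply: lerD.
    rewrite (ipC _ e) -(sum_ip_gradx oO bO lrd divrd le lGe lpsi cpsi cGpsi) mulrC.
    exact: sum_ip_CS.
  apply: (le_trans (ler_norm _)); apply: (le_trans (ip_CS mQ le lreq)).
  rewrite mulrA ler_wpM2r// mulrC.
  by apply: hF => //; split=> // j.
(* the same identity tested with the time derivative of e *)
have est2 : 2^-1 * normL2v Omega (weak_grad Omega (E T)) ^+ 2 + ng ^+ 2 <=
    ng * (normL2 Q (divx Omega T r_d) + normL2 Q r_eq).
  apply: (@le_trans _ _ (ip Q (dt Omega T e) r_eq - ip Q (dt Omega T e) (divx Omega T r_d))).
    by rewrite -keyip// ngE (ipC _ _ l) addrC lerD2l.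
  rewrite mulrDr addrC; apply: lerD.
    by rewrite (le_trans (ler_norm _))// normrN; exact: ip_CS.
  by apply: (le_trans (ler_norm _)); exact: ip_CS.
have Y1 := young gamma0 a1 est1.
have Y2 := young gamma0 a2 est2.
have {}Y1 := ler_wpM2l (ltW hlambda) Y1.
have {}Y2 := ler_wpM2l (ltW hmu) Y2.
have := lerD Y1 Y2.
rewrite exprMn; move: (nG ^+ 2) (ng ^+ 2) (normL2v Q r_d ^+ 2) (normL2 Q r_eq ^+ 2).
move: (normL2 Q (divx Omega T r_d) ^+ 2) (normL2v Omega _ ^+ 2) (normL2 Omega _ ^+ 2).
by move=> x1 x2 x3 x4 x5 x6 x7; congr (_ <= _); ring.
Qed.
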